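(* Let $n,m\in\mathbb{N}$, let $p\ge1$, let $Q\subset\mathbb{R}^m$ be a convex body containing the origin in its interior, and let $\Omega\subset\mathbb{R}^n$ be a bounded open set. Then there exists a constant $d=d(Q,p,\Omega)>0$ such that $$\lambda_{1,p}(\Omega)\ \ge\ \lambda^{\mathcal A}_{1,p}(Q,\Omega)\ \ge\ d\left(\lambda_{1,p}(\Omega)\right)^{\frac1{nm}}.$$
   Context: Elements of $\mathbb{R}^{nm}$ are identified with real $n\times m$ matrices $\theta=(\theta_1,\dots,\theta_m)$ with columns $\theta_i\in\mathbb{R}^n$, so $\theta^tv\in\mathbb{R}^m$ for $v\in\mathbb{R}^n$; $\mathbb{S}^{nm-1}$ is the Euclidean unit sphere of $\mathbb{R}^{nm}$ and $d\theta$ is spherical Lebesgue measure. $B_2^n$ is the Euclidean unit ball and $\omega_n=\operatorname{vol}_n(B_2^n)$. A convex body is a compact convex set with non-empty interior; its support function is $h_K(u)=\sup_{y\in K}\langle y,u\rangle$. For $p>1$, $W_0^{1,p}(\Omega)$ is the completion of $C_0^\infty(\Omega)$ in the norm $\||\nabla f|\|_{L^p(\Omega)}$, its elements being extended by zero to $\mathbb{R}^n$; for $p=1$ the space $W_0^{1,1}(\Omega)$ is replaced everywhere by $\operatorname{BV}(\Omega)$, understood as the functions in $\operatorname{BV}(\mathbb{R}^n)$ vanishing a.e. outside $\Omega$. Write $\|h_Q(\theta^t\nabla f(\cdot))\|_{L^p(\mathbb{R}^n)}=\left(\int_{\mathbb{R}^n}h_Q(\theta^t\nabla f(x))^pdx\right)^{1/p}$;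 for $p=1$ and $f\in\operatorname{BV}(\mathbb{R}^n)$ this means $\int_{\mathbb{R}^n}h_Q(\theta^t\eta_f)\,d|Df|$, where $|Df|$ is the variation measure and $\eta_f$ the Radon–Nikodym derivative of $Df$ with respect to $|Df|$, and $\||\nabla f|\|_{L^1}$ means the total variation $|Df|(\mathbb{R}^n)$. Let $\Pi^\circ_{Q,p}B_2^n\subset\mathbb{R}^{nm}$ be the convex body with gauge $\|\theta\|_{\Pi^\circ_{Q,p}B_2^n}=\left(\int_{\mathbb{S}^{n-1}}h_Q(\theta^tv)^pdv\right)^{1/p}$. Set $d_{n,p}(Q)=(n\omega_n)^{1/p}\left(nm\operatorname{vol}_{nm}(\Pi^\circ_{Q,p}B_2^n)\right)^{1/(nm)}$ and $$\mathcal{E}_{Q,p}f=d_{n,p}(Q)\left(\int_{\mathbb{S}^{nm-1}}\|h_Q(\theta^t\nabla f(\cdot))\|_{L^p(\mathbb{R}^n)}^{-nm}d\theta\right)^{-\frac1{nm}}.$$ Set $$\lambda^{\mathcal A}_{1,p}(Q,\Omega)=\inf\left\{\frac{(\mathcal{E}_{Q,p}f)^p}{\|f\|^p_{L^p(\Omega)}}: f\in W^{1,p}_0(\Omega)\setminus\{0\}\right\},\qquad \lambda_{1,p}(\Omega)=\inf\left\{\frac{\||\nabla f|\|^p_{L^p}}{\|f\|^p_{L^p(\Omega)}}: f\in W^{1,p}_0(\Omega)\setminus\{0\}\right\}.$$ *)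

(* Defs.v *)
From HB Require Import structures.
From mathcomp Require Import all_boot all_order all_algebra.
From mathcomp Require Import all_classical all_reals all_analysis.
From mathcomp Require Import measurable_realfun ring.
Set Implicit Arguments.
Unset Strict Implicit.
Unset Printing Implicit Defensive.
Import Order.TTheory GRing.Theory Num.Theory.
Import numFieldNormedType.Exports.
Local Open Scope classical_set_scope.
Local Open Scope ring_scope.

Definition mx_display : measure_display -> measure_display.
Proof. exact. Qed.

Section measurable_matrix.
Context {d} {T : measurableType d} (m n : nat).

(* over a real type, they generate the Borel sets *)
Definition mx_cylinders : set (set 'M[T]_(m, n)) :=
  [set A | exists i j, exists2 B, measurable B &
           A = [set M : 'M[T]_(m, n) | B (M i j)]].

HB.instance Definition _ := @isMeasurable.Build (mx_display d)
  'M[T]_(m, n) <<s mx_cylinders >>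
  (@sigma_algebra0 _ setT mx_cylinders)
  (@sigma_algebraC _ mx_cylinders)
  (@sigma_algebra_bigcup _ setT mx_cylinders).

Lemma measurable_mx_coord i j :
  measurable_fun [set: 'M[T]_(m, n)] (fun M : 'M[T]_(m, n) => M i j).
Proof.
move=> _ B mB; rewrite setTI; apply: sub_sigma_algebra.
by exists i, j, B.
Qed.

Lemma measurable_fun_mx d' (S : measurableType d') (f : S -> 'M[T]_(m, n)) :
  (forall i j, measurable_fun [set: S] (fun x => f x i j)) ->
  measurable_fun [set: S] f.
Proof.
move=> mf; apply: (@measurability _ _ _ _ _ _ mx_cylinders) => //.
move=> _ [_ [i [j [B mB ->]]] <-]; rewrite setTI.
by have := mf i j measurableT B mB; rewrite setTI.
Qed.

End measurable_matrix.

Section pushforward_sigma_finite.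
Context d1 d2 (T1 : measurableType d1) (T2 : measurableType d2) (R : realType).
Variable mu : {measure set T1 -> \bar R}.
Hypothesis smu : sigma_finite setT mu.
Variables (f : T1 -> T2) (g : T2 -> T1).
Hypotheses (mf : measurable_fun setT f) (mg : measurable_fun setT g).
Hypothesis fK : cancel f g.

(* the proofs are recorded so that [transport] carries its
   sigma-finite measure structure canonically *)
Definition transport & sigma_finite setT mu & measurable_fun setT f &
  measurable_fun setT g & cancel f g : set T2 -> \bar R := pushforward mu f.

Local Notation nu := (transport smu mf mg fK).

Let nu0 : nu set0 = 0%E.
Proof. by rewrite /transport /pushforward preimage_set0 measure0. Qed.

Let nu_ge0 A : (0 <= nu A)%E. Proof. exact: measure_ge0. Qed.

Let nu_sigma_additive : semi_sigma_additive nu.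
Proof.
rewrite /transport => F mF tF mUF; rewrite /pushforward preimage_bigcup.
apply: measure_semi_sigma_additive.
- by move=> n; rewrite -[X in measurable X]setTI; exact: mf.
- apply/trivIsetP => /= i j _ _ ij; rewrite -preimage_setI.
  by move/trivIsetP : tF => /(_ _ _ _ _ ij) ->//; rewrite preimage_set0.
- by rewrite -preimage_bigcup -[X in measurable X]setTI; exact: mf.
Qed.

HB.instance Definition _ := isMeasure.Build _ _ _ nu nu0 nu_ge0 nu_sigma_additive.

Let nu_sigma_finite : sigma_finite setT nu.
Proof.
have [F FT mF] := smu.
exists (fun k => g @^-1` F k).
  by rewrite -preimage_bigcup -FT preimage_setT.
move=> k; have [mFk Fk] := mF k; split.
  by rewrite -[X in measurable X]setTI; exact: mg.
rewrite /transport /pushforward -comp_preimage.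
by rewrite (_ : g \o f = id)//; apply/funext => x /=; rewrite fK.
Qed.

HB.instance Definition _ := Measure_isSigmaFinite.Build _ _ _ nu nu_sigma_finite.

End pushforward_sigma_finite.

Section lebesgue_measure_mx.
Context {R : realType}.
Local Notation mR := (measurableTypeR R).

Definition cons_vec k (p : mR * 'rV[R]_k) : 'rV[R]_k.+1 :=
  row_mx (const_mx p.1 : 'rV_1) p.2.

Definition uncons_vec k (v : 'rV[R]_k.+1) : mR * 'rV[R]_k :=
  (v 0 0, rsubmx (v : 'rV_(1 + k))).

Lemma cons_vecK k : cancel (@cons_vec k) (@uncons_vec k).
Proof.
move=> [x v]; rewrite /uncons_vec /cons_vec row_mxKr; congr pair.
transitivity (row_mx (const_mx x : 'rV[R]_1) v 0 (lshift k 0)).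
  by congr (_ _ _); exact/val_inj.
by rewrite row_mxEl mxE.
Qed.

Lemma measurable_cons_vec k : measurable_fun setT (@cons_vec k).
Proof.
apply: measurable_fun_mx => i j; rewrite /cons_vec.
under eq_fun do rewrite mxE.
case: (fintype.split (j : 'I_(1 + k))) => l.
  under eq_fun do rewrite mxE.
  exact: measurable_fst.
exact: measurableT_comp (measurable_mx_coord _ _) measurable_snd.
Qed.

Lemma measurable_uncons_vec k : measurable_fun setT (@uncons_vec k).
Proof.
apply/measurable_fun_pairP; split; first exact: measurable_mx_coord.
apply: measurable_fun_mx => i j /=.
by under eq_fun do rewrite mxE; exact: measurable_mx_coord.
Qed.

Lemma measurable_vec_mx a b :
  measurable_fun setT (vec_mx : 'rV[R]_(a * b) -> 'M[R]_(a, b)).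
Proof.
apply: measurable_fun_mx => i j; under eq_fun do rewrite mxE.
exact: measurable_mx_coord.
Qed.

Lemma measurable_mxvec a b :
  measurable_fun setT (mxvec : 'M[R]_(a, b) -> 'rV[R]_(a * b)).
Proof.
apply: measurable_fun_mx => i j; rewrite ord1.
case/mxvec_indexP: j => k l; under eq_fun do rewrite mxvecE.
exact: measurable_mx_coord.
Qed.

Lemma sigma_finite_lebesgue_prod k
    (mu : {sigma_finite_measure set 'rV[R]_k -> \bar R}) :
  sigma_finite setT (@lebesgue_measure R \x mu)%E.
Proof.
have /sigma_finiteP[F [TF ndF Foo]] := sigma_finiteT (@lebesgue_measure R).
have /sigma_finiteP[G [TG ndG Goo]] := sigma_finiteT mu.
exists (fun i => F i `*` G i).
  rewrite -setXTT TF TG predeqE => -[x y]; split.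
    move=> [/= [i _ Fix] [l _ Gly]]; exists (maxn i l) => //; split.
    - by move: x Fix; exact/subsetPset/ndF/leq_maxl.
    - by move: y Gly; exact/subsetPset/ndG/leq_maxr.
  by move=> [i _ []/= ? ?]; split; exists i.
move=> i; have [? ?] := Foo i; have [? ?] := Goo i.
split; first exact: measurableX.
by rewrite product_measure1E// lte_mul_pinfty// ge0_fin_numE.
Qed.

Definition lebesgue_cons k
    (mu : {sigma_finite_measure set 'rV[R]_k -> \bar R}) :
    {sigma_finite_measure set 'rV[R]_k.+1 -> \bar R} :=
  transport (sigma_finite_lebesgue_prod mu) (@measurable_cons_vec k)
    (@measurable_uncons_vec k) (@cons_vecK k).

Fixpoint lebesgue_rv k : {sigma_finite_measure set 'rV[R]_k -> \bar R} :=
  match k with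
  | 0 => dirac (0 : 'rV[R]_0)
  | k'.+1 => lebesgue_cons (lebesgue_rv k')
  end.

Definition lebesgue_mx a b : set 'M[R]_(a, b) -> \bar R :=
  transport (sigma_finiteT (lebesgue_rv (a * b))) (@measurable_vec_mx a b)
    (@measurable_mxvec a b) (@vec_mxK R a b).

HB.instance Definition _ a b := SigmaFiniteMeasure.on (@lebesgue_mx a b).

End lebesgue_measure_mx.

Section euclidean.
Context {R : realType}.

Definition enorm a b (M : 'M[R]_(a, b)) : R :=
  Num.sqrt (\sum_i \sum_j M i j ^+ 2).

Definition dotv k (u v : 'rV[R]_k) : R := \sum_j u 0 j * v 0 j.

Definition eball a b : set 'M[R]_(a, b) := [set M | enorm M <= 1].

Definition esphere a b : set 'M[R]_(a, b) := [set M | enorm M = 1].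

Lemma measurable_enorm a b : measurable_fun setT (@enorm a b).
Proof.
apply: (@measurableT_comp _ _ _ _ _ _ (@Num.sqrt R)).
  by apply: continuous_measurable_fun; exact: sqrt_continuous.
apply: measurable_sum => i; apply: measurable_sum => j.
exact: measurable_funX (measurable_mx_coord i j).
Qed.

Lemma measurable_eball a b : measurable (@eball a b).
Proof.
rewrite /eball -[X in measurable X]setTI.
have := @measurable_enorm a b measurableT [set` `]-oo, 1]] (measurable_itv _).
by congr measurable; apply/seteqP; split => M /=; rewrite in_itv.
Qed.

Definition radial a b (M : 'M[R]_(a, b)) : 'M[R]_(a, b) := (enorm M)^-1 *: M.

Lemma measurable_radial a b : measurable_fun setT (@radial a b).
Proof.
apply: measurable_fun_mx => i j; under eq_fun do rewrite mxE.
apply: measurable_funM; last exact: measurable_mx_coord.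
rewrite (_ : (fun _ => _) = (@powR R)^~ (-1) \o @enorm a b).
  exact: measurableT_comp (measurable_powR _) (@measurable_enorm a b).
by apply/funext => M /=; rewrite powR_inv1 ?sqrtr_ge0.
Qed.

(* surface measure of the unit sphere of the (a * b)-dimensional space, carried
   by [esphere a b]: a Borel set [A] of directions has measure [a * b] times the
   volume of the cone over [A] in the unit ball (for [a * b = 1], the counting
   measure of {-1, 1}) *)
Definition sphere_measure a b (A : set 'M[R]_(a, b)) : \bar R :=
  ((a * b)%:R%:E *
   @lebesgue_mx R a b (@eball a b `&` (@radial a b @^-1` A)))%E.

Section sphere_measure.
Variables a b : nat.
Local Open Scope ereal_scope.

Let mpre (A : set 'M[R]_(a, b)) : measurable A ->
  measurable (@eball a b `&` @radial a b @^-1` A).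
Proof.
move=> mA; apply: measurableI; first exact: measurable_eball.
by rewrite -[X in measurable X]setTI; exact: measurable_radial.
Qed.

Let sphere0 : @sphere_measure a b set0 = 0.
Proof. by rewrite /sphere_measure preimage_set0 setI0 measure0 mule0. Qed.

Let sphere_ge0 A : 0 <= @sphere_measure a b A.
Proof. exact: mule_ge0. Qed.

Let sphere_sigma_additive : semi_sigma_additive (@sphere_measure a b).
Proof.
move=> F mF tF mUF; rewrite /sphere_measure.
under eq_fun do rewrite -ge0_sume_distrr//.
rewrite preimage_bigcup setI_bigcupr; apply: cvgeZl => //.
apply: measure_semi_sigma_additive.
- by move=> n; exact: mpre.
- apply/trivIsetP => /= i j _ _ ij; rewrite setIACA -preimage_setI.
  by move/trivIsetP : tF => /(_ _ _ _ _ ij) ->//; rewrite preimage_set0 setI0.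
- by rewrite -setI_bigcupr -preimage_bigcup; exact: mpre.
Qed.

HB.instance Definition _ := isMeasure.Build _ _ _ (@sphere_measure a b)
  sphere0 sphere_ge0 sphere_sigma_additive.

End sphere_measure.

End euclidean.

Section enorm_theory.
Context {R : realType}.

Lemma enorm_rvE k (v : 'rV[R]_k) : enorm v = Num.sqrt (dotv v v).
Proof. by rewrite /enorm big_ord1; congr Num.sqrt; apply: eq_bigr. Qed.

Lemma enorm_rv_sqr k (v : 'rV[R]_k) : enorm v ^+ 2 = dotv v v.
Proof.
by rewrite enorm_rvE sqr_sqrtr// sumr_ge0// => i _; rewrite -expr2 sqr_ge0.
Qed.

Lemma dotv_le_enorm k (u v : 'rV[R]_k) : dotv u v <= enorm u * enorm v.
Proof.
set a := enorm u; set b := enorm v.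
have a0 : 0 <= a by exact: sqrtr_ge0.
have b0 : 0 <= b by exact: sqrtr_ge0.
have dot0 (w z : 'rV[R]_k) : enorm w = 0 -> dotv w z = 0.
  move=> w0; have : dotv w w = 0 by rewrite -enorm_rv_sqr w0 expr0n.
  move/eqP; rewrite psumr_eq0; last by move=> i _; rewrite -expr2 sqr_ge0.
  move=> /allP w00; rewrite /dotv big1// => i _.
  have := w00 i; rewrite mem_index_enum => /(_ isT) /=.
  by rewrite mulf_eq0 orbb => /eqP ->; rewrite mul0r.
have dotC (w z : 'rV[R]_k) : dotv w z = dotv z w.
  by apply: eq_bigr => i _; rewrite mulrC.
have [a00|an0] := eqVneq a 0; first by rewrite dot0// a00 mul0r.
have [b00|bn0] := eqVneq b 0; first by rewrite dotC dot0// b00 mulr0.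
have ab0 : 0 < a * b by rewrite mulr_gt0// lt0r ?an0 ?bn0.
have : 0 <= \sum_i (b * u 0 i - a * v 0 i) ^+ 2.
  by apply: sumr_ge0 => i _; exact: sqr_ge0.
have -> : \sum_i (b * u 0 i - a * v 0 i) ^+ 2 =
    b ^+ 2 * dotv u u - (a * b) * dotv u v *+ 2 + a ^+ 2 * dotv v v.
  rewrite /dotv !mulr_sumr -sumrMnl -sumrB -big_split/=.
  by apply: eq_bigr => i _; ring.
rewrite -!enorm_rv_sqr -/a -/b (mulrC (b ^+ 2)) addrAC -mulr2n -mulrnBl.
rewrite pmulrn_lge0// subr_ge0 -exprMn expr2 ler_pM2l//.
Qed.

Lemma enorm_le_sum k (v : 'rV[R]_k) : enorm v <= \sum_i `|v 0 i|.
Proof.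
have s0 : 0 <= \sum_i `|v 0 i| by exact: sumr_ge0.
rewrite -(ler_pXn2r (n := 2)) ?nnegrE ?sqrtr_ge0// enorm_rv_sqr.
rewrite [leRHS]expr2 mulr_suml; apply: ler_sum => i _.
rewrite -expr2 -real_normK ?num_real// expr2 ler_wpM2l//.
by rewrite (bigD1 i)//= lerDl sumr_ge0.
Qed.

Lemma cvg_finsum (I : finType) (g : I -> nat -> R) (l : I -> R) :
  (forall i, g i n @[n --> \oo] --> l i) ->
  \sum_i g i n @[n --> \oo] --> \sum_i l i.
Proof.
move=> gl; elim: (index_enum I) => [|i s IH].
  by rewrite big_nil; under eq_fun do rewrite big_nil; exact: cvg_cst.
by rewrite big_cons; under eq_fun do rewrite big_cons; exact: cvgD.
Qed.

End enorm_theory.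

Section charge_vector.
Context d (T : measurableType d) {R : realType} (k : nat).
Variable D : 'I_k -> {charge set T -> \bar R}.
Local Open Scope ereal_scope.

Definition charge_vec (A : set T) : 'rV[R]_k := \row_i fine (D i A).

Definition partition_of (A : set T) : set ((set T)^nat) :=
  [set F | [/\ forall j, measurable (F j), trivIset setT F & \bigcup_j F j = A]].

(* 0 on non-measurable sets: the measure structure requires nonnegative values
   everywhere, and the supremum over no partition is -oo *)
Definition vec_variation (A : set T) : \bar R :=
  if A \in measurable then
    ereal_sup [set \sum_(j <oo) (enorm (charge_vec (F j)))%:E |
               F in partition_of A]
  else 0.

Local Notation nD A := (enorm (charge_vec A))%:E.

Let nD_ge0 A : 0 <= nD A. Proof. by rewrite lee_fin sqrtr_ge0. Qed.

Let nD0 : nD set0 = 0.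
Proof.
rewrite enorm_rvE /dotv big1 ?sqrtr0// => i _.
by rewrite mxE charge0 mulr0.
Qed.

Lemma enorm_charge_bigcup (F : (set T)^nat) : (forall j, measurable (F j)) ->
  trivIset setT F -> nD (\bigcup_j F j) <= \sum_(j <oo) nD (F j).
Proof.
move=> mF tF; have mUF : measurable (\bigcup_j F j) by exact: bigcupT_measurable.
set v := charge_vec (\bigcup_j F j).
have [v0|vn0] := eqVneq (enorm v) 0%R.
  by rewrite v0; apply: nneseries_ge0 => n _ _; exact: nD_ge0.
have vgt0 : (0 < enorm v)%R by rewrite lt0r vn0 sqrtr_ge0.
suff : (enorm v * enorm v)%:E <= \sum_(j <oo) (enorm v)%:E * nD (F j).
  by rewrite nneseriesZl// EFinM lee_pmul2l.
rewrite -expr2 enorm_rv_sqr.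
have cvgv : (\sum_(0 <= j < n) dotv v (charge_vec (F j)))%R @[n --> \oo] --> dotv v v.
  rewrite /dotv; under eq_fun do rewrite exchange_big/=.
  apply: cvg_finsum => i; under eq_fun do rewrite -mulr_sumr.
  apply: cvgMl_tmp.
  have DF := @charge_semi_sigma_additive _ _ _ (D i) F mF tF mUF.
  rewrite -(@fineK _ (D i (\bigcup_j F j))) ?fin_num_measure// in DF.
  move: DF => /fine_cvgP[_]; rewrite /v mxE; apply: cvg_trans.
  apply: near_eq_cvg; near=> n => /=; under [RHS]eq_bigr do rewrite mxE.
  by rewrite sum_fine// => j _; rewrite fin_num_measure.
have {}cvgv : \sum_(0 <= j < n) (dotv v (charge_vec (F j)))%:E @[n --> \oo]
    --> (dotv v v)%:E.
  under eq_fun do rewrite sumEFin.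
  by apply: cvg_EFin => //; exact: nearW.
rewrite -(cvg_lim _ cvgv)//; apply: lee_lim.
- by apply/cvg_ex; eexists; exact: cvgv.
- by apply: is_cvg_nneseries => n _ _; rewrite mule_ge0// ?lee_fin ?ltW.
- by near=> n; apply: lee_sum => j _; rewrite -EFinM lee_fin dotv_le_enorm.
Unshelve. all: by end_near. Qed.

Let sumnD_ge0 (F : (set T)^nat) : 0 <= \sum_(j <oo) nD (F j).
Proof. by apply: nneseries_ge0 => n _ _; exact: nD_ge0. Qed.

Let trivial_partition A : measurable A ->
  partition_of A (fun j => if j is 0%N then A else set0).
Proof.
move=> mA; split; first by case.
- by apply/trivIsetP => -[|i] [|j] _ _ //= _; rewrite ?setI0 ?set0I.
- apply/seteqP; split => [x [[|j] _]|x Ax]//.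
  by exists 0%N.
Qed.

Lemma le_vec_variation A : measurable A -> nD A <= vec_variation A.
Proof.
move=> mA; rewrite /vec_variation mem_set//; apply: ereal_sup_ubound.
exists (fun j => if j is 0%N then A else set0); first exact: trivial_partition.
rewrite nneseries_recl//= eseries0 ?adde0//.
by move=> [|j]//= _ _; exact: nD0.
Qed.

Let variation_ge0 A : 0 <= vec_variation A.
Proof.
have [mA|nmA] := boolP (A \in measurable); last by rewrite /vec_variation (negbTE nmA).
by apply: le_trans (le_vec_variation _); [exact: nD_ge0 | exact: set_mem].
Qed.

Let variation0 : vec_variation set0 = 0.
Proof.
apply/eqP; rewrite eq_le variation_ge0 andbT /vec_variation mem_set//.
apply: ge_ereal_sup => _ [F [_ _ F0] <-].
rewrite eseries0// => j _ _.
have -> : F j = set0 by apply/seteqP; split => // x Fx; rewrite -F0; exists j.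
exact: nD0.
Qed.

Let hahnP i := svalP (cid (Hahn_decomposition (D i))).
Let hahn i := svalP (cid (hahnP i)).

Let variation_le A : measurable A ->
  vec_variation A <= \sum_i charge_variation (hahn i) A.
Proof.
move=> mA; rewrite {1}/vec_variation mem_set//.
apply: ge_ereal_sup => _ [F [mF tF FA] <-].
have FAi i : \sum_(j <oo) charge_variation (hahn i) (F j) =
    charge_variation (hahn i) A.
  by rewrite -FA measure_semi_bigcup// FA.
under eq_bigr do rewrite -FAi.
rewrite -nneseries_sum//; apply: lee_nneseries => [j *|j *]; first exact: nD_ge0.
apply: (@le_trans _ _ (\sum_i `|D i (F j)|)).
  rewrite (eq_bigr (fun i => (`|charge_vec (F j) 0 i|)%:E)).
    by rewrite sumEFin lee_fin enorm_le_sum.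
  by move=> i _; rewrite mxE -[in LHS](@fineK _ (D i (F j))) ?fin_num_measure.
by apply: lee_sum => i _; exact: abse_charge_variation.
Qed.

Let variation_fin A : measurable A -> vec_variation A \is a fin_num.
Proof.
move=> mA; rewrite ge0_fin_numE//; apply: le_lt_trans (variation_le mA) _.
by rewrite lte_sum_pinfty// => i _; rewrite ltey_eq fin_num_measure.
Qed.

Let variation_sigma_additive : semi_sigma_additive vec_variation.
Proof.
move=> A mA tA mUA.
rewrite (_ : vec_variation (\bigcup_n A n) = \sum_(n <oo) vec_variation (A n)).
  by apply: is_cvg_nneseries => n _ _; exact: variation_ge0.
apply/eqP; rewrite eq_le; apply/andP; split.
  rewrite {1}/vec_variation mem_set//.
  apply: ge_ereal_sup => _ [F [mF tF FA] <-].
  apply: (@le_trans _ _ (\sum_(j <oo) \sum_(n <oo) nD (F j `&` A n))).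
    apply: lee_nneseries => [j *|j *]; first exact: nD_ge0.
    have {1}-> : F j = \bigcup_n (F j `&` A n).
      rewrite -setI_bigcupr -FA; apply/esym/setIidPl => x Fx.
      by exists j.
    apply: enorm_charge_bigcup => [n|]; first exact: measurableI.
    exact: trivIset_setIl.
  rewrite nneseries_interchange => [|i j]; last exact: nD_ge0.
  apply: lee_nneseries => [n *|n *]; first exact: sumnD_ge0.
  rewrite /vec_variation mem_set//; apply: ereal_sup_ubound.
  exists (fun j => F j `&` A n) => //; split => [j||].
  - exact: measurableI.
  - exact: trivIset_setIr.
  - rewrite -setI_bigcupl FA; apply/setIidPr => x Ax.
    by exists n.
apply/lee_addgt0Pr => e e0.
pose P n F := partition_of (A n) F /\
  vec_variation (A n) <= \sum_(j <oo) nD (F j) + (e / (2 ^ n.+1)%:R)%:E.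
have [G PG] : {G : ((set T)^nat)^nat & forall n, P n (G n)}.
  apply: (@choice _ _ P) => n.
  have en : (0 < e / (2 ^ n.+1)%:R)%R by rewrite divr_gt0// ltr0n expn_gt0.
  have := variation_fin (mA n); rewrite {1}/vec_variation mem_set//.
  move=> /(ub_ereal_sup_adherent en)[_ [F FA <-] VF].
  exists F; split => //; rewrite /vec_variation mem_set//.
  by rewrite -leeBlDr// ltW.
apply: (@le_trans _ _ (\sum_(n <oo) (\sum_(j <oo) nD (G n j) + (e / (2 ^ n.+1)%:R)%:E))).
  by apply: lee_nneseries => [n *|n *]; [exact: variation_ge0 | exact: (PG n).2].
apply: le_trans (epsilon_trick _ _ (ltW e0)) _ => [n|]; first exact: sumnD_ge0.
rewrite leeD2r//.
have /card_esym/ppcard_eqP[f] := card_nat2.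
have -> : \sum_(n <oo) \sum_(j <oo) nD (G n j) =
    \sum_(l <oo) nD (G (f l).1 (f l).2).
  rewrite (nneseries_esumT (fun n => sumnD_ge0 (G n))).
  under eq_esum => n _ do rewrite (nneseries_esumT (fun j => nD_ge0 (G n j))).
  rewrite (nneseries_esumT (fun l => nD_ge0 (G (f l).1 (f l).2))).
  rewrite esum_esum => [|n j _ _]; last exact: nD_ge0.
  rewrite (reindex_esum setT _ f)//.
  have : set_bij [set: nat] [set: nat * nat] f by exact: bij.
  by congr set_bij; apply/seteqP; split => // -[].
rewrite /vec_variation mem_set//; apply: ereal_sup_ubound.
exists (fun l => G (f l).1 (f l).2) => //; split => [l||].
- by have [[+ _ _] _] := PG (f l).1; exact.
- apply/trivIsetP => l l' _ _ ll'.
  have : f l != f l' by apply: contra ll' => /eqP/inj->//; rewrite in_setT.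
  case: (f l) => a b; case: (f l') => a' b' /= ab.
  have [aa|aa] := eqVneq a a'.
    have bb : b != b' by apply: contra ab => /eqP ->; rewrite aa.
    have [[_ /trivIsetP tG _] _] := PG a.
    by rewrite -aa; exact: tG.
  have Gsub c c' : G c c' `<=` A c.
    by have [[_ _ <-] _] := PG c; move=> x ?; exists c'.
  apply/seteqP; split => // x [/Gsub Ax /Gsub Ax'].
  by move/trivIsetP : tA => /(_ a a' I I aa) <-.
- apply/seteqP; split => x.
    move=> [l _ Gx]; exists (f l).1 => //.
    by have [[_ _ <-] _] := PG (f l).1; exists (f l).2.
  move=> [n _]; have [[_ _ <-] _] := PG n => -[j _ Gx].
  by exists (f^-1%FUN (n, j)) => //=; rewrite invK ?inE.
Qed.

HB.instance Definition _ := isMeasure.Build _ _ _ vec_variation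
  variation0 variation_ge0 variation_sigma_additive.

HB.instance Definition _ := @Measure_isFinite.Build _ _ _ vec_variation
  variation_fin.

End charge_vector.

Section charge_integral.
Context d (T : measurableType d) {R : realType}.

(* independent of the Hahn decomposition chosen *)
Definition charge_integral (nu : {charge set T -> \bar R}) (f : T -> R) :
    \bar R :=
  let nuPN := svalP (cid (svalP (cid (Hahn_decomposition nu)))) in
  (\int[jordan_pos nuPN]_x (f x)%:E - \int[jordan_neg nuPN]_x (f x)%:E)%E.

End charge_integral.

Section function_spaces.
Context {R : realType} {n : nat}.
Local Notation Rn := 'rV[R]_n.
Local Notation leb := (@lebesgue_mx R 1 n).
Implicit Types (f phi : Rn -> R) (g : Rn -> Rn) (Omega : set Rn) (p : R).
Local Open Scope ereal_scope.

Definition partial (i : 'I_n) phi : Rn -> R :=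
  fun x => 'D_(delta_mx ord0 i) phi x.

Definition grad phi : Rn -> Rn := fun x => \row_i partial i phi x.

Fixpoint Ck (k : nat) phi : Prop :=
  match k with
  | 0 => continuous phi
  | k'.+1 => [/\ continuous phi,
      forall i x, derivable phi x (delta_mx ord0 i) &
      forall i, Ck k' (partial i phi)]
  end.

Definition test_function Omega phi : Prop :=
  [/\ forall k, Ck k phi,
      compact (closure [set x | phi x != 0%R]) &
      closure [set x | phi x != 0%R] `<=` Omega].

Definition loc_integrable f : Prop :=
  measurable_fun setT f /\
  forall K, compact K -> leb.-integrable K (EFin \o f).

Definition weak_gradient f g : Prop :=
  loc_integrable f /\
  forall i, loc_integrable (fun x => g x 0%R i) /\
  forall phi, test_function setT phi ->
    \int[leb]_x (f x * partial i phi x)%:E =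
    - \int[leb]_x (g x 0%R i * phi x)%:E.

Definition wgrad f : Rn -> Rn := xget (cst 0%R) [set g | weak_gradient f g].

(* The completion of the test functions for the norm |grad phi|_p, realised as
   a space of functions on the whole space: a class of gradient-Cauchy
   sequences is identified with its limit in L^p (for bounded Omega, it exists
   and determines the class by the Poincare inequality). *)
Definition sobolev0 p Omega f : Prop :=
  measurable_fun setT f /\
  exists phi : nat -> Rn -> R,
  [/\ forall k, test_function Omega (phi k),
      forall e : R, (0 < e)%R -> exists N, forall k l,
        (N <= k)%N -> (N <= l)%N ->
        Lnorm leb p%:E (fun x => (enorm (grad (phi k) x - grad (phi l) x))%:E)
          < e%:E &
      Lnorm leb p%:E (fun x => (phi k x - f x)%:E) @[k --> \oo] --> 0].

Definition distr_derivative f (D : 'I_n -> {charge set Rn -> \bar R}) : Prop :=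
  forall i phi, test_function setT phi ->
    \int[leb]_x (f x * partial i phi x)%:E = - charge_integral (D i) phi.

Definition BV f : Prop :=
  leb.-integrable setT (EFin \o f) /\ exists D, distr_derivative f D.

Definition bvD f : 'I_n -> {charge set Rn -> \bar R} :=
  match pselect (exists D, distr_derivative f D) with
  | left fBV => sval (cid fBV)
  | right _ => fun=> czero
  end.

Definition bv_variation f : {finite_measure set Rn -> \bar R} :=
  vec_variation (bvD f).

Definition bv_eta f : Rn -> Rn :=
  fun x => \row_i fine (Radon_Nikodym (bvD f i) (bv_variation f) x).

(* BV(Omega) stands in for the Sobolev space when p = 1 *)
Definition W0 p Omega : set (Rn -> R) :=
  [set f | if p == 1%R then BV f /\ {ae leb, forall x, ~ Omega x -> f x = 0%R}
           else sobolev0 p Omega f].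

Definition ae_zero f : Prop := {ae leb, forall x, f x = 0%R}.

Definition Lp_norm p Omega f : \bar R := Lnorm leb p%:E (EFin \o (f \_ Omega)).

Definition grad_norm p f : \bar R :=
  if p == 1%R then bv_variation f setT
  else Lnorm leb p%:E (fun x => (enorm (wgrad f x))%:E).

Definition lambda1 p Omega : \bar R :=
  ereal_inf [set (grad_norm p f `^ p) / (Lp_norm p Omega f `^ p) |
             f in W0 p Omega `\` ae_zero].

End function_spaces.

Section affine_energy.
Context {R : realType} {n m : nat}.
Local Notation Rn := 'rV[R]_n.
Local Notation Rm := 'rV[R]_m.
Local Notation Rnm := 'M[R]_(n, m).
Local Notation leb a b := (@lebesgue_mx R a b).
Local Notation sph a b := (@sphere_measure R a b).
Implicit Types (p : R) (Q : set Rm) (theta : Rnm) (f : Rn -> R).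
Local Open Scope ereal_scope.

Definition convex_body (Q : set Rm) : Prop :=
  [/\ compact Q, convex_set (Q : set (convex_lmodType Rm)) & Q° !=set0].

Definition support_fun Q (u : Rm) : R := sup [set dotv y u | y in Q].

(* vectors are rows, so that [v *m theta] is (theta^t v)^t *)
Definition hQ_norm p Q f theta : \bar R :=
  if p == 1%R then
    \int[bv_variation f]_x (support_fun Q (bv_eta f x *m theta))%:E
  else Lnorm (leb 1 n) p%:E (fun x => (support_fun Q (wgrad f x *m theta))%:E).

Definition polar_gauge p Q theta : \bar R :=
  Lnorm (sph 1 n) p%:E (fun v : Rn => (support_fun Q (v *m theta))%:E).

Definition polar_proj_body p Q : set Rnm :=
  [set theta | polar_gauge p Q theta <= 1].

Definition omega : \bar R := leb 1 n (@eball R 1 n).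

Definition d_const p Q : \bar R :=
  ((n%:R)%:E * omega) `^ p^-1 *
  (((n * m)%N%:R)%:E * leb n m (polar_proj_body p Q)) `^ ((n * m)%N%:R^-1).

(* [inve] sends 0 to +oo and +oo to 0, the conventions for negative powers in
   [0, +oo]; [poweR] with a negative exponent does not follow them *)
Definition affine_energy p Q f : \bar R :=
  d_const p Q *
  ((\int[sph n m]_(theta in @esphere R n m) (hQ_norm p Q f theta ^+ (n * m))^-1)
     `^ ((n * m)%N%:R^-1))^-1.

Definition lambda1_affine p Q (Omega : set Rn) : \bar R :=
  ereal_inf [set (affine_energy p Q f `^ p) / (Lp_norm p Omega f `^ p) |
             f in W0 p Omega `\` ae_zero].

End affine_energy.

(* Main.v *)
(* Both inequalities are proved for a vector field [g] on a measure space [mu],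
   with [g] the weak gradient when p > 1, and the density of [Df] with respect to
   its variation when p = 1.

   Upper bound. Let [G theta] be the L^p norm of [h_Q (theta^t g)], [N] the gauge
   of the polar body and [k = nm]. From [x^-k + (k/p) x^p >= 1 + k/p] applied to
   [x = G / (t N)], multiplied by [N^-k] and integrated over the sphere, one
   bounds [int G^-k] from below. The cross term [int N^(-k-p) G^p] is, by
   Fubini, [int |g|^p dmu] times a constant, because [N] is invariant under
   Householder reflections; the remaining term [int N^-k] is at least [k] times
   the volume of the polar body, by comparing both on thin cones.

   Lower bound. As [h_Q u >= r |u|], the norm [G theta] is at least a constant
   times the L^p norm of [<g, u>] for some column [u] of [theta] that is not too
   small, so it is enough to have the directional Poincare inequality
   [|f|_p <= T |<g, v>|_p] for unit [v], where [T] is such that translating by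
   [T v] moves Omega off itself. This gives [lambda^A >= c > 0]; since the constant
   [d] may depend on Omega, and [lambda_1] is finite unless both infima range over
   the empty set, [d = c / lambda_1^(1/k)] works. *)

From HB Require Import structures.
Require Import Defs.
From mathcomp Require Import all_boot all_order all_algebra.
From mathcomp Require Import all_classical all_reals all_analysis.
From mathcomp Require Import measurable_realfun ring lra.

Set Implicit Arguments.
Unset Strict Implicit.
Unset Printing Implicit Defensive.
Import Order.TTheory GRing.Theory Num.Theory.
Import numFieldNormedType.Exports.
Local Open Scope classical_set_scope.
Local Open Scope ring_scope.

(** * Lebesgue measure on matrices *)

(** The inequality behind the upper bound is an equality at G = tN. With t the ratio of the L^p norm
    of g to that of a unit field on the sphere of R^n, the cross term becomes exactly (k/p) int N^-k
    and cancels against the same multiple on the left, so no constant is lost. The constant of the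
    cross term is never computed: the Fubini identity is applied a second time, to the identity
    field on the sphere, for which G = N.

    The directional Poincare inequality rests on the mean value theorem for s |-> int w(x) psi(x + s
    v) dx. Only psi is differentiated, so w need only be integrable. For p > 1, w is a signed power
    of a test function and the result passes to the completion. For p = 1, w is the BV function
    itself and psi runs over test functions approximating its sign, which is why density results
    appear.

    The sigma-algebra on matrices is generated by coordinates, and Lebesgue measure is built from
    iterated products. Hence the link with the topology needs countable grids, and invariance under
    reflections comes from the uniqueness, up to a factor, of translation-invariant measures. *)

Section matrix_measurability.
Context {R : realType} (a b : nat).
Local Notation V := 'M[R]_(a, b).

Lemma cvg_mxP T (F : set_system T) {FF : Filter F} (u : T -> V) (l : V) :
  (forall i j, u k i j @[k --> F] --> l i j) -> u k @[k --> F] --> l.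
Proof.
move=> ul; apply/cvg_ballP => e e0.
have H : \forall k \near F, forall i j, ball (l i j) e (u k i j).
  apply: filter_forall => i; apply: filter_forall => j.
  by have /cvg_ballP := ul i j; apply.
by apply: filterS H => k H; split.
Qed.

(** Integer index of the cell of mesh 1/(k+1) that contains [M]. Topological statements reach the
    coordinate sigma-algebra through these cells, of which there are countably many. *)
Definition mx_floor (k : nat) (M : V) : 'M[int]_(a, b) :=
  map_mx (fun x => Num.floor (k.+1%:R * x)) M.

Definition mx_grid (k : nat) (Z : 'M[int]_(a, b)) : V :=
  map_mx (fun z : int => z%:~R / k.+1%:R) Z.

Lemma cvg_mx_grid (M : V) : mx_grid k (mx_floor k M) @[k --> \oo] --> M.
Proof.
apply: cvg_mxP => i j; apply/cvgrPdist_lt => e e0; near=> k.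
rewrite !mxE; have k0 : 0 < k.+1%:R :> R by [].
have /andP[h1 h2] := floor_itv (k.+1%:R * M i j).
rewrite -[X in X - _](mulfK (lt0r_neq0 k0)) -mulrBl mulrC normrM.
rewrite (@gtr0_norm _ k.+1%:R^-1) ?invr_gt0//.
apply: (@le_lt_trans _ _ (k.+1%:R^-1 * 1)); last first.
  by rewrite mulr1; near: k; exact: (near_infty_natSinv_lt (PosNum e0)).
rewrite ler_pM2l ?invr_gt0// mulrC ger0_norm ?subr_ge0//.
by rewrite lerBlDr addrC ltW//; move: h2; rewrite intrD.
Unshelve. all: by end_near. Qed.

Lemma measurable_mx_floor (k : nat) (Z : 'M[int]_(a, b)) :
  measurable (mx_floor k @^-1` [set Z]).
Proof.
rewrite (_ : _ @^-1` _ = \bigcap_(ij in [set: 'I_a * 'I_b])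
   ((fun M : V => M ij.1 ij.2) @^-1`
   [set x | Num.floor (k.+1%:R * x) = Z ij.1 ij.2])).
  apply: fin_bigcap_measurable; first exact: finite_finset.
  move=> [i j] _ /=; rewrite -[X in measurable X]setTI.
  apply: measurable_mx_coord => //.
  rewrite (_ : [set _ | _] = `[(Z i j)%:~R / k.+1%:R, (Z i j + 1)%:~R / k.+1%:R[%classic) //.
  apply/seteqP; split => x /=; rewrite in_itv/= ler_pdivrMr// ltr_pdivlMr// mulrC.
    by move=> <-; rewrite floor_itv.
  by move=> /floor_def.
apply/seteqP; split => M /=.
  by move=> <- [i j] _ /=; rewrite mxE.
by move=> H; apply/matrixP => i j; rewrite mxE; exact: (H (i, j)).
Qed.

(** [f] is the pointwise limit of its values at the grid points [mx_grid k (mx_floor k M)], and each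
    of these approximations takes countably many values, on measurable cells. *)
Lemma continuous_measurable_mx (f : V -> R) :
  continuous f -> measurable_fun setT f.
Proof.
move=> cf; apply: (measurable_fun_cvg (h := fun k M => f (mx_grid k (mx_floor k M)))).
  move=> k _ B mB; rewrite setTI.
  rewrite (_ : _ @^-1` B = \bigcup_(Z in [set: 'M[int]_(a, b)])
    (mx_floor k @^-1` [set Z] `&` [set M | B (f (mx_grid k Z))])).
    apply: countable_bigcupT_measurable => // Z.
    have [BZ|BZ] := pselect (B (f (mx_grid k Z))).
      by rewrite (_ : [set _ | _] = setT) ?setIT; [exact: measurable_mx_floor|apply/seteqP; split].
    by rewrite (_ : [set _ | _] = set0) ?setI0//; apply/seteqP; split.
  apply/seteqP; split => M /=.
    by move=> BM; exists (mx_floor k M).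
  by move=> [Z _ [<-]].
by move=> M _; exact: (cvg_comp _ _ (@cvg_mx_grid M) (cf M)).
Qed.

Lemma measurable_mxD d (S : measurableType d) (f g : S -> V) :
  measurable_fun setT f -> measurable_fun setT g ->
  measurable_fun setT (fun x => f x + g x).
Proof.
move=> mf mg; apply: measurable_fun_mx => i j.
under eq_fun do rewrite mxE.
by apply: measurable_funD; apply: (measurableT_comp (measurable_mx_coord i j)).
Qed.

Lemma measurable_mxN d (S : measurableType d) (f : S -> V) :
  measurable_fun setT f -> measurable_fun setT (fun x => - f x).
Proof.
move=> mf; apply: measurable_fun_mx => i j.
under eq_fun do rewrite mxE.
by apply: measurableT_comp => //; apply: (measurableT_comp (measurable_mx_coord i j)).
Qed.

Lemma measurable_mxZ d (S : measurableType d) (c : S -> R) (f : S -> V) :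
  measurable_fun setT c -> measurable_fun setT f ->
  measurable_fun setT (fun x => c x *: f x).
Proof.
move=> mc mf; apply: measurable_fun_mx => i j.
under eq_fun do rewrite mxE.
by apply: measurable_funM => //; apply: (measurableT_comp (measurable_mx_coord i j)).
Qed.

End matrix_measurability.

Lemma measurable_mulmx {R : realType} (a b c : nat) d (S : measurableType d)
    (f : S -> 'M[R]_(a, b)) (g : S -> 'M[R]_(b, c)) :
  measurable_fun setT f -> measurable_fun setT g ->
  measurable_fun setT (fun x => f x *m g x).
Proof.
move=> mf mg; apply: measurable_fun_mx => i j.
under eq_fun do rewrite mxE.
apply: measurable_sum => k; apply: measurable_funM.
  exact: (measurableT_comp (measurable_mx_coord i k)).
exact: (measurableT_comp (measurable_mx_coord k j)).
Qed.

(** * Translation-invariant measures *)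

Section translation_invariant.
Context {R : realType} (a b : nat).
Local Notation V := 'M[R]_(a, b).
Local Open Scope ereal_scope.

Definition translation_invariant (mu : set V -> \bar R) : Prop :=
  forall (v : V) (A : set V), measurable A -> mu ((fun x : V => v + x)%R @^-1` A) = mu A.

Variables mu nu : {sigma_finite_measure set V -> \bar R}.
Hypotheses (mu_inv : translation_invariant mu) (nu_inv : translation_invariant nu).

(* Fubini on the shears [(x, y) |-> (x, x + y)] and [(x, y) |-> (x - y, x)]. *)
Lemma translation_invariant_cross (A B : set V) : measurable A -> measurable B ->
  nu A * mu B = mu (-%R @^-1` A) * nu B.
Proof.
move=> mA mB.
have m1 : measurable_fun setT (@fst V V) by exact: measurable_fst.
have m2 : measurable_fun setT (@snd V V) by exact: measurable_snd.
pose C1 := [set z : V * V | A z.1 /\ B (z.1 + z.2)%R].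
pose C2 := [set z : V * V | A (z.1 - z.2)%R /\ B z.1].
have mC1 : measurable C1.
  apply: measurableI; rewrite -[X in measurable X]setTI; first exact: m1.
  exact: (measurable_mxD m1 m2).
have mC2 : measurable C2.
  apply: measurableI; rewrite -[X in measurable X]setTI; last exact: m1.
  exact: (measurable_mxD m1 (measurable_mxN m2)).
have E1 : nu A * mu B = \int[nu]_x mu (xsection C1 x).
  rewrite -[A]setIT -integral_indic// -ge0_integralZr//; last exact/measurable_EFinP.
  apply: eq_integral => x _; rewrite indicE.
  have [/set_mem Ax|/negP nAx] := boolP (x \in A).
    rewrite mul1e -(mu_inv x mB); congr (mu _); apply/seteqP; split => y /=.
      by move=> By; apply: mem_set.
    by move=> /set_mem[].
  rewrite mul0e (_ : xsection C1 x = set0) ?measure0//.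
  by apply/seteqP; split => // y /set_mem[/= Ax _]; apply: nAx; exact: mem_set.
have E2 : mu (-%R @^-1` A) * nu B = \int[nu]_x mu (xsection C2 x).
  have mNA : measurable (-%R @^-1` A : set V).
    by rewrite -[X in measurable X]setTI; apply: measurable_mxN.
  rewrite muleC -[B in nu B]setIT -integral_indic// -ge0_integralZr//; last exact/measurable_EFinP.
  apply: eq_integral => x _; rewrite indicE.
  have [/set_mem Bx|/negP nBx] := boolP (x \in B).
    rewrite mul1e -(mu_inv (- x)%R mNA); congr (mu _); apply/seteqP; split => y /=.
      by rewrite opprD opprK => Ay; apply: mem_set.
    by rewrite opprD opprK => /set_mem[].
  rewrite mul0e (_ : xsection C2 x = set0) ?measure0//.
  by apply/seteqP; split => // y /set_mem[/= _ Bx]; apply: nBx; exact: mem_set.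
have swap C : measurable C ->
    \int[nu]_x mu (xsection C x) = \int[mu]_y nu (ysection C y).
  move=> mC; have := @indic_fubini_tonelli _ _ V V R nu mu C mC.
  by rewrite indic_fubini_tonelli_FE// indic_fubini_tonelli_GE.
rewrite E1 E2 !swap//; apply: eq_integral => y _.
rewrite -(nu_inv (- y)%R); last exact: measurable_ysection.
congr (nu _); apply/seteqP; split => x /=.
  move=> /set_mem[/= h1 h2]; apply: mem_set; split => /=; first by rewrite addrC.
  by move: h2; rewrite addrAC addNr add0r.
move=> /set_mem[/= h1 h2]; apply: mem_set; split => /=; first by rewrite addrC.
by rewrite addrAC addNr add0r.
Qed.

End translation_invariant.

Section lebesgue_translation.
Context {R : realType}.
Local Open Scope ereal_scope.
Local Notation mR := (measurableTypeR R).

Lemma lebesgue_measure_translation (v : R) (A : set R) : measurable A ->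
  lebesgue_measure ((fun x => v + x)%R @^-1` A) = lebesgue_measure A :> \bar R.
Proof.
move=> mA.
have mv : measurable_fun [set: mR] (fun x : mR => (v + x)%R : mR).
  exact: measurable_funD.
pose phi : {mfun mR >-> mR} := HB.pack (fun x : mR => (v + x)%R : mR)
  (isMeasurableFun.Build _ _ _ _ _ mv).
apply/esym; apply: (lebesgue_measure_unique
  (mu := (pushforward lebesgue_measure phi : {measure set mR -> \bar R}))) => //.
move=> _ [[x y] _ <-].
transitivity (lebesgue_measure (`](x - v)%R, (y - v)%R]%classic : set mR)).
  rewrite !lebesgue_measure_itv/= !lte_fin ltrD2r; case: ifPn => // _.
  by rewrite -!EFinB; congr EFin; ring.
congr (lebesgue_measure _); apply/seteqP.
by split => z /=; rewrite !in_itv/= ltrBlDl lerBrDl.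
Qed.

Lemma cons_vecD k (p q : mR * 'rV[R]_k) :
  cons_vec (p.1 + q.1, p.2 + q.2)%R = (cons_vec p + cons_vec q)%R.
Proof.
rewrite /cons_vec [RHS](@add_row_mx _ 1 1 k); apply: (congr2 (@row_mx R 1 1 k)) => //.
by apply/matrixP => i j; rewrite !mxE.
Qed.

Lemma uncons_vecK k : cancel (@uncons_vec R k) (@cons_vec R k).
Proof.
move=> v; rewrite /cons_vec /uncons_vec/= -[RHS](@hsubmxK _ 1 1 k); apply: (congr2 (@row_mx R 1 1 k)) => //.
apply/matrixP => i j; rewrite !mxE !ord1; congr (v _ _); exact/val_inj.
Qed.

Lemma lebesgue_rv_translation k : translation_invariant (@lebesgue_rv R k).
Proof.
elim: k => [|k IH] v A mA.
  by congr (lebesgue_rv _ _); apply/seteqP; split => x /=; rewrite (thinmx0 v) add0r.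
rewrite /= /transport /pushforward /product_measure1 /=.
pose B := (@cons_vec R k @^-1` A).
have mB : measurable B.
  by rewrite -[X in measurable X]setTI; exact: measurable_cons_vec.
pose g x := lebesgue_rv k (xsection B x).
have mg : measurable_fun setT g by exact: measurable_fun_xsection.
transitivity (\int[lebesgue_measure]_x g (((uncons_vec v).1 : mR) + x)%R).
  apply: eq_integral => x _ /=; rewrite /g -(IH (uncons_vec v).2); last first.
    exact: measurable_xsection.
  have vE w : (v + cons_vec (x, w) =
      cons_vec (((uncons_vec v).1 : mR) + x, (uncons_vec v).2 + w))%R.
    by rewrite -{1}(uncons_vecK v) (cons_vecD _ (x, w)).
  congr (lebesgue_rv _ _); apply/seteqP; split => w /set_mem /=.
    by rewrite vE => Aw; exact: mem_set.
  by move=> Aw; apply: mem_set; rewrite /= vE.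
set c := (uncons_vec v).1.
have mc : measurable_fun [set: mR] (fun x : mR => (c + x)%R : mR).
  exact: measurable_funD.
rewrite -[LHS](@ge0_integral_pushforward _ _ _ _ _ _ mc lebesgue_measure setT g)//.
by apply: eq_measure_integral => C mC _; exact: lebesgue_measure_translation.
Qed.

Lemma lebesgue_mx_translation a b : translation_invariant (@lebesgue_mx R a b).
Proof.
move=> v A mA; rewrite /lebesgue_mx /transport /pushforward.
rewrite -[RHS](lebesgue_rv_translation (mxvec v)); last first.
  by rewrite -[X in measurable X]setTI; exact: measurable_vec_mx.
by congr (lebesgue_rv _ _); apply/seteqP; split => w /=; rewrite linearD/= mxvecK.
Qed.

Definition mx_box a b (r : R) : set 'M[R]_(a, b) :=
  [set M | forall i j, (`|M i j| <= r)%R].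

Lemma measurable_mx_box a b r : measurable (@mx_box a b r).
Proof.
rewrite (_ : mx_box _ = \bigcap_(ij in [set: 'I_a * 'I_b])
   ((fun M : 'M[R]_(a, b) => M ij.1 ij.2) @^-1` `[(- r)%R, r]%classic)).
  apply: fin_bigcap_measurable; first exact: finite_finset.
  move=> [i j] _ /=; rewrite -[X in measurable X]setTI.
  by apply: measurable_mx_coord => //.
apply/seteqP; split => M /=.
  by move=> H [i j] _ /=; rewrite in_itv/= -ler_norml.
by move=> H i j; have := H (i, j) I; rewrite /= in_itv/= -ler_norml.
Qed.

Lemma lebesgue_rv_box k (r : R) : (0 <= r)%R ->
  @lebesgue_rv R k (mx_box r) = ((2 * r) ^+ k)%:E.
Proof.
move=> r0; elim: k => [|k IH].
  by rewrite /= diracE mem_set ?expr0// => i [].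
rewrite /= /transport /pushforward.
rewrite (_ : _ @^-1` _ = (`[(- r)%R, r]%classic : set mR) `*` mx_box r).
  rewrite product_measure1E//; last exact: measurable_mx_box.
  rewrite [X in X * _]lebesgue_measure_itv/= lte_fin IH.
  have [rr|rr] := ltP (- r)%R r.
    by rewrite -EFinB -EFinM exprS; congr (_ * _)%:E; ring.
  by rewrite (_ : r = 0)%R ?mulr0 ?expr0n ?mul0e//; lra.
apply/seteqP; split => -[x w] /= H.
all: have e0 : @cons_vec R k (x, w) ord0 ord0 = x by exact: (congr1 fst (cons_vecK (x, w))).
  split.
    by have := H ord0 ord0; rewrite e0 in_itv/= -ler_norml.
  move=> i j; rewrite !ord1.
  have := H ord0 (rshift 1 j); have := congr1 (fun p : mR * 'rV[R]_k => p.2 ord0 j) (cons_vecK (x, w)).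
  by rewrite /= mxE => ->.
move=> i j; rewrite !ord1; case: H => H1 H2.
have [->|[l ->]] : j = ord0 \/ exists l, j = rshift 1 l.
- rewrite -[j](@splitK 1 k); case: (fintype.split _) => l /=.
    by left; apply: val_inj; rewrite /= ord1.
  by right; exists l.
- by rewrite e0; move: H1; rewrite in_itv/= -ler_norml.
- have := congr1 (fun p : mR * 'rV[R]_k => p.2 ord0 l) (cons_vecK (x, w)).
  by rewrite /= mxE => ->; exact: H2.
Qed.

Lemma lebesgue_mx_box a b (r : R) : (0 <= r)%R ->
  @lebesgue_mx R a b (mx_box r) = ((2 * r) ^+ (a * b))%:E.
Proof.
move=> r0; rewrite -lebesgue_rv_box// /lebesgue_mx /transport /pushforward.
congr (lebesgue_rv _ _); apply/seteqP; split => v /= H i j.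
  rewrite ord1; case/mxvec_indexP: j => k l.
  by have := H k l; rewrite mxE.
by rewrite mxE.
Qed.

End lebesgue_translation.

Section lebesgue_linear.
Context {R : realType} (a b : nat).
Local Notation V := 'M[R]_(a, b).
Local Notation leb := (@lebesgue_mx R a b).
Local Open Scope ereal_scope.

Lemma measurable_preimage_mx (L : V -> V) (A : set V) :
  measurable_fun setT L -> measurable A -> measurable (L @^-1` A).
Proof. by move=> mL mA; rewrite -[X in measurable X]setTI; exact: mL. Qed.

(** [translation_invariant_cross] with both measures equal to Lebesgue measure and [B] a box, whose
    volume is finite and nonzero and can be divided out. *)
Lemma lebesgue_mxN (A : set V) : measurable A -> leb (-%R @^-1` A) = leb A.
Proof.
move=> mA; have mB := @measurable_mx_box R a b 1%R.
have : leb A * leb (mx_box 1) = leb (-%R @^-1` A) * leb (mx_box 1).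
  exact: (translation_invariant_cross (@lebesgue_mx_translation R a b)
    (@lebesgue_mx_translation R a b) mA mB).
rewrite lebesgue_mx_box//; set c := (_ ^+ _)%:E => H.
have : leb A * c * c^-1 = leb (-%R @^-1` A) * c * c^-1 by rewrite H.
by rewrite -!muleA divee ?mule1// /c eqe expf_neq0// mulr1.
Qed.

Section additive.
Variables L Li : V -> V.
Hypotheses (mL : measurable_fun setT L) (mLi : measurable_fun setT Li).
Hypotheses (LK : cancel L Li) (LiK : cancel Li L).
Hypothesis LD : forall x y, L (x + y)%R = (L x + L y)%R.

(** The image of Lebesgue measure under an additive bijection is again translation invariant, hence
    proportional to it. The factor, |det L|^-1, is not named: it is read off from one test set [B],
    a box for dilations and the unit ball for isometries. *)
Lemma lebesgue_mx_additive (A B : set V) : measurable A -> measurable B ->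
  leb (L @^-1` A) * leb B = leb A * leb (L @^-1` B).
Proof.
move=> mA mB; rewrite -(lebesgue_mxN mA).
pose nu : {sigma_finite_measure set V -> \bar R} :=
  transport (sigma_finiteT leb) mL mLi LK.
apply: (translation_invariant_cross (mu := leb) (nu := nu)) => //.
  exact: lebesgue_mx_translation.
move=> v C mC; rewrite /nu /= /transport /pushforward.
rewrite -[RHS](lebesgue_mx_translation (Li v)); last exact: measurable_preimage_mx.
by congr (leb _); apply/seteqP; split => x /=; rewrite LD LiK.
Qed.

End additive.

Lemma lebesgue_mxZ (t : R) (A : set V) : (0 < t)%R -> measurable A ->
  leb ((fun x : V => t *: x)%R @^-1` A) = (t^-1 ^+ (a * b))%:E * leb A.
Proof.
move=> t0 mA; have mB := @measurable_mx_box R a b 1%R.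
have mZ (s : R) : measurable_fun setT (fun x : V => s *: x)%R.
  exact: measurable_mxZ.
have tn0 := lt0r_neq0 t0.
have K1 : cancel (fun x : V => t *: x)%R (fun x : V => t^-1 *: x)%R.
  by move=> x; rewrite scalerA mulVf// scale1r.
have K2 : cancel (fun x : V => t^-1 *: x)%R (fun x : V => t *: x)%R.
  by move=> x; rewrite scalerA mulfV// scale1r.
have := lebesgue_mx_additive (mZ t) (mZ t^-1%R) K1 K2 (scalerDr t) mA mB.
rewrite (_ : _ @^-1` (mx_box 1) = mx_box t^-1%R :> set V); last first.
  apply/seteqP; split => M /= H i j.
    have := H i j; rewrite mxE normrM gtr0_norm// => h.
    by rewrite -(ler_pM2l t0) mulfV.
  by rewrite mxE normrM gtr0_norm// -(mulfV tn0) ler_pM2l.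
rewrite !lebesgue_mx_box ?invr_ge0 1?ltW// mulr1 exprMn.
set c := (2 ^+ (a * b))%R => H.
have c0 : c != 0%R by rewrite expf_neq0.
have : leb ((fun x : V => t *: x)%R @^-1` A) * c%:E * c%:E^-1 =
  leb A * (c * t^-1 ^+ (a * b))%:E * c%:E^-1 by rewrite H.
rewrite -!muleA divee ?eqe// mule1 => ->.
by rewrite muleC inver (negbTE c0) -EFinM; congr (_%:E * _); field.
Qed.

Lemma enorm_ge0 (M : V) : (0 <= enorm M)%R. Proof. exact: sqrtr_ge0. Qed.

Lemma sqr_enorm (M : V) : (enorm M ^+ 2 = \sum_i \sum_j M i j ^+ 2)%R.
Proof.
by rewrite sqr_sqrtr// sumr_ge0// => i _; rewrite sumr_ge0// => j _; rewrite sqr_ge0.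
Qed.

Lemma enormZ (t : R) (M : V) : enorm (t *: M)%R = (`|t| * enorm M)%R.
Proof.
rewrite /enorm -sqrtr_sqr -sqrtrM ?sqr_ge0// mulr_sumr; congr Num.sqrt.
apply: eq_bigr => i _; rewrite mulr_sumr; apply: eq_bigr => j _.
by rewrite mxE exprMn.
Qed.

Lemma enorm0 : enorm (0%R : V) = 0%R.
Proof. by rewrite -(scale0r 0%R) enormZ normr0 mul0r. Qed.

Lemma normr_le_enorm (M : V) i j : (`|M i j| <= enorm M)%R.
Proof.
rewrite -(ler_pXn2r (n := 2)) ?nnegrE ?enorm_ge0// sqr_enorm real_normK ?num_real//.
rewrite (bigD1 i)//= (bigD1 j)//= -addrA lerDl addr_ge0// ?sumr_ge0// => *.
  by rewrite sqr_ge0.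
by rewrite sumr_ge0// => *; rewrite sqr_ge0.
Qed.

Lemma enorm_eq0 (M : V) : enorm M = 0%R -> M = 0%R.
Proof.
move=> M0; apply/matrixP => i j; rewrite mxE; apply/eqP; rewrite -normr_le0 -M0.
exact: normr_le_enorm.
Qed.

Lemma enorm_gt0 (M : V) : M != 0%R -> (0 < enorm M)%R.
Proof.
by rewrite lt0r enorm_ge0 andbT; apply: contra => /eqP/enorm_eq0/eqP.
Qed.

Lemma radial_enorm (M : V) : (enorm M *: radial M)%R = M.
Proof.
have [->|M0] := eqVneq M 0%R; first by rewrite enorm0 scale0r.
by rewrite /radial scalerA mulfV ?scale1r// lt0r_neq0// enorm_gt0.
Qed.

Lemma enorm_radial (M : V) : M != 0%R -> enorm (radial M) = 1%R.
Proof.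
move=> M0; rewrite /radial enormZ ger0_norm ?invr_ge0 ?enorm_ge0// mulVf//.
by rewrite lt0r_neq0// enorm_gt0.
Qed.

Lemma eball_sub_box : @eball R a b `<=` mx_box 1.
Proof. by move=> M M1 i j; exact: le_trans (normr_le_enorm _ _ _) M1. Qed.

Lemma box_sub_eball : mx_box (a * b)%N.+1%:R^-1 `<=` @eball R a b.
Proof.
move=> M H; rewrite /eball/= -(ler_pXn2r (n := 2)) ?nnegrE ?enorm_ge0// sqr_enorm.
set r := _^-1%R in H.
apply: (@le_trans _ _ (\sum_(i < a) \sum_(j < b) r ^+ 2)%R).
  apply: ler_sum => i _; apply: ler_sum => j _.
  rewrite -(real_normK (num_real (M i j))) ler_pXn2r ?nnegrE//.
  by rewrite invr_ge0.
rewrite !sumr_const !card_ord -mulrnA mulnC expr1n /r -[X in (X <= _)%R]mulr_natl.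
rewrite exprVn ler_pdivrMr ?exprn_gt0// mul1r -natrX ler_nat.
by rewrite expnS expn1 mulSn (leq_trans (leqnSn _))// leq_addr.
Qed.

Lemma lebesgue_eball_gt0 : 0 < leb (@eball R a b).
Proof.
apply: (@lt_le_trans _ _ (leb (mx_box (a * b)%N.+1%:R^-1))).
  by rewrite lebesgue_mx_box ?invr_ge0// lte_fin exprn_gt0// mulr_gt0// invr_gt0.
apply: le_measure box_sub_eball; rewrite inE; last exact: measurable_eball.
exact: measurable_mx_box.
Qed.

Lemma lebesgue_eball_fin_num : leb (@eball R a b) \is a fin_num.
Proof.
rewrite ge0_fin_numE//; apply: (@le_lt_trans _ _ (leb (mx_box 1%R))).
  apply: le_measure eball_sub_box; rewrite inE; first exact: measurable_eball.
  exact: measurable_mx_box.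
by rewrite lebesgue_mx_box// ltry.
Qed.

Lemma lebesgue_mx_set0 : (0 < a * b)%N -> leb [set 0%R] = 0.
Proof.
move=> ab0; rewrite (_ : [set 0%R] = mx_box 0%R :> set V).
  by rewrite lebesgue_mx_box// mulr0 expr0n; case: (_ * _)%N ab0.
apply/seteqP; split => M /=.
  by move=> -> i j; rewrite mxE normr0.
by move=> H; apply/matrixP => i j; apply/eqP; rewrite mxE -normr_le0.
Qed.

Section isometry.
Variable L : {linear V -> V}.
Hypotheses (mL : measurable_fun setT L) (LK : involutive L).
Hypothesis enormL : forall M, enorm (L M) = enorm M.

Lemma lebesgue_mx_isometry (A : set V) : measurable A -> leb (L @^-1` A) = leb A.
Proof.
move=> mA; have mB := @measurable_eball R a b.
have := lebesgue_mx_additive mL mL LK LK (raddfD L) mA mB.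
rewrite (_ : _ @^-1` @eball R a b = @eball R a b); last first.
  by apply/seteqP; split => M; rewrite /eball /= enormL.
rewrite -(fineK lebesgue_eball_fin_num); set c := fine _ => H.
have c0 : c != 0%R.
  by rewrite -eqe fineK ?lebesgue_eball_fin_num// gt_eqF// lebesgue_eball_gt0.
have : leb (L @^-1` A) * c%:E * c%:E^-1 = leb A * c%:E * c%:E^-1 by rewrite H.
by rewrite -!muleA divee ?eqe// !mule1.
Qed.

Lemma sphere_measure_isometry (A : set V) : measurable A ->
  sphere_measure (L @^-1` A) = sphere_measure A.
Proof.
move=> mA; rewrite /sphere_measure; congr (_ * _).
have mrA : measurable (@radial R a b @^-1` A).
  by apply: measurable_preimage_mx => //; exact: measurable_radial.
rewrite -[RHS]lebesgue_mx_isometry//; last first.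
  by apply: measurableI => //; exact: measurable_eball.
congr (leb _); apply/seteqP; split => M; rewrite /eball /= enormL /radial enormL.
  by rewrite linearZ.
by rewrite linearZ.
Qed.

Lemma ge0_integral_sphere_isometry (f : V -> \bar R) :
  measurable_fun setT f -> (forall M, 0 <= f M) ->
  \int[@sphere_measure R a b]_M f (L M) = \int[@sphere_measure R a b]_M f M.
Proof.
move=> mf f0; rewrite -[LHS](@ge0_integral_pushforward _ _ _ _ _ _ mL _ setT f)//.
by apply: eq_measure_integral => A mA _; exact: sphere_measure_isometry.
Qed.

End isometry.

Lemma sphere_measure_fin : fin_num_fun (@sphere_measure R a b).
Proof.
move=> A mA; rewrite /sphere_measure fin_numM// ge0_fin_numE//.
apply: le_lt_trans (_ : leb (@eball R a b) < _); last first.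
  by rewrite -ge0_fin_numE// lebesgue_eball_fin_num.
apply: le_measure; rewrite ?inE.
- apply: measurableI; first exact: measurable_eball.
  by apply: measurable_preimage_mx => //; exact: measurable_radial.
- exact: measurable_eball.
- exact: subIsetl.
Qed.

HB.instance Definition _ := Measure_isFinite.Build _ _ _ (@sphere_measure R a b)
  sphere_measure_fin.

Lemma measurable_esphere : measurable (@esphere R a b).
Proof.
rewrite /esphere -[X in measurable X]setTI.
exact: (@measurable_enorm R a b measurableT [set 1%R]).
Qed.

Lemma sphere_measure_gt0 : (0 < a * b)%N -> 0 < @sphere_measure R a b setT.
Proof.
move=> ab0; rewrite /sphere_measure preimage_setT setIT mule_gt0//.
  by rewrite lte_fin ltr0n.
exact: lebesgue_eball_gt0.
Qed.

(** [radial] misses the sphere only at the origin, where it returns 0, and the origin is a null set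
    in positive dimension. *)
Lemma sphere_measure_setC : (0 < a * b)%N -> @sphere_measure R a b (~` @esphere R a b) = 0.
Proof.
move=> ab0; rewrite /sphere_measure.
rewrite (_ : leb _ = 0) ?mule0//; apply/eqP; rewrite eq_le measure_ge0 andbT.
rewrite -(lebesgue_mx_set0 ab0); apply: le_measure; rewrite ?inE.
- apply: measurableI; first exact: measurable_eball.
  apply: measurable_preimage_mx; first exact: measurable_radial.
  by apply: measurableC; exact: measurable_esphere.
- rewrite (_ : [set 0%R] = mx_box 0%R :> set V); first exact: measurable_mx_box.
  apply/seteqP; split => M /=; first by move=> -> i j; rewrite mxE normr0.
  by move=> H; apply/matrixP => i j; apply/eqP; rewrite mxE -normr_le0.
- move=> M [_]; apply: contra_notP => /eqP M0.
  exact: enorm_radial.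
Qed.

Lemma integral_esphere (f : V -> \bar R) : (0 < a * b)%N ->
  measurable_fun setT f -> (forall M, 0 <= f M) ->
  \int[@sphere_measure R a b]_(M in @esphere R a b) f M = \int[@sphere_measure R a b]_M f M.
Proof.
move=> ab0 mf f0; have mS := measurableC measurable_esphere.
rewrite [RHS](ge0_negligible_integral mS measurableT mf (fun x _ => f0 x) (sphere_measure_setC ab0)).
by rewrite setTD setCK.
Qed.

End lebesgue_linear.

(** * Volume of the polar body *)

Section polar_volume.
Context {R : realType} (a b : nat).
Local Notation V := 'M[R]_(a, b).
Local Notation leb := (@lebesgue_mx R a b).
Local Notation sph := (@sphere_measure R a b).
Local Notation S1 := (@esphere R a b).
Local Notation B1 := (@eball R a b).
Local Notation rad := (@radial R a b).
Local Open Scope ereal_scope.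

Variables (g : V -> R) (c : R).
Hypotheses (ab0 : (0 < a * b)%N) (mg : measurable_fun setT g) (c0 : (0 < c)%R).
Hypothesis gc : forall M, (c * enorm M <= g M)%R.
Hypothesis gZ : forall t M, (0 <= t)%R -> g (t *: M)%R = (t * g M)%R.

Let k := (a * b)%N.
(** Layers of the sphere on which [g] varies by a factor less than [s]. The levels start at [c], the
    minimum allowed by [gc], so that [j] can range over the naturals. *)
Let C (s : R) (j : nat) : set V :=
  S1 `&` [set M | (c * s ^+ j <= g M)%R /\ (g M < c * s ^+ j.+1)%R].

Let g0 M : (0 <= g M)%R.
Proof. by rewrite (le_trans _ (gc M))// mulr_ge0 ?enorm_ge0// ltW. Qed.

Let mgk D : measurable_fun D (fun M => ((g M)^-1 ^+ k)%:E).
Proof.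
apply/measurable_EFinP; apply: measurable_funX; apply: measurable_funTS.
rewrite (_ : (fun _ => _) = (@powR R)^~ (-1)%R \o g).
  exact: measurableT_comp (measurable_powR _) mg.
by apply/funext => M /=; rewrite powR_inv1.
Qed.

Let f0 M : 0 <= ((g M)^-1 ^+ k)%:E.
Proof. by rewrite lee_fin exprn_ge0// invr_ge0. Qed.

Let mC s j : measurable (C s j).
Proof.
apply: measurableI; first exact: measurable_esphere.
rewrite (_ : [set _ | _] = g @^-1` `[(c * s ^+ j)%R, (c * s ^+ j.+1)%R[).
  by rewrite -[X in measurable X]setTI; apply: mg.
by apply/seteqP; split => M /=; rewrite in_itv/= => /andP.
Qed.

Let mP : measurable [set M | (g M <= 1)%R].
Proof.
rewrite (_ : [set _ | _] = g @^-1` `]-oo, 1%R]%classic).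
  by rewrite -[X in measurable X]setTI; apply: mg.
by apply/seteqP; split => M /=; rewrite in_itv.
Qed.

Let mrad A : measurable A -> measurable (rad @^-1` A).
Proof. by move=> mA; apply: measurable_preimage_mx => //; exact: measurable_radial. Qed.

Let tC s : (1 < s)%R -> trivIset setT (C s).
Proof.
move=> s1; apply/trivIsetP => i j _ _; wlog ij : i j / (i < j)%N.
  by move=> H; rewrite neq_ltn => /orP[|] h; [|rewrite setIC]; apply: H; rewrite ?lt_eqF.
move=> _; apply/seteqP; split => // M [[_ [_ h1]] [_ [h2 _]]].
have : (c * s ^+ i.+1 <= c * s ^+ j)%R by rewrite ler_pM2l// ler_weXn2l// ltW.
by move=> /le_trans/(_ h2)/(lt_le_trans h1); rewrite ltxx.
Qed.

Let coverC s M : (1 < s)%R -> esphere M -> exists j, C s j M.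
Proof.
move=> s1 SM; have cg : (c <= g M)%R by have := gc M; rewrite SM mulr1.
have [N HN] : exists N, (g M < c * s ^+ N)%R.
  have : (s - 1 > 0)%R by rewrite subr_gt0.
  move=> s10; exists (Num.bound (g M / (c * (s - 1))))%R.
  set N := Num.bound _.
  have : (g M / (c * (s - 1)) < N%:R)%R.
    apply: archi_boundP; rewrite divr_ge0//.
    by apply: ltW; rewrite mulr_gt0.
  rewrite ltr_pdivrMr ?mulr_gt0// => /lt_le_trans; apply.
  rewrite mulrCA ler_pM2l// mulrC mulr_natr.
  (* Bernoulli's inequality: [s ^+ N] is at least [1 + N (s - 1)]. *)
  apply: le_trans (_ : 1 + (s - 1) *+ N <= _)%R; first by rewrite lerDr.
  elim: N => [|N IH]; first by rewrite mulr0n addr0 expr0.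
  rewrite exprS mulrS; apply: (@le_trans _ _ (s * (1 + (s - 1) *+ N))%R); last first.
    by rewrite ler_pM2l// (lt_trans _ s1).
  have : (0 <= (s - 1) * (s - 1) *+ N)%R by rewrite mulrn_wge0// mulr_ge0// ltW.
  by rewrite -mulrnAr; set w := ((s - 1) *+ N)%R; nra.
have [j Hj jmin] := ex_minnP (ex_intro (fun N => (g M < c * s ^+ N)%R) N HN).
case: j Hj jmin => [|j] Hj jmin; first by move: Hj; rewrite expr0 mulr1 ltNge cg.
exists j; split => //=; split => //; rewrite leNgt; apply/negP => /jmin.
by rewrite ltnn.
Qed.

(* The cone over [C s j] meets the unit ball of [g] inside the Euclidean ball
   of radius [(c * s ^+ j)^-1]. *)
Let cone_le s j : (1 < s)%R ->
  k%:R%:E * leb ([set M | (g M <= 1)%R] `&` rad @^-1` C s j) <=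
  (s ^+ k)%:E * \int[sph]_(M in C s j) ((g M)^-1 ^+ k)%:E.
Proof.
move=> s1; have s0 : (0 < s)%R by rewrite (lt_trans _ s1).
set r := (c * s ^+ j)%R; have r0 : (0 < r)%R by rewrite mulr_gt0// exprn_gt0.
have mBC : measurable (B1 `&` rad @^-1` C s j).
  by apply: measurableI; [exact: measurable_eball|exact: mrad].
apply: (@le_trans _ _ (k%:R%:E * ((r^-1 ^+ k)%:E * leb (B1 `&` rad @^-1` C s j)))).
  rewrite lee_pmul2l ?lte_fin ?ltr0n// -lebesgue_mxZ//.
  apply: le_measure; rewrite ?inE.
  - by apply: measurableI => //; exact: mrad.
  - by apply: measurable_preimage_mx => //; exact: measurable_mxZ.
  - move=> M [/= gM [SM [h1 h2]]]; split; rewrite /eball /=.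
      rewrite enormZ gtr0_norm//; apply: le_trans gM.
      rewrite -[in leRHS](radial_enorm M) gZ ?enorm_ge0// mulrC.
      by rewrite ler_wpM2l// enorm_ge0.
    rewrite (_ : radial (r *: M)%R = radial M); first by split.
    rewrite /radial enormZ gtr0_norm// scalerA invfM mulrC mulrA divff ?mul1r//.
    exact: lt0r_neq0.
rewrite muleCA -[X in _ * X]/(sph (C s j)).
rewrite -ge0_integralZl//; last by rewrite lee_fin exprn_ge0// ltW.
rewrite -integral_cst//; apply: ge0_le_integral => //.
- by move=> M _; rewrite lee_fin exprn_ge0// invr_ge0 ltW.
- by apply: emeasurable_funM => //; exact: mgk.
(* On this layer [g M] is less than [s * r], so [r^-1] is at most [s / g M]. *)
- move=> M [SM [h1 h2]]; rewrite -EFinM lee_fin -exprMn ler_pXn2r ?nnegrE.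
  + rewrite ler_pdivlMr ?(lt_le_trans r0)// ler_pdivrMl//.
    by apply: ltW; apply: lt_le_trans h2 _; rewrite exprSr mulrA.
  + done.
  + by rewrite invr_ge0 ltW.
  + by rewrite divr_ge0 ?(ltW s0)// (le_trans (ltW r0)).
Qed.

(** Summing [cone_le] over the layers gives the bound up to the factor [s ^+ k], and
    [s = 1 + 1/(j+1)] tends to 1. The limit is taken for finite [J]; otherwise there is nothing to
    prove. *)
Lemma polar_volume_le : k%:R%:E * leb [set M | (g M <= 1)%R] <=
  \int[sph]_(M in S1) ((g M)^-1 ^+ k)%:E.
Proof.
set J := \int[_]_(_ in _) _.
have J0 : 0 <= J by apply: integral_ge0.
have step s : (1 < s)%R -> k%:R%:E * leb [set M | (g M <= 1)%R] <= (s ^+ k)%:E * J.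
  move=> s1; have s0 : (0 < s)%R by rewrite (lt_trans _ s1).
  have SE : S1 = \bigcup_j C s j.
    apply/seteqP; split => [M /(coverC s1)[j Cj]|M [j _ []]//].
    by exists j.
  pose P0 := [set M | (g M <= 1)%R].
  have -> : leb P0 = leb (\bigcup_j (P0 `&` rad @^-1` C s j)).
    apply/eqP; rewrite eq_le; apply/andP; split; last first.
      apply: le_measure; rewrite ?inE//.
        by apply: bigcup_measurable => j _; apply: measurableI => //; exact: mrad.
      by move=> M [j _ []].
    (* The origin is the only point of [P0] outside all the cones, and it is null. *)
    rewrite -[leRHS]add0e -(@lebesgue_mx_set0 R a b ab0).
    have m0 : measurable [set (0%R : V)].
      rewrite (_ : [set 0%R] = mx_box 0%R :> set V); first exact: measurable_mx_box.
      apply/seteqP; split => M /=; first by move=> -> i j; rewrite mxE normr0.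
      by move=> H; apply/matrixP => i j; apply/eqP; rewrite mxE -normr_le0.
    apply: le_trans (measureU2 _ _ _) => //; last first.
      by apply: bigcup_measurable => j _; apply: measurableI => //; exact: mrad.
    apply: le_measure; rewrite ?inE//.
      apply: measurableU => //.
      by apply: bigcup_measurable => j _; apply: measurableI => //; exact: mrad.
    move=> M PM; have [->|M0] := eqVneq M 0%R; first by left.
    right; have /(coverC s1)[j Cj] : esphere (radial M) by exact: enorm_radial.
    by exists j.
  rewrite measure_bigcup//; last 2 first.
  - by move=> j _; apply: measurableI => //; exact: mrad.
  - apply/trivIsetP => i j _ _ ij; apply/seteqP; split => // M [[_ Ci] [_ Cj]].
    have : (C s i `&` C s j) (rad M) by [].
    by rewrite (trivIsetP.1 (tC s1) i j I I ij).
  rewrite -nneseriesZl//.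
  rewrite /J SE ge0_integral_bigcup//; last exact: tC.
  rewrite -nneseriesZl//; last by move=> *; exact: integral_ge0.
  rewrite (eq_eseriesl (Q := xpredT)); last by move=> j; rewrite in_setT.
  apply: lee_nneseries => [j *|j *]; last exact: cone_le.
  exact: mule_ge0.
have [Joo|] := eqVneq J +oo; first by rewrite Joo leey.
rewrite -ltey -ge0_fin_numE// => Jfin.
have cv1 : (1 + j.+1%:R^-1 : R)%R @[j --> \oo] --> (1 : R)%R.
  rewrite -[X in _ --> X]addr0.
  by apply: cvgD; [exact: cvg_cst|exact: cvg_harmonic].
have cvr : ((1 + j.+1%:R^-1) ^+ k : R)%R @[j --> \oo] --> (1 : R)%R.
  by have := cvg_comp _ _ cv1 (@exprn_continuous R k 1%R); rewrite expr1n.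
have cv : (((1 + j.+1%:R^-1) ^+ k)%:E * J) @[j --> \oo] --> J.
  rewrite -[X in _ --> X]mul1e; apply: cvgeZr => //.
  by apply: cvg_EFin cvr; exact: nearW.
rewrite -(cvg_lim _ cv)//; apply: lime_ge.
  by apply/cvg_ex; eexists; exact: cv.
by apply: nearW => j; apply: step; rewrite ltrDl invr_gt0.
Qed.

End polar_volume.

(** * Norms and support functions *)

Section householder.
Context {R : realType} (n : nat).
Local Notation Rn := 'rV[R]_n.

Lemma dotvE (u v : Rn) : u *m v^T = (dotv u v)%:M.
Proof.
apply/matrixP => i j; rewrite !ord1 !mxE mulr1n.
by apply: eq_bigr => l _; rewrite mxE.
Qed.

Lemma dotvC (u v : Rn) : dotv u v = dotv v u.
Proof. by apply: eq_bigr => i _; rewrite mulrC. Qed.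

Lemma dotvDl (u v w : Rn) : dotv (u + v) w = dotv u w + dotv v w.
Proof. by rewrite -big_split; apply: eq_bigr => i _ /=; rewrite mxE mulrDl. Qed.

Lemma dotvZl (t : R) (u v : Rn) : dotv (t *: u) v = t * dotv u v.
Proof. by rewrite mulr_sumr; apply: eq_bigr => i _; rewrite mxE mulrA. Qed.

Lemma dotvDr (u v w : Rn) : dotv u (v + w) = dotv u v + dotv u w.
Proof. by rewrite dotvC dotvDl !(dotvC u). Qed.

Lemma dotvZr (t : R) (u v : Rn) : dotv u (t *: v) = t * dotv u v.
Proof. by rewrite dotvC dotvZl dotvC. Qed.

Lemma dotvBr (u v w : Rn) : dotv u (v - w) = dotv u v - dotv u w.
Proof. by rewrite dotvDr -scaleN1r dotvZr mulN1r. Qed.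

Lemma dotvBl (u v w : Rn) : dotv (u - v) w = dotv u w - dotv v w.
Proof. by rewrite dotvC dotvBr !(dotvC w). Qed.

Lemma normr_dotv_le (u v : Rn) : `|dotv u v| <= enorm u * enorm v.
Proof.
rewrite ler_norml dotv_le_enorm andbT -[leLHS]mulN1r -[leRHS]opprK -[- dotv u v]mulN1r.
rewrite mulN1r lerN2 -dotvZl; apply: le_trans (dotv_le_enorm _ _) _.
by rewrite enormZ normrN1 mul1r.
Qed.

Lemma dotv_delta (u : Rn) i : dotv u (delta_mx 0 i) = u 0 i.
Proof.
rewrite /dotv (bigD1 i)//= big1 => [|j ji]; first by rewrite mxE !eqxx mulr1 addr0.
by rewrite mxE (negbTE ji) andbF mulr0.
Qed.

Lemma enorm_delta i : enorm (delta_mx 0 i : Rn) = 1.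
Proof. by rewrite enorm_rvE dotv_delta mxE !eqxx sqrtr1. Qed.

Lemma measurable_dotv d (X : measurableType d) (g : X -> Rn) (u : Rn) :
  measurable_fun setT g -> measurable_fun setT (fun x => dotv (g x) u).
Proof.
move=> mg; apply: measurable_sum => i; apply: measurable_funM => //.
exact: (measurableT_comp (measurable_mx_coord _ _) mg).
Qed.

(** The reflection in the hyperplane orthogonal to [u - w]. Reflections already act transitively on
    spheres, and they are symmetric involutions, which is the form of isometry that the invariance
    lemmas accept. *)
Lemma householder (u w : Rn) : enorm u = enorm w ->
  exists O : 'M[R]_n, [/\ O^T = O, O *m O = 1%:M & u *m O = w].
Proof.
have [->|uw] := eqVneq u w; first by exists 1%:M; rewrite trmx1 !mulmx1.
move=> uw1; have [z zE] : exists z, z = u - w by exists (u - w).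
(* The one use of [enorm u = enorm w]; it makes the coefficient [2 <u,z> / <z,z>] equal to 1. *)
have zz : dotv z z = 2 * (dotv u u - dotv u w).
  rewrite zE dotvBl !dotvBr (dotvC w u) -(enorm_rv_sqr w) -uw1 enorm_rv_sqr; ring.
have z0 : dotv z z != 0.
  rewrite -enorm_rv_sqr expf_neq0// lt0r_neq0// enorm_gt0//.
  by rewrite zE subr_eq0.
exists (1%:M - (2 / dotv z z) *: (z^T *m z)); split.
- by rewrite linearB/= linearZ/= trmx_mul trmxK trmx1.
- rewrite mulmxBl mul1mx mulmxBr mulmx1 -scalemxAl -scalemxAr.
  rewrite (_ : z^T *m z *m (z^T *m z) = dotv z z *: (z^T *m z)); last first.
    by rewrite -mulmxA (mulmxA z) dotvE mul_scalar_mx -scalemxAr.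
  rewrite !scalerA -[RHS]addr0 -addrA; congr (_ + _).
  rewrite opprB -!scaleNr -!scalerDl.
  by rewrite (_ : _ + _ = 0) ?scale0r// /GRing.scale/=; field.
- rewrite mulmxBr mulmx1 -scalemxAr mulmxA dotvE mul_scalar_mx scalerA.
  rewrite (_ : _ * dotv u z = 1) ?scale1r; first by rewrite zE opprB addrCA subrr addr0.
  rewrite zz [in dotv u z]zE dotvBr; move: z0; rewrite zz mulf_eq0 negb_or => /andP[_ z0].
  by field.
Qed.

Lemma enorm_mulmx_orthol m (O : 'M[R]_n) (M : 'M[R]_(n, m)) :
  O^T *m O = 1%:M -> enorm (O *m M) = enorm M.
Proof.
move=> OO; congr Num.sqrt.
have E (N : 'M[R]_(n, m)) : \sum_i \sum_j N i j ^+ 2 = \tr (N^T *m N).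
  rewrite exchange_big/=; apply: eq_bigr => j _; rewrite mxE.
  by apply: eq_bigr => i _; rewrite mxE expr2.
by rewrite !E trmx_mul mulmxA -(mulmxA _ _ O) OO mulmx1.
Qed.

Lemma enorm_trmx m (M : 'M[R]_(n, m)) : enorm M^T = enorm M.
Proof.
rewrite /enorm exchange_big/=; congr Num.sqrt.
by apply: eq_bigr => i _; apply: eq_bigr => j _; rewrite mxE.
Qed.

End householder.

Section Lnorm_lemmas.
Context d (T : measurableType d) {R : realType} (mu : {measure set T -> \bar R}).
Variable p : R.
Hypothesis p0 : 0 < p.
Local Open Scope ereal_scope.

Lemma le_poweR (r : R) (x y : \bar R) : (0 <= r)%R -> 0 <= x -> x <= y ->
  x `^ r <= y `^ r.
Proof.
by move=> r0 x0 xy; apply: gt0_ler_poweR => //; rewrite in_itv/= ?andbT ?leey ?(le_trans x0)// leey.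
Qed.

Lemma measurable_poweR_abse (f : T -> \bar R) : measurable_fun setT f ->
  measurable_fun setT (fun x => `|f x| `^ p).
Proof.
move=> mf; apply: (@measurableT_comp _ _ _ _ _ _ (fun x => x `^ p)) => //=.
  exact: (measurableT_comp (measurable_poweR _)).
exact: measurableT_comp.
Qed.

Lemma LnormE (f : T -> \bar R) : Lnorm mu p%:E f = (\int[mu]_x `|f x| `^ p) `^ p^-1.
Proof. by rewrite unlock. Qed.

Lemma ae_le_Lnorm (f g : T -> \bar R) : measurable_fun setT f -> measurable_fun setT g ->
  {ae mu, forall x, `|f x| <= `|g x|} -> Lnorm mu p%:E f <= Lnorm mu p%:E g.
Proof.
move=> mf mg fg; rewrite !LnormE; apply: le_poweR; first by rewrite invr_ge0 ltW.
  by apply: integral_ge0 => x _; exact: poweR_ge0.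
apply: ae_ge0_le_integral => //.
- by move=> *; exact: poweR_ge0.
- exact: measurable_poweR_abse.
- by move=> *; exact: poweR_ge0.
- exact: measurable_poweR_abse.
- by apply: filterS fg => x fg _; apply: le_poweR => //; exact: ltW.
Qed.

Lemma le_Lnorm (f g : T -> \bar R) : measurable_fun setT f -> measurable_fun setT g ->
  (forall x, `|f x| <= `|g x|) -> Lnorm mu p%:E f <= Lnorm mu p%:E g.
Proof. by move=> mf mg fg; apply: ae_le_Lnorm => //; exact: nearW. Qed.

Lemma ae_eq_Lnorm (f g : T -> \bar R) : measurable_fun setT f -> measurable_fun setT g ->
  {ae mu, forall x, f x = g x} -> Lnorm mu p%:E f = Lnorm mu p%:E g.
Proof.
move=> mf mg fg; apply/eqP; rewrite eq_le !ae_le_Lnorm//.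
- by apply: filterS fg => x ->.
- by apply: filterS fg => x ->.
Qed.

Lemma LnormMl (c : R) (f : T -> R) : (0 <= c)%R -> measurable_fun setT f ->
  Lnorm mu p%:E (fun x => (c * f x)%:E) = c%:E * Lnorm mu p%:E (EFin \o f).
Proof.
move=> c0 mf; rewrite !LnormE.
under eq_integral do rewrite EFinM abseM poweRM//.
rewrite ge0_integralZl//.
- rewrite poweRM ?poweR_ge0//; last by apply: integral_ge0 => x _; exact: poweR_ge0.
  rewrite gee0_abs ?lee_fin// -poweRrM mulfV ?gt_eqF// poweRe1//.
- by apply: measurable_poweR_abse; exact/measurable_EFinP.
- by move=> *; exact: poweR_ge0.
- exact: poweR_ge0.
Qed.

End Lnorm_lemmas.

Section row_norms.
Context {R : realType} (n : nat).
Local Notation Rn := 'rV[R]_n.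

Lemma normr_mx_coord (y : Rn) i : `|y 0 i| <= `|y|.
Proof.
have /mapP[j Hj ->] : `|y 0 i| \in [seq `|y x.1 x.2| | x : 'I_1 * 'I_n].
  by apply/mapP; exists (0, i) => //=; rewrite mem_enum.
by rewrite [leRHS]/Num.Def.normr /= mx_normrE; apply/bigmax_geP; right => /=; exists j.
Qed.

Lemma enorm_le_normr (y : Rn) : enorm y <= n%:R * `|y|.
Proof.
apply: le_trans (enorm_le_sum y) _.
apply: le_trans (_ : \sum_(i < n) `|y| <= _); last by rewrite sumr_const card_ord mulr_natl.
by apply: ler_sum => i _; exact: normr_mx_coord.
Qed.

Lemma bounded_set_enorm (A : set Rn) : bounded_set A ->
  exists2 r : R, 0 < r & forall y, A y -> enorm y <= r.
Proof.
move=> [M [_ HM]]; exists ((n%:R * (`|M| + 1)) + 1).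
  by rewrite ltr_wpDl// mulr_ge0// addr_ge0.
move=> y Ay; apply: ler_wpDr => //; apply: le_trans (enorm_le_normr y) _.
by rewrite ler_wpM2l//; apply: HM => //; rewrite (le_lt_trans (ler_norm M))// ltrDl.
Qed.

Lemma continuous_enorm_lipschitz (f : Rn -> R) (r : R) :
  (forall u v, `|f u - f v| <= r * enorm (u - v)) -> continuous f.
Proof.
move=> fr u; apply/(@cvgrPdist_le _ _ _ (nbhs u) (nbhs_filter u)) => e e0.
pose c := `|r| * n%:R + 1; have c0 : 0 < c by rewrite ltr_wpDl// mulr_ge0.
near=> v; apply: le_trans (fr u v) _.
apply: (@le_trans _ _ (c * `|u - v|)).
  apply: le_trans (_ : `|r| * (n%:R * `|u - v|) <= _).
    apply: (@le_trans _ _ (`|r| * enorm (u - v))).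
      by rewrite ler_wpM2r ?enorm_ge0// ler_norm.
    by rewrite ler_wpM2l// enorm_le_normr.
  by rewrite mulrA ler_wpM2r// lerDl.
rewrite -ler_pdivlMl// mulrC; near: v.
by apply: (@cvgr_dist_le _ _ _ (nbhs u) _ id u) => //; rewrite divr_gt0.
Unshelve. all: by end_near. Qed.

End row_norms.

Section support_function.
Context {R : realType} (m : nat) (Q : set 'rV[R]_m).
Hypotheses (Qbody : convex_body Q) (Q0 : Q° 0).
Local Notation Rm := 'rV[R]_m.
Local Notation h := (support_fun Q).

Lemma Q_inner_radius : exists2 r : R, 0 < r & forall y : Rm, enorm y <= r -> Q y.
Proof.
have := Q0; rewrite /interior => /nbhs_ballP[e /= e0 eQ].
exists (e / 2); first by rewrite divr_gt0.
move=> y ye; apply: eQ; split => // i j.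
rewrite -ball_normE /ball_ /= mxE sub0r normrN.
apply: le_lt_trans (normr_le_enorm y i j) _; apply: le_lt_trans ye _.
by rewrite ltr_pdivrMr// mulr_natr mulr2n ltrDl.
Qed.

Lemma Q_outer_radius : exists2 r : R, 0 < r & forall y : Rm, Q y -> enorm y <= r.
Proof.
by have [cQ _ _] := Qbody; exact: bounded_set_enorm (compact_bounded cQ).
Qed.

Lemma Q_zero : Q 0.
Proof. exact: nbhs_singleton Q0. Qed.

Lemma support_ub u y : Q y -> dotv y u <= h u.
Proof.
move=> Qy; apply: ub_le_sup; last by exists y.
have [r r0 Qr] := Q_outer_radius; exists (r * enorm u) => _ [z Qz <-].
apply: le_trans (dotv_le_enorm _ _) _.
by rewrite ler_wpM2r ?enorm_ge0// Qr.
Qed.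

Lemma support_le u c : (forall y, Q y -> dotv y u <= c) -> h u <= c.
Proof.
move=> H; apply: ge_sup; first by exists (dotv 0 u), 0 => //; exact: Q_zero.
by move=> _ [y Qy <-]; exact: H.
Qed.

Lemma support_ge0 u : 0 <= h u.
Proof.
apply: le_trans (support_ub _ Q_zero).
by rewrite /dotv big1// => i _; rewrite mxE mul0r.
Qed.

Lemma supportZ t u : 0 <= t -> h (t *: u) = t * h u.
Proof.
move=> t0; apply/eqP; rewrite eq_le; apply/andP; split.
  by apply: support_le => y Qy; rewrite dotvZr ler_wpM2l// support_ub.
have [->|tn0] := eqVneq t 0; first by rewrite mul0r support_ge0.
have {}t0 : 0 < t by rewrite lt0r tn0.
rewrite mulrC -ler_pdivlMr//; apply: support_le => y Qy.
by rewrite ler_pdivlMr// mulrC -dotvZr support_ub.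
Qed.

Lemma supportD u v : h (u + v) <= h u + h v.
Proof. by apply: support_le => y Qy; rewrite dotvDr lerD// support_ub. Qed.

Lemma support_enorm_le : exists2 r : R, 0 < r & forall u, h u <= r * enorm u.
Proof.
have [r r0 Qr] := Q_outer_radius; exists r => // u; apply: support_le => y Qy.
by apply: le_trans (dotv_le_enorm _ _) _; rewrite ler_wpM2r ?enorm_ge0// Qr.
Qed.

Lemma enorm_support_le : exists2 r : R, 0 < r & forall u, r * enorm u <= h u.
Proof.
have [r r0 Qr] := Q_inner_radius; exists r => // u.
have [->|u0] := eqVneq u 0; first by rewrite enorm0 mulr0 support_ge0.
have e0 := enorm_gt0 u0.
apply: le_trans (support_ub (y := (r / enorm u) *: u) _ _).
  rewrite dotvZl -enorm_rv_sqr expr2 mulrA ler_wpM2r ?enorm_ge0//.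
  by rewrite mulfVK// gt_eqF.
apply: Qr; rewrite enormZ ger0_norm; last by rewrite divr_ge0// ltW.
by rewrite mulfVK// gt_eqF.
Qed.

Lemma continuous_support : continuous (h : Rm -> R).
Proof.
have [r r0 hr] := support_enorm_le.
have lip u v : h u - h v <= r * enorm (u - v).
  by rewrite lerBlDl; apply: le_trans (lerD (lexx _) (hr _)); apply: le_trans (supportD _ _); rewrite addrC subrK.
apply: (@continuous_enorm_lipschitz _ _ _ r) => u v; rewrite ler_norml lip andbT.
rewrite lerNl opprB; apply: le_trans (lip _ _) _.
by rewrite -opprB -scaleN1r enormZ normrN1 mul1r.
Qed.

Lemma measurable_support d (S : measurableType d) (f : S -> Rm) :
  measurable_fun setT f -> measurable_fun setT (fun x => h (f x)).
Proof.
exact: measurableT_comp (continuous_measurable_mx continuous_support).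
Qed.

End support_function.

(** With l = ln (G / (t N)) and N^-k factored out, this reads exp (- k l) + (k/p) exp (p l) >= 1 +
    k/p. It follows from exp x >= 1 + x applied to both exponents; the weight k/p is the one for
    which the linear terms cancel. *)
Lemma young_gauge {R : realType} (k : nat) (p t N G : R) :
  0 < p -> 0 < t -> 0 < N -> 0 < G ->
  (1 + k%:R / p) * N^-1 ^+ k <=
  t ^+ k * (G ^+ k)^-1 + k%:R / p * t `^ (- p) * (N `^ (- (k%:R + p)) * G `^ p).
Proof.
move=> p0 t0 N0 G0; rewrite /powR !gt_eqF//.
have XE x : 0 < x -> x ^+ k = expR (k%:R * ln x).
  by move=> x0; rewrite -[in LHS](lnK x0) -expRM_natl.
rewrite exprVn !XE// -!expRN -!expRD -mulrA -!expRD.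
set l := ln G - ln t - ln N.
have -> : k%:R * ln t - k%:R * ln G = - (k%:R * l) - k%:R * ln N by rewrite /l; ring.
have -> : - p * ln t + (- (k%:R + p) * ln N + p * ln G) = p * l - k%:R * ln N.
  by rewrite /l; ring.
rewrite !expRD mulrA -mulrDl ler_wpM2r ?expR_ge0//.
have h1 := expR_ge1Dx (- (k%:R * l)); have h2 := expR_ge1Dx (p * l).
have kp : 0 <= k%:R / p by rewrite divr_ge0// ltW.
apply: le_trans (lerD h1 (ler_wpM2l kp h2)).
have p0' : p != 0 by rewrite gt_eqF.
suff -> : 1 - k%:R * l + k%:R / p * (1 + p * l) = 1 + k%:R / p by [].
by field.
Qed.

(** * Bounds on the energy of a vector field *)

Section energy.
Context {R : realType} (n m : nat) (p : R) (Q : set 'rV[R]_m).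
Hypotheses (n_gt0 : (0 < n)%N) (m_gt0 : (0 < m)%N) (p_ge1 : 1 <= p).
Hypotheses (Qbody : convex_body Q) (Q0 : Q° 0).
Local Notation Rn := 'rV[R]_n.
Local Notation Rnm := 'M[R]_(n, m).
Local Notation h := (support_fun Q).
Local Notation k := (n * m)%N.
Local Notation sph1 := (@sphere_measure R 1 n).
Local Notation sphm := (@sphere_measure R n m).
Local Notation S1 := (@esphere R n m).
Local Open Scope ereal_scope.

Let p_gt0 : (0 < p)%R. Proof. exact: lt_le_trans p_ge1. Qed.
Let k_gt0 : (0 < k)%N. Proof. by rewrite muln_gt0 n_gt0. Qed.
Let n1_gt0 : (0 < 1 * n)%N. Proof. by rewrite mul1n. Qed.

Lemma enorm_mulmx_le (v : Rn) (th : Rnm) : (enorm (v *m th) <= enorm v * enorm th)%R.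
Proof.
rewrite -(ler_pXn2r (n := 2)) ?nnegrE ?mulr_ge0 ?enorm_ge0// exprMn !(sqr_enorm (_ *m _)).
rewrite big_ord1 (sqr_enorm th) exchange_big/= mulr_sumr; apply: ler_sum => j _.
have -> : (v *m th) 0%R j = dotv v (col j th)^T.
  by rewrite mxE; apply: eq_bigr => i _; rewrite !mxE.
have -> : (\sum_i th i j ^+ 2 = enorm (col j th)^T ^+ 2)%R.
  by rewrite enorm_rv_sqr; apply: eq_bigr => i _; rewrite !mxE expr2.
rewrite -exprMn -(real_normK (num_real (dotv _ _))).
by rewrite ler_pXn2r ?nnegrE ?mulr_ge0 ?enorm_ge0// normr_dotv_le.
Qed.

Section field.
Context d (T : measurableType d) (mu : {sigma_finite_measure set T -> \bar R}).
Variable g : T -> Rn.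
Hypothesis mg : measurable_fun setT g.

Definition hfield (th : Rnm) (x : T) : R := h (g x *m th).

Lemma measurable_hfield th : measurable_fun setT (hfield th).
Proof. by apply: measurable_support => //; apply: measurable_mulmx. Qed.

Lemma measurable_hfield2 : measurable_fun setT (fun z : Rnm * T => hfield z.1 z.2).
Proof.
apply: measurable_support => //; apply: measurable_mulmx.
  exact: measurableT_comp mg measurable_snd.
exact: measurable_fst.
Qed.

Lemma hfield_ge0 th x : (0 <= hfield th x)%R. Proof. exact: support_ge0. Qed.

Lemma abse_hfield th x : `|(hfield th x)%:E| = (hfield th x)%:E.
Proof. by rewrite gee0_abs// lee_fin hfield_ge0. Qed.

Lemma Lnorm_hfield th : Lnorm mu p%:E (EFin \o hfield th) =
  (\int[mu]_x (hfield th x `^ p)%:E) `^ p^-1.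
Proof.
rewrite LnormE; congr (_ `^ _); apply: eq_integral => x _ /=.
by rewrite ger0_norm ?hfield_ge0// poweR_EFin.
Qed.

Lemma measurable_hfield_powR2 :
  measurable_fun setT (fun z : Rnm * T => (hfield z.1 z.2 `^ p)%:E).
Proof.
apply/measurable_EFinP.
exact: measurableT_comp (measurable_powR _) measurable_hfield2.
Qed.

Lemma measurable_int_hfield :
  measurable_fun setT (fun th : Rnm => \int[mu]_x (hfield th x `^ p)%:E).
Proof.
apply: (measurable_fun_fubini_tonelli_F (m2 := mu) _ measurable_hfield_powR2).
by move=> z; rewrite lee_fin powR_ge0.
Qed.

Lemma measurable_Lnorm_hfield :
  measurable_fun setT (fun th => Lnorm mu p%:E (EFin \o hfield th)).
Proof.
under eq_fun do rewrite Lnorm_hfield.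
exact: measurableT_comp (measurable_poweR _) measurable_int_hfield.
Qed.

Lemma Lnorm_hfield_le (C : R) : (0 < C)%R -> (forall u, h u <= C * enorm u)%R ->
  forall th, Lnorm mu p%:E (EFin \o hfield th) <=
  (C * enorm th)%:E * Lnorm mu p%:E (fun x => (enorm (g x))%:E).
Proof.
move=> C0 hC th.
have mge : measurable_fun setT (fun x => enorm (g x)).
  exact: measurableT_comp (@measurable_enorm R 1 n) mg.
rewrite -(LnormMl _ p_gt0 _ mge) ?mulr_ge0 ?enorm_ge0 ?(ltW C0)//.
apply: (le_Lnorm _ p_gt0) => //.
- by apply/measurable_EFinP; exact: measurable_hfield.
- by apply/measurable_EFinP; exact: measurable_funM.
move=> x; rewrite abse_hfield abse_EFin lee_fin.
apply: le_trans (hC _) _; rewrite ger0_norm ?mulr_ge0 ?enorm_ge0 ?(ltW C0)//.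
by rewrite -mulrA ler_wpM2l ?(ltW C0)// mulrC enorm_mulmx_le.
Qed.

Lemma Lnorm_hfield_ge (r : R) (K : \bar R) : (0 < r)%R ->
  (forall u, r * enorm u <= h u)%R -> 0 <= K ->
  (forall u : Rn, (enorm u)%:E * K <= Lnorm mu p%:E (fun x => (dotv (g x) u)%:E)) ->
  forall th, (r / Num.sqrt m%:R * enorm th)%:E * K <= Lnorm mu p%:E (EFin \o hfield th).
Proof.
move=> r0 hr K0 HK th; set s := Num.sqrt m%:R; have s0 : (0 < s)%R by rewrite sqrtr_gt0 ltr0n.
have s2 : (s ^+ 2 = m%:R)%R by rewrite sqr_sqrtr.
(* Pigeonhole: the squared lengths of the [m] columns add up to [enorm th ^+ 2], whence the factor
   [Num.sqrt m%:R]. *)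
have [j Hj] : exists j : 'I_m, (enorm th / s <= enorm (col j th)^T)%R.
  apply/not_existsP => H.
  have : (enorm th ^+ 2 < enorm th ^+ 2)%R.
    rewrite {1}sqr_enorm exchange_big/=.
    apply: (@lt_le_trans _ _ (\sum_(j < m) (enorm th / s) ^+ 2)%R).
      apply: ltr_sum => [|j _]; first by apply/hasP; exists (Ordinal m_gt0); rewrite ?mem_index_enum.
      have /negP := H j; rewrite -ltNge => h1.
      rewrite [ltLHS](_ : _ = enorm (col j th)^T ^+ 2)%R; last first.
        by rewrite enorm_rv_sqr; apply: eq_bigr => i _; rewrite !mxE expr2.
      by rewrite ltr_pXn2r ?nnegrE ?divr_ge0 ?enorm_ge0// ltW.
    rewrite sumr_const card_ord expr_div_n s2 -[leLHS]mulr_natr mulfVK//.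
    by rewrite pnatr_eq0 gtn_eqF.
  by rewrite ltxx.
set u := (col j th)^T in Hj *.
have mgu := measurable_dotv u mg.
apply: (@le_trans _ _ (r%:E * Lnorm mu p%:E (fun x => (dotv (g x) u)%:E))).
  apply: le_trans (lee_wpmul2l _ (HK u)); last by rewrite lee_fin ltW.
  rewrite muleA -EFinM lee_wpmul2r// lee_fin mulrAC -mulrA.
  by rewrite ler_wpM2l ?(ltW r0).
rewrite -(LnormMl _ p_gt0 (ltW r0) mgu); apply: (le_Lnorm _ p_gt0) => //.
- by apply/measurable_EFinP; exact: measurable_funM.
- by apply/measurable_EFinP; exact: measurable_hfield.
move=> x; rewrite abse_hfield abse_EFin lee_fin normrM gtr0_norm//.
apply: le_trans (hr _); rewrite ler_wpM2l ?(ltW r0)//.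
have -> : dotv (g x) u = (g x *m th) 0%R j.
  by rewrite mxE; apply: eq_bigr => i _; rewrite !mxE.
exact: normr_le_enorm.
Qed.

End field.

End energy.

(** * The polar gauge and its invariance *)

Section polar_gauge.
Context {R : realType} (n m : nat) (p : R) (Q : set 'rV[R]_m).
Hypotheses (n_gt0 : (0 < n)%N) (m_gt0 : (0 < m)%N) (p_ge1 : 1 <= p).
Hypotheses (Qbody : convex_body Q) (Q0 : Q° 0).
Local Notation Rn := 'rV[R]_n.
Local Notation Rnm := 'M[R]_(n, m).
Local Notation h := (support_fun Q).
Local Notation k := (n * m)%N.
Local Notation sph1 := (@sphere_measure R 1 n).
Local Notation sphm := (@sphere_measure R n m).
Local Notation S1 := (@esphere R n m).
Local Open Scope ereal_scope.

Let p_gt0 : (0 < p)%R. Proof. exact: lt_le_trans p_ge1. Qed.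
Let k_gt0 : (0 < k)%N. Proof. by rewrite muln_gt0 n_gt0. Qed.
Let n1_gt0 : (0 < 1 * n)%N. Proof. by rewrite mul1n. Qed.

Let mid : measurable_fun setT (@id Rn). Proof. exact: measurable_id. Qed.

Lemma ae_sphere_enorm : {ae sph1, forall v : Rn, enorm v = 1%R}.
Proof.
exists (~` @esphere R 1 n); split; first exact: measurableC (@measurable_esphere R 1 n).
  exact: sphere_measure_setC.
by move=> v /=; apply: contra_not.
Qed.

Lemma measurable_enorm_rv : measurable_fun setT (fun v : Rn => (enorm v)%:E).
Proof. by apply/measurable_EFinP; exact: (@measurable_enorm R 1 n). Qed.

Lemma Lnorm_sphere_enorm : Lnorm sph1 p%:E (fun v : Rn => (enorm v)%:E) = sph1 setT `^ p^-1.
Proof.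
rewrite -Lnorm_cst1; apply: (ae_eq_Lnorm p_gt0) => //.
- exact: measurable_enorm_rv.
- by apply: filterS ae_sphere_enorm => v ->.
Qed.

Lemma sph1T : sph1 setT = (fine (sph1 setT))%:E.
Proof. by rewrite fineK// fin_num_measure. Qed.

Lemma sph1T_gt0 : (0 < fine (sph1 setT))%R.
Proof. by rewrite -lte_fin -sph1T sphere_measure_gt0. Qed.

Lemma polar_gauge_ge0 th : 0 <= @polar_gauge R n m p Q th.
Proof. exact: Lnorm_ge0. Qed.

(** The polar gauge is the norm of [hfield Q id th], for the identity field on the unit sphere of
    R^n. The estimates for general fields therefore apply to it, here and in the lower bound
    [pgauge_ge]. *)
Lemma polar_gauge_le : exists2 C : R, (0 < C)%R & forall th : Rnm,
  polar_gauge p Q th <= (C * enorm th)%:E.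
Proof.
have [C C0 hC] := support_enorm_le Qbody Q0.
exists (C * (fine (sph1 setT)) `^ p^-1)%R; first by rewrite mulr_gt0//; apply: powR_gt0; exact: sph1T_gt0.
move=> th; apply: le_trans (Lnorm_hfield_le p_ge1 Qbody Q0 sph1 mid C0 hC th) _.
by rewrite Lnorm_sphere_enorm sph1T poweR_EFin -EFinM mulrAC.
Qed.

Lemma polar_gauge_fin th : @polar_gauge R n m p Q th \is a fin_num.
Proof.
have [C _ HC] := polar_gauge_le.
by rewrite ge0_fin_numE ?polar_gauge_ge0// (le_lt_trans (HC th))// ltry.
Qed.

Definition pgauge (th : Rnm) : R := fine (polar_gauge p Q th).

Lemma pgaugeE th : (pgauge th)%:E = polar_gauge p Q th.
Proof. by rewrite fineK// polar_gauge_fin. Qed.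

Lemma pgauge_ge0 th : (0 <= pgauge th)%R.
Proof. by rewrite -lee_fin pgaugeE polar_gauge_ge0. Qed.

Lemma measurable_pgauge : measurable_fun setT pgauge.
Proof.
apply: measurableT_comp; first exact: fine_measurable.
exact: (measurable_Lnorm_hfield p Qbody Q0 sph1 mid).
Qed.

Lemma pgaugeZ t th : (0 <= t)%R -> pgauge (t *: th)%R = (t * pgauge th)%R.
Proof.
move=> t0; apply: EFin_inj; rewrite EFinM !pgaugeE.
rewrite -(LnormMl _ p_gt0 t0 (measurable_hfield Qbody Q0 mid th)).
apply: eq_Lnorm => v; rewrite /hfield -scalemxAr supportZ//.
Qed.

Lemma pgauge_powR th : \int[sph1]_v (h (v *m th) `^ p)%:E = (pgauge th `^ p)%:E.
Proof.
rewrite -poweR_EFin pgaugeE [polar_gauge _ _ _](Lnorm_hfield p Qbody Q0 sph1 id th).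
rewrite -poweRrM mulVf ?gt_eqF// poweRe1//.
by apply: integral_ge0 => v _; rewrite lee_fin powR_ge0.
Qed.

Section reflection.
Variable O : 'M[R]_n.
Hypotheses (OT : (O^T = O)%R) (OO : (O *m O = 1%:M)%R).

Lemma enorm_reflect_row (v : Rn) : enorm (v *m O)%R = enorm v.
Proof.
rewrite -(enorm_trmx (v *m O)) trmx_mul OT -[RHS]enorm_trmx.
by apply: enorm_mulmx_orthol; rewrite OT.
Qed.

Lemma reflect_rowK : involutive (mulmxr O : Rn -> Rn).
Proof. by move=> v /=; rewrite -mulmxA OO mulmx1. Qed.

Lemma reflectK : involutive (mulmx O : Rnm -> Rnm).
Proof. by move=> v /=; rewrite mulmxA OO mul1mx. Qed.

Lemma enorm_reflect (th : Rnm) : enorm (O *m th)%R = enorm th.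
Proof. by apply: enorm_mulmx_orthol; rewrite OT. Qed.

Lemma integral_reflect_row (f : Rn -> \bar R) : measurable_fun setT f ->
  (forall v, 0 <= f v) -> \int[sph1]_v f (v *m O)%R = \int[sph1]_v f v.
Proof.
move=> mf f0.
apply: (ge0_integral_sphere_isometry (L := mulmxr O) _ reflect_rowK enorm_reflect_row mf f0).
exact: measurable_mulmx.
Qed.

Lemma integral_reflect (f : Rnm -> \bar R) : measurable_fun setT f ->
  (forall v, 0 <= f v) -> \int[sphm]_th f (O *m th)%R = \int[sphm]_th f th.
Proof.
move=> mf f0.
apply: (ge0_integral_sphere_isometry (L := mulmx O) _ reflectK enorm_reflect mf f0).
exact: measurable_mulmx.
Qed.

(** By associativity [O] moves from [th] to the integration variable [v], over which the sphere
    measure is invariant. *)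
Lemma pgauge_reflect th : pgauge (O *m th)%R = pgauge th.
Proof.
have H : (pgauge (O *m th) `^ p = pgauge th `^ p)%R.
  apply: EFin_inj; rewrite -!pgauge_powR -[RHS]integral_reflect_row.
  - by apply: eq_integral => v _; rewrite mulmxA.
  - apply/measurable_EFinP; apply: (measurableT_comp (measurable_powR _)).
    exact: (measurable_hfield Qbody Q0 mid).
  - by move=> v; rewrite lee_fin powR_ge0.
have := congr1 (fun x : R => x `^ p^-1)%R H.
by rewrite -!powRrM mulfV ?gt_eqF// !powRr1 ?pgauge_ge0.
Qed.

End reflection.

(** By reflection invariance and homogeneity the norm depends on [u] only through its length, so [I]
    is the L^p norm of any coordinate function on the sphere. This is the directional lower bound
    that [Lnorm_hfield_ge] asks of the identity field. *)
Lemma integral_dotv_sphere : exists2 I : R, (0 < I)%R & forall u : Rn,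
  (enorm u * I)%:E = Lnorm sph1 p%:E (fun v => (dotv v u)%:E).
Proof.
pose L u := Lnorm sph1 p%:E (fun v => (dotv v u)%:E).
have mdot (u : Rn) : measurable_fun setT (fun v : Rn => dotv v u).
  exact: measurable_dotv (@measurable_id _ _ setT).
have mdotp (u : Rn) : measurable_fun setT (fun v : Rn => (`|dotv v u| `^ p)%:E).
  apply/measurable_EFinP; apply: (measurableT_comp (measurable_powR _)).
  exact: measurableT_comp.
have LE u : L u = (\int[sph1]_v (`|dotv v u| `^ p)%:E) `^ p^-1.
  by rewrite /L LnormE; congr (_ `^ _); apply: eq_integral => v _; rewrite abse_EFin poweR_EFin.
have LZ t u : (0 <= t)%R -> L (t *: u)%R = t%:E * L u.
  move=> t0; rewrite /L -(LnormMl _ p_gt0 t0 (mdot u)).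
  by apply: eq_Lnorm => v; rewrite dotvZr.
have Lrot u w : enorm u = enorm w -> L u = L w.
  move=> /householder [ O [ OT OO uO]]; rewrite -uO !LE; congr (_ `^ _).
  rewrite -(integral_reflect_row OT OO (mdotp (u *m O)%R)) => [|v]; last by rewrite lee_fin powR_ge0.
  apply: eq_integral => v _; congr (`|_| `^ _)%:E.
  have := dotvE (v *m O) (u *m O).
  rewrite trmx_mul OT mulmxA -(mulmxA v O O) OO mulmx1 dotvE => /matrixP/(_ ord0 ord0).
  by rewrite !mxE.
pose e i : Rn := delta_mx 0%R i.
have e1 i : enorm (e i) = 1%R by exact: enorm_delta.
have Lfin u : L u \is a fin_num.
  rewrite ge0_fin_numE ?Lnorm_ge0//.
  apply: (@le_lt_trans _ _ ((enorm u)%:E * Lnorm sph1 p%:E (fun v : Rn => (enorm v)%:E))).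
    rewrite -(LnormMl _ p_gt0 _ (@measurable_enorm R 1 n)) ?enorm_ge0//.
    apply: (le_Lnorm _ p_gt0).
    - exact/measurable_EFinP.
    - by apply/measurable_EFinP; apply: measurable_funM => //; exact: measurable_enorm.
    - move=> v; rewrite !abse_EFin lee_fin [leRHS]ger0_norm ?mulr_ge0 ?enorm_ge0//.
      by rewrite mulrC normr_dotv_le.
  by rewrite Lnorm_sphere_enorm sph1T poweR_EFin -EFinM ltry.
pose i0 := Ordinal n_gt0.
have Lu u : L u = (enorm u)%:E * L (e i0).
  by rewrite -LZ ?enorm_ge0//; apply: Lrot; rewrite enormZ e1 mulr1 ger0_norm ?enorm_ge0.
exists (fine (L (e i0))); last by move=> u; rewrite EFinM fineK ?Lfin// -Lu.
rewrite fine_gt0// ltey_eq Lfin/= andbT lt0e Lnorm_ge0 andbT; apply/eqP => L0.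
(* If [I] were 0, all coordinates would vanish almost everywhere, whereas almost every [v] has norm
   1 and the sphere has positive measure. *)
have Li0 i : {ae sph1, forall v : Rn, dotv v (e i) = 0%R}.
  have Lei : L (e i) = 0 by rewrite Lu e1 mul1e.
  have m_e : measurable_fun setT (fun v : Rn => (dotv v (e i))%:E).
    exact/measurable_EFinP.
  have p0e : 0 < p%:E by rewrite lte_fin.
  have := Lnorm_eq0_eq0 m_e p0e Lei.
  by apply: filterS => v /(_ I)/= [].
have : {ae sph1, forall v : Rn, False}.
  have Hall : {ae sph1, forall v : Rn, forall i, dotv v (e i) = 0%R}.
    by apply: filter_forall.
  apply: filterS (filterI ae_sphere_enorm Hall) => v [v1 v0].
  have : v = 0%R.
    by apply/rowP => i; rewrite mxE -(v0 i) dotv_delta.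
  by move=> v00; move: v1; rewrite v00 enorm0 => /eqP; rewrite eq_sym oner_eq0.
move=> [A [mA A0 HA]]; have := sphere_measure_gt0 (R := R) n1_gt0.
rewrite (_ : setT = A) ?A0 ?ltxx//.
by apply/seteqP; split => // v _; exact: HA.
Qed.

Lemma pgauge_ge : exists2 c : R, (0 < c)%R & forall th, (c * enorm th <= pgauge th)%R.
Proof.
have [I I0 HI] := integral_dotv_sphere.
have [r r0 hr] := enorm_support_le Qbody Q0.
have s0 : (0 < Num.sqrt m%:R :> R)%R by rewrite sqrtr_gt0 ltr0n.
exists (r / Num.sqrt m%:R * I)%R; first by rewrite mulr_gt0// divr_gt0.
move=> th; rewrite -lee_fin pgaugeE mulrAC EFinM.
apply: (Lnorm_hfield_ge (mu := sph1) m_gt0 p_ge1 Qbody Q0 mid r0 hr).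
  by rewrite lee_fin ltW.
by move=> u; rewrite -EFinM HI.
Qed.

End polar_gauge.

Lemma measurable_inve_ge0 d (T : measurableType d) {R : realType} (f : T -> \bar R) :
  measurable_fun setT f -> (forall x, 0 <= f x)%E ->
  measurable_fun setT (fun x => (f x)^-1)%E.
Proof.
move=> mf f0 mT; apply: (measurability _ (ErealGenOInfty.measurableE R)) => //.
move=> _ [_ [y ->] <-]; apply: measurableI => //.
have [y0|y0] := ltP y 0.
  rewrite (_ : _ @^-1` _ = setT)//; apply/seteqP; split => // x _ /=.
  by rewrite in_itv/= andbT (@lt_le_trans _ _ 0%E) ?lte_fin// inve_ge0.
rewrite (_ : _ @^-1` _ = setT `&` f @^-1` `]-oo, (y%:E)^-1%E[%classic).
  by apply: mf => //; exact: emeasurable_itv.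
rewrite setTI; apply/seteqP; split => x /=; rewrite !in_itv/= andbT.
  by rewrite inve_pgt// inE ?lee_fin.
by rewrite inve_pgt// inE ?lee_fin.
Qed.

Lemma measurable_expe d (T : measurableType d) {R : realType} (f : T -> \bar R) k :
  measurable_fun setT f -> measurable_fun setT (fun x => f x ^+ k)%E.
Proof.
move=> mf; elim: k => [|k IH].
  by under eq_fun do rewrite expe0; exact: measurable_cst.
by under eq_fun do rewrite expeS; exact: emeasurable_funM.
Qed.

(** Only an inequality, because the product is 0 at 0 and at +oo. *)
Lemma mule_inve_le1 {R : realType} (x : \bar R) : (0 <= x -> x * x^-1 <= 1)%E.
Proof.
case: x => [r r0||//]; last by rewrite invey mule0 lee_fin.
have [->|r00] := eqVneq r 0; first by rewrite mul0e lee_fin.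
by rewrite divee.
Qed.

(** * Two-sided estimates of the affine energy *)

Section energy_bounds.
Context {R : realType} (n m : nat) (p : R) (Q : set 'rV[R]_m).
Hypotheses (n_gt0 : (0 < n)%N) (m_gt0 : (0 < m)%N) (p_ge1 : 1 <= p).
Hypotheses (Qbody : convex_body Q) (Q0 : Q° 0).
Local Notation Rn := 'rV[R]_n.
Local Notation Rnm := 'M[R]_(n, m).
Local Notation h := (support_fun Q).
Local Notation k := (n * m)%N.
Local Notation sph1 := (@sphere_measure R 1 n).
Local Notation sphm := (@sphere_measure R n m).
Local Notation S1 := (@esphere R n m).
Local Notation leb := (@lebesgue_mx R n m).
Local Notation N := (@pgauge R n m p Q).
Local Open Scope ereal_scope.

Let p_gt0 : (0 < p)%R. Proof. exact: lt_le_trans p_ge1. Qed.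
Let k_gt0 : (0 < k)%N. Proof. by rewrite muln_gt0 n_gt0. Qed.
Let kR_gt0 : (0 < k%:R :> R)%R. Proof. by rewrite ltr0n. Qed.
Let mid : measurable_fun setT (@id Rn). Proof. exact: measurable_id. Qed.
Let mN : measurable_fun setT N.
Proof. exact: measurable_pgauge. Qed.

(** The weight of the cross term: N^-k, by which the scalar inequality is multiplied, times the N^-p
    contained in (G / (t N))^p. *)
Let W (th : Rnm) : R := N th `^ (- (k%:R + p)).

Let mW : measurable_fun setT W.
Proof. exact: measurableT_comp (measurable_powR _) mN. Qed.

Let c (u : Rn) : \bar R := \int[sphm]_th (W th * h (u *m th) `^ p)%:E.

Let mc_int u : measurable_fun setT (fun th => (W th * h (u *m th) `^ p)%:E).
Proof.
apply/measurable_EFinP; apply: measurable_funM => //.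
apply: (measurableT_comp (measurable_powR _)); apply: measurable_support => //.
exact: measurable_mulmx.
Qed.

Let c_int_ge0 u th : 0 <= (W th * h (u *m th) `^ p)%:E.
Proof. by rewrite lee_fin mulr_ge0 ?powR_ge0. Qed.

Let c_rot u w : enorm u = enorm w -> c u = c w.
Proof.
move=> /householder [ O [ OT OO uO]].
have H := integral_reflect OT OO (mc_int u) (c_int_ge0 u).
rewrite /c -H {H}; apply: eq_integral => th _.
by rewrite /W (@pgauge_reflect R n m p Q n_gt0 p_ge1 Qbody Q0 O OT OO th) -uO mulmxA.
Qed.

Let cZ t u : (0 <= t)%R -> c (t *: u)%R = (t `^ p)%:E * c u.
Proof.
move=> t0; rewrite /c -ge0_integralZl//; last by rewrite lee_fin powR_ge0.
apply: eq_integral => th _; rewrite -scalemxAl supportZ// powRM ?support_ge0//.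
by rewrite -EFinM mulrCA.
Qed.

Let e : Rn := delta_mx 0%R (Ordinal n_gt0).

Let cE u : c u = (enorm u `^ p)%:E * c e.
Proof.
rewrite -(cZ e (enorm_ge0 u)); apply: c_rot.
by rewrite enormZ enorm_delta mulr1 ger0_norm ?enorm_ge0.
Qed.

Let c_ge0 u : 0 <= c u. Proof. by apply: integral_ge0 => th _; exact: c_int_ge0. Qed.

Let s := fine (sph1 setT).
Let s_gt0 : (0 < s)%R. Proof. exact: sph1T_gt0. Qed.

(** The factor n omega_n is the total mass [s] of the unit sphere of R^n. *)
Let dE : @d_const R n m p Q =
  (s `^ p^-1)%:E * (k%:R%:E * leb [set th | (N th <= 1)%R]) `^ (k%:R^-1).
Proof.
rewrite /d_const -poweR_EFin /s -sph1T//; congr (_ `^ _ * _).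
  by rewrite /sphere_measure preimage_setT setIT mul1n.
congr ((_ * leb _) `^ _); apply/seteqP; split => th /=.
  by rewrite /polar_proj_body /= -pgaugeE.
by rewrite /polar_proj_body /= -pgaugeE.
Qed.

Lemma d_const_gt0 : 0 < @d_const R n m p Q.
Proof.
rewrite dE mule_gt0//; first by rewrite lte_fin powR_gt0.
have [C C0 HC] := @polar_gauge_le R n m p Q n_gt0 p_ge1 Qbody Q0.
have mP : measurable [set th : Rnm | (N th <= 1)%R].
  rewrite (_ : [set _ | _] = N @^-1` `]-oo, 1%R]%classic).
    by rewrite -[X in measurable X]setTI; apply: mN.
  by apply/seteqP; split => M /=; rewrite in_itv.
(* As [N] is at most [C] times the Euclidean norm, the polar body contains the ball of radius
   1/C. *)
have H : 0 < leb [set th | (N th <= 1)%R].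
  apply: (@lt_le_trans _ _ (leb ((fun x : Rnm => C *: x)%R @^-1` @eball R n m))).
    rewrite lebesgue_mxZ//; last exact: measurable_eball.
    by rewrite mule_gt0 ?lebesgue_eball_gt0// lte_fin exprn_gt0// invr_gt0.
  apply: le_measure; rewrite ?inE//.
    apply: measurable_preimage_mx; last exact: measurable_eball.
    exact: measurable_mxZ.
  move=> th; rewrite /eball/= enormZ gtr0_norm// => Cth.
  by rewrite -lee_fin pgaugeE//; apply: le_trans (HC th) _; rewrite lee_fin.
by apply: poweR_gt0; rewrite mule_gt0// lte_fin.
Qed.

Let sphm_gt0 : 0 < sphm S1.
Proof.
rewrite lt0e measure_ge0 andbT; apply/eqP => S0.
have mS := @measurable_esphere R n m.
have : sphm setT = sphm S1 + sphm (~` S1).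
  by rewrite -measureU ?setUv ?setICr//; exact: measurableC.
have -> : sphm (~` S1) = 0 by exact: sphere_measure_setC.
rewrite [sphm S1]S0 add0e => ST.
by have := sphere_measure_gt0 (R := R) k_gt0; rewrite ST ltxx.
Qed.

Section field.
Context d (T : measurableType d) (mu : {sigma_finite_measure set T -> \bar R}).
Variable g : T -> Rn.
Hypothesis mg : measurable_fun setT g.
Local Notation hf := (hfield Q g).

(** After Fubini the inner integral is [c (g x)], which [cE] reduces to a power of [enorm (g x)]. It
    serves twice: for the given field, and for the identity field on the sphere in order to express
    [c e] through [J]. *)
Lemma integral_weight_hfield : \int[sphm]_th ((W th)%:E * \int[mu]_x (hf th x `^ p)%:E) =
  \int[mu]_x (enorm (g x) `^ p)%:E * c e.
Proof.
rewrite -ge0_integralZr//; last 2 first.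
- apply/measurable_EFinP; apply: (measurableT_comp (measurable_powR _)).
  exact: measurableT_comp (@measurable_enorm R 1 n) mg.
- by move=> x _; rewrite lee_fin powR_ge0.
under [RHS]eq_integral do rewrite -cE.
pose F (z : Rnm * T) := (W z.1 * hf z.1 z.2 `^ p)%:E.
have mF : measurable_fun setT F.
  apply/measurable_EFinP; apply: measurable_funM.
    exact: measurableT_comp mW measurable_fst.
  apply: (measurableT_comp (measurable_powR _)).
  exact: measurable_hfield2.
have F0 z : 0 <= F z by rewrite lee_fin mulr_ge0 ?powR_ge0.
have H := fubini_tonelli (m1 := sphm) (m2 := mu) F mF F0.
apply: etrans H; apply: eq_integral => th _; rewrite -ge0_integralZl//.
- by apply/measurable_EFinP; apply: (measurableT_comp (measurable_powR _)); exact: measurable_hfield.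
- by move=> x _; rewrite lee_fin powR_ge0.
- by rewrite lee_fin powR_ge0.
Qed.

End field.

Let J := \int[sphm]_(th in S1) ((N th)^-1 ^+ k)%:E.

Let N_gt0 th : S1 th -> (0 < N th)%R.
Proof.
have [c0 c00 Hc] := @pgauge_ge R n m p Q n_gt0 m_gt0 p_ge1 Qbody Q0.
move=> th1; apply: lt_le_trans (Hc th); rewrite th1 mulr1//.
Qed.

Let measurable_Nk : measurable_fun setT (fun th => ((N th)^-1 ^+ k)%:E).
Proof.
apply/measurable_EFinP; apply: measurable_funX.
rewrite (_ : (fun _ => _) = (@powR R)^~ (-1)%R \o N).
  exact: measurableT_comp (measurable_powR _) mN.
by apply/funext => M /=; rewrite powR_inv1 ?pgauge_ge0.
Qed.

(** Finiteness of [J] is what allows a multiple of it to be cancelled in [young]. *)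
Let J_fin : J \is a fin_num.
Proof.
have [c0 c00 Hc] := @pgauge_ge R n m p Q n_gt0 m_gt0 p_ge1 Qbody Q0.
rewrite ge0_fin_numE; last first.
  by apply: integral_ge0 => th _; rewrite lee_fin exprn_ge0// invr_ge0 pgauge_ge0.
apply: (@le_lt_trans _ _ (\int[sphm]_(th in S1) (c0^-1 ^+ k)%:E)).
  apply: ge0_le_integral => //.
  - exact: measurable_esphere.
  - by move=> th _; rewrite lee_fin exprn_ge0// invr_ge0 pgauge_ge0.
  - exact: measurable_funTS.
  - move=> th th1; rewrite lee_fin ler_pXn2r ?nnegrE ?invr_ge0 ?pgauge_ge0 ?(ltW c00)//.
    by rewrite lef_pV2 ?posrE ?N_gt0//; have := Hc th; rewrite th1 mulr1.
rewrite integral_cst//; last exact: measurable_esphere.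
apply: lte_mul_pinfty; rewrite ?lee_fin ?exprn_ge0 ?invr_ge0 ?(ltW c00)//.
by rewrite -ge0_fin_numE// fin_num_measure//; exact: measurable_esphere.
Qed.

(** Since W N^p = N^-k, [J] is the weighted integral of the identity field on the sphere, whose
    values have norm 1 almost everywhere. *)
Let J_E : J = s%:E * c e.
Proof.
have E1 : J = \int[sphm]_(th in S1) ((W th)%:E * \int[sph1]_v (hfield Q id th v `^ p)%:E).
  apply: eq_integral => th /set_mem th1.
  rewrite [X in _ * X](pgauge_powR n_gt0 p_ge1 Qbody Q0 th) -EFinM /W.
  rewrite -powRD; last by apply/implyP => _; rewrite gt_eqF// N_gt0.
  by rewrite opprD addrNK powRN powR_mulrn ?pgauge_ge0// exprVn.
rewrite E1 integral_esphere//.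
- rewrite (integral_weight_hfield sph1 mid).
  congr (_ * _); rewrite /s -sph1T//.
  transitivity (\int[sph1]_v (cst 1 v : \bar R)); last by rewrite integral_cst// mul1e.
  apply: ae_eq_integral => //.
    by apply/measurable_EFinP; apply: (measurableT_comp (measurable_powR _)); exact: measurable_enorm.
  by apply: filterS (@ae_sphere_enorm R n n_gt0) => v -> _; rewrite powR1.
- apply: emeasurable_funM; first exact/measurable_EFinP.
  exact: (measurable_int_hfield p Qbody Q0 sph1 mid).
- move=> th; rewrite mule_ge0 ?lee_fin ?powR_ge0//.
  by apply: integral_ge0 => v _; rewrite lee_fin powR_ge0.
Qed.

Section field.
Context d (T : measurableType d) (mu : {sigma_finite_measure set T -> \bar R}).
Variable g : T -> Rn.
Hypothesis mg : measurable_fun setT g.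
Local Notation hf := (hfield Q g).
Local Notation G th := (Lnorm mu p%:E (EFin \o hf th)).
Local Notation I := (\int[sphm]_(th in S1) ((G th) ^+ k)^-1).
Local Notation a := (Lnorm mu p%:E (fun x => (enorm (g x))%:E)).

Definition field_energy : \bar R := @d_const R n m p Q * (I `^ (k%:R^-1))^-1.

Let mGk : measurable_fun setT (fun th => (G th ^+ k)^-1).
Proof.
have mG := measurable_Lnorm_hfield p Qbody Q0 mu mg.
by apply: measurable_inve_ge0 => [|th]; [exact: measurable_expe|rewrite expe_ge0// Lnorm_ge0].
Qed.

Let Gk_ge0 th : 0 <= (G th ^+ k)^-1.
Proof. by rewrite inve_ge0 expe_ge0// Lnorm_ge0. Qed.

(** For this [t] the integral of [enorm (g x)]^ p[is]t [^ p * s], so by [J_E] the cross term is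
    exactly [q * J] and cancels against the left-hand side. *)
Let young t : (0 < t)%R -> (t * s `^ p^-1)%:E = a -> J <= (t ^+ k)%:E * I.
Proof.
move=> t0 ta.
have [C C0 hC] := support_enorm_le Qbody Q0.
have Gfin th : G th \is a fin_num.
  rewrite ge0_fin_numE ?Lnorm_ge0//.
  apply: le_lt_trans (Lnorm_hfield_le p_ge1 Qbody Q0 mu mg C0 hC th) _.
  by rewrite -ta -EFinM ltry.
pose A th := \int[mu]_x (hf th x `^ p)%:E.
have mA : measurable_fun setT A by exact: measurable_int_hfield.
have A0 th : 0 <= A th by apply: integral_ge0 => x _; rewrite lee_fin powR_ge0.
have AE th : A th = ((fine (G th)) `^ p)%:E.
  by rewrite -poweR_EFin fineK// Lnorm_hfield// -poweRrM mulVf ?gt_eqF// poweRe1// A0.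
have aE : \int[mu]_x (enorm (g x) `^ p)%:E = (t `^ p * s)%:E.
  transitivity (a `^ p).
    rewrite poweR_Lnorm ?gt_eqF//; apply: eq_integral => x _.
    by rewrite abse_EFin ger0_norm ?enorm_ge0// poweR_EFin.
  rewrite -ta poweR_EFin powRM ?powR_ge0 ?(ltW t0)// -powRrM mulVf ?gt_eqF// powRr1//.
  exact: ltW.
pose q := (k%:R / p)%R; have q0 : (0 <= q)%R by rewrite divr_ge0// ltW.
have main : (1 + q)%:E * J <= (t ^+ k)%:E * I + (q * t `^ (- p))%:E * \int[sphm]_th ((W th)%:E * A th).
  rewrite -[X in _ <= _ + _ * X]integral_esphere//; last 2 first.
  - by apply: emeasurable_funM => //; exact/measurable_EFinP.
  - by move=> th; rewrite mule_ge0// lee_fin powR_ge0.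
  have mS := @measurable_esphere R n m.
  have mJ : measurable_fun S1 (fun th => ((N th)^-1 ^+ k)%:E) by exact: measurable_funTS.
  have mWA : measurable_fun S1 (fun th => (W th)%:E * A th).
    by apply: emeasurable_funM; apply: measurable_funTS => //; exact/measurable_EFinP.
  have mI : measurable_fun S1 (fun th => (G th ^+ k)^-1) by exact: measurable_funTS.
  rewrite -!ge0_integralZl//; last first.
  - by rewrite lee_fin addr_ge0.
  - by move=> th _; rewrite lee_fin exprn_ge0// invr_ge0 pgauge_ge0.
  - by rewrite lee_fin exprn_ge0// ltW.
  - by rewrite lee_fin mulr_ge0// powR_ge0.
  - by move=> th _; rewrite mule_ge0// lee_fin powR_ge0.
  have WA0 th : 0 <= (q * t `^ (- p))%:E * ((W th)%:E * A th).
    apply: mule_ge0; first by rewrite lee_fin mulr_ge0 ?powR_ge0.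
    by apply: mule_ge0 => //; rewrite lee_fin powR_ge0.
  have GI0 th : 0 <= (t ^+ k)%:E * (G th ^+ k)^-1.
    by rewrite mule_ge0// lee_fin exprn_ge0// ltW.
  rewrite -ge0_integralD//; last 2 first.
  - exact: emeasurable_funM.
  - exact: emeasurable_funM.
  apply: ge0_le_integral => //.
  - by move=> th _; rewrite mule_ge0// lee_fin ?addr_ge0// exprn_ge0// invr_ge0 pgauge_ge0.
  - exact: emeasurable_funM.
  - by apply: emeasurable_funD; apply: emeasurable_funM.
  move=> th th1; rewrite AE -[X in (X ^+ k)^-1](fineK (Gfin th)).
  (* [young_gauge] needs a positive [G]; where [G] vanishes the right-hand side is +oo. *)
  have [G00|G00] := eqVneq (fine (G th)) 0%R.
    rewrite G00 -EFin_expe expr0n gtn_eqF//= inve0 gt0_muley ?lte_fin ?exprn_gt0//.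
    by rewrite addye ?leey// -EFinM.
  have G0 : (0 < fine (G th))%R by rewrite lt0r G00 fine_ge0// Lnorm_ge0.
  rewrite -EFin_expe inver expf_eq0 (negbTE G00) andbF -!EFinM -EFinD lee_fin.
  exact: young_gauge (N_gt0 th1) G0.
move: main; rewrite integral_weight_hfield// aE.
have -> : (q * t `^ (- p))%:E * ((t `^ p * s)%:E * c e) = q%:E * J.
  rewrite J_E !muleA -!EFinM; congr (_%:E * _).
  rewrite powRN -!mulrA mulKf// gt_eqF// powR_gt0//.
by rewrite EFinD muleDl// mul1e leeD2rE// fin_numM.
Qed.

Lemma field_energy_le : field_energy <= a.
Proof.
have [aoo|] := eqVneq a +oo; first by rewrite aoo leey.
rewrite -ltey -ge0_fin_numE ?Lnorm_ge0// => afin.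
set D := k%:R%:E * leb [set th | (N th <= 1)%R].
have [c0 c00 Hc] := @pgauge_ge R n m p Q n_gt0 m_gt0 p_ge1 Qbody Q0.
have DJ : D <= J.
  by apply: (polar_volume_le k_gt0 mN c00 Hc) => t M t0; exact: pgaugeZ.
have D0 : 0 <= D by rewrite mule_ge0.
have I0 : 0 <= I by apply: integral_ge0.
have I10 : 0 <= I `^ (k%:R^-1) by exact: poweR_ge0.
rewrite /field_energy dE -/D -muleA.
(* Here [t] would be 0. Then [G] vanishes identically, [I] is +oo and the energy is 0. *)
have [a0|a0] := eqVneq (fine a) 0%R.
  have Ioo : I = +oo.
    have {}a0 : a = 0 by rewrite -(fineK afin) a0.
    have [C C0 hC] := support_enorm_le Qbody Q0.
    have G0 th : G th = 0.
      apply/eqP; rewrite eq_le Lnorm_ge0 andbT.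
      apply: le_trans (Lnorm_hfield_le p_ge1 Qbody Q0 mu mg C0 hC th) _.
      by rewrite a0 mule0.
    under eq_integral do rewrite G0 -EFin_expe expr0n gtn_eqF//= inve0.
    rewrite integral_cst//; last exact: measurable_esphere.
    by rewrite gt0_mulye// sphm_gt0.
  by rewrite Ioo poweRyr ?gt_eqF ?invr_gt0// invey !mule0 Lnorm_ge0.
have {}a0 : (0 < fine a)%R by rewrite lt0r a0 fine_ge0// Lnorm_ge0.
pose t := (fine a / s `^ p^-1)%R.
have sp0 : (0 < s `^ p^-1)%R by rewrite powR_gt0.
have t0 : (0 < t)%R by rewrite divr_gt0.
have ta : (t * s `^ p^-1)%:E = a by rewrite mulfVK ?gt_eqF// fineK.
have DI : D `^ (k%:R^-1) <= t%:E * I `^ (k%:R^-1).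
  have -> : t%:E = (t ^+ k)%:E `^ (k%:R^-1).
    by rewrite poweR_EFin -powR_mulrn ?(ltW t0)// -powRrM mulfV ?gt_eqF// powRr1// ltW.
  rewrite -poweRM ?lee_fin ?exprn_ge0 ?(ltW t0)//; apply: le_poweR => //.
  by apply: le_trans DJ _; exact: young.
apply: (@le_trans _ _ ((s `^ p^-1)%:E * t%:E)); last by rewrite -EFinM mulrC ta.
rewrite lee_pmul2l//; apply: le_trans (_ : t%:E * I `^ (k%:R^-1) * (I `^ (k%:R^-1))^-1 <= _).
  by rewrite lee_wpmul2r// inve_ge0.
rewrite -muleA -[leRHS]mule1; apply: lee_wpmul2l; first by rewrite lee_fin ltW.
exact: mule_inve_le1.
Qed.

Lemma field_energy_ge (r K : R) : (0 < r)%R -> (0 < K)%R ->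
  (forall u : 'rV_m, r * enorm u <= h u)%R ->
  (forall u : Rn, (enorm u * K)%:E <= Lnorm mu p%:E (fun x => (dotv (g x) u)%:E)) ->
  @d_const R n m p Q * (K * (r / Num.sqrt m%:R) * (fine (sphm S1) `^ (k%:R^-1))^-1)%:E <= field_energy.
Proof.
move=> r0 K0 hr HK.
have s0 : (0 < Num.sqrt m%:R :> R)%R by rewrite sqrtr_gt0 ltr0n.
set rho := (r / Num.sqrt m%:R)%R; have rho0 : (0 < rho)%R by rewrite divr_gt0.
have rK0 : (0 < K * rho)%R by rewrite mulr_gt0.
have HG th : S1 th -> (K * rho)%:E <= G th.
  move=> th1; have := Lnorm_hfield_ge (mu := mu) m_gt0 p_ge1 Qbody Q0 mg (K := K%:E) r0 hr.
  rewrite lee_fin (ltW K0) => /(_ isT); move=> /(_ _ th).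
  by rewrite th1 mulr1 -EFinM mulrC; apply => u; rewrite -EFinM.
rewrite /field_energy lee_wpmul2l//; first exact/ltW/d_const_gt0.
set S := fine _; have SE : sphm S1 = S%:E.
  by rewrite fineK// fin_num_measure//; exact: measurable_esphere.
have S0 : (0 < S)%R by rewrite -lte_fin -SE.
have I0 : 0 <= I by apply: integral_ge0.
(* [G] is at least [K * rho] on the sphere, so the integrand is at most a constant and [S] is the
   mass of the sphere. *)
have IS : I <= ((K * rho)^-1 ^+ k * S)%:E.
  rewrite EFinM -SE -integral_cst//; last exact: measurable_esphere.
  apply: ge0_le_integral => //.
  - exact: measurable_esphere.
  - exact: measurable_funTS.
  - move=> th th1; have rGk := HG th th1.
    have G0 : 0 <= G th by exact: Lnorm_ge0.
    have H : forall j, ((K * rho) ^+ j)%:E <= G th ^+ j.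
      elim=> [|j IH]; first by rewrite expr0 expe0.
      by rewrite exprS expeS EFinM lee_pmul// lee_fin ?exprn_ge0// ltW.
    have r1 : (0 < (K * rho) ^+ k)%R by rewrite exprn_gt0.
    rewrite exprVn -[leRHS](_ : ((K * rho) ^+ k)%:E^-1 = _); last first.
      by rewrite inver gt_eqF.
    by rewrite lee_pV2 ?inE ?lee_fin ?(ltW r1)// expe_ge0.
have J1 : (K * rho * (S `^ k%:R^-1)^-1)%:E = (((K * rho)^-1 ^+ k * S)%:E `^ k%:R^-1)^-1.
  rewrite poweR_EFin powRM ?exprn_ge0 ?invr_ge0 ?(ltW rK0) ?(ltW S0)//.
  rewrite -powR_mulrn ?invr_ge0 ?(ltW rK0)// -powRrM mulfV ?gt_eqF// powRr1 ?invr_ge0 ?(ltW rK0)//.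
  rewrite inver mulf_eq0 invr_eq0 !gt_eqF ?powR_gt0//=.
  by rewrite invfM invrK.
rewrite J1 lee_pV2 ?inE ?poweR_ge0//.
by apply: le_poweR => //; rewrite invr_ge0 ltW.
Qed.

End field.

End energy_bounds.

(** * Directional derivatives along lines *)

Section directional.
Context {R : realType} {V : normedModType R}.

Lemma is_derive_cvgP (f : V -> R) (x v : V) (l : R) :
  is_derive x v f l <-> h^-1 *: (f (h *: v + x) - f x) @[h --> 0^'] --> l.
Proof.
split=> [[+ <-]|fl]; first by [].
apply: DeriveDef; first by apply/cvg_ex; exists l.
exact: cvg_lim.
Qed.

(** Restriction to a line, where the one-variable chain rule and mean value theorem apply. *)
Lemma is_derive_line (f : V -> R) (a v : V) (t l : R) :
  is_derive t 1 (fun s => f (s *: v + a)) l <-> is_derive (t *: v + a) v f l.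
Proof.
have E : (fun h => h^-1 *: (f (h *: v + (t *: v + a)) - f (t *: v + a))) =
    (fun h => h^-1 *: (f ((h *: 1 + t) *: v + a) - f (t *: v + a))).
  by apply/funext => h; rewrite scalerDl addrA -scalerA scale1r.
split => [H|H].
  apply/is_derive_cvgP; rewrite E.
  have [/= +] := H; rewrite /derivable /derive /= => H1 H2.
  by rewrite -H2.
apply: DeriveDef.
  by apply/cvg_ex; exists l; rewrite /= -E; apply/is_derive_cvgP.
by rewrite /derive /= -E; apply: cvg_lim => //; apply/is_derive_cvgP.
Qed.

End directional.

(** * Test functions *)

Section flat.
Context {R : realType}.

(* The derivative of [flat j] is [- j * flat j.+1 + flat j.+2], so that this family
   is closed under differentiation. *)
Definition flat (j : nat) (y : R) : R :=
  if 0 < y then y^-1 ^+ j * expR (- y^-1) else 0.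

Lemma flat_bound j (y : R) : 0 <= flat j y <= (j.+1)`!%:R * `|y|.
Proof.
rewrite /flat; case: ifPn => [y0|_]; last by rewrite lexx mulr_ge0.
rewrite mulr_ge0 ?exprn_ge0 ?invr_ge0 ?expR_ge0 ?(ltW y0)//=.
have z0 : 0 < y^-1 by rewrite invr_gt0.
have /(le_trans _) := @expR_ge1Dxn R y^-1 j (ltW z0).
move=> /(_ (y^-1 ^+ j.+1 / j.+1`!%:R)); rewrite lerDr => /(_ ler01) H.
rewrite expRN ler_pdivrMr ?expR_gt0// gtr0_norm//.
have f0 : 0 < j.+1`!%:R :> R by rewrite ltr0n fact_gt0.
have yn0 : y != 0 by rewrite gt_eqF.
have -> : y^-1 ^+ j = j.+1`!%:R * y * (y^-1 ^+ j.+1 / j.+1`!%:R).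
  rewrite exprS; set w := _ ^+ j; field.
  by rewrite yn0 gt_eqF.
by rewrite ler_wpM2l// mulr_ge0 ?ltW.
Qed.

Lemma is_derive_flat j (y : R) :
  is_derive y 1 (flat j) (- j%:R * flat j.+1 y + flat j.+2 y).
Proof.
have [y0|y0|->] := ltgtP y 0.
- have -> : - j%:R * flat j.+1 y + flat j.+2 y = 0.
    by rewrite /flat ltNge (ltW y0)/= mulr0 addr0.
  apply: (@near_eq_is_derive _ _ _ (cst 0)).
  near=> t; rewrite /flat ltNge ltW//.
  by near: t; exact: lt_nbhsl.
- pose g (t : R) := t^-1 ^+ j * expR (- t^-1).
  apply: (@near_eq_is_derive _ _ _ g).
    by near=> t; rewrite /flat /g ifT//; near: t; exact: lt_nbhsr.
  have yn0 : y != 0 by rewrite gt_eqF.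
  have dV : is_derive y 1 (fun t : R => t^-1) (- y ^- 2).
    apply: DeriveDef; first by apply: derivableV => //; exact: derivable_id.
    by rewrite deriveV//= derive_id /GRing.scale/= mulr1.
  have dX : is_derive y 1 (fun t : R => t^-1 ^+ j) (- j%:R * y^-1 ^+ j.+1).
    rewrite (_ : (fun t => _) = (fun t : R => t^-1) ^+ j); last first.
      by apply/funext => t; rewrite fctE.
    apply: is_derive_eq; rewrite /GRing.scale/=.
    case: j g {dV} => [|j] g; first by rewrite oppr0 !mul0r.
    by rewrite /= -exprVn !exprS expr0; set x := y^-1; set w := x ^+ j; ring.
  have dE : is_derive y 1 (fun t : R => expR (- t^-1)) (y^-1 ^+ 2 * expR (- y^-1)).
    have dN : is_derive y 1 (fun t : R => - t^-1) (y ^- 2).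
      by apply: is_derive_eq; rewrite opprK.
    have := @is_derive1_comp _ expR (fun t : R => - t^-1) y _ _ (is_derive_expR (- y^-1)) dN.
    by rewrite exprVn mulrC.
  have dM := is_deriveM dX dE.
  rewrite /flat y0; apply: (is_derive_eq dM).
  by rewrite /GRing.scale/= !exprS; set w := _ ^+ j; set u := expR _; ring.
- have -> : - j%:R * flat j.+1 0 + flat j.+2 0 = 0 :> R.
    by rewrite /flat ltxx mulr0 addr0.
  apply/is_derive_cvgP.
  have f0 : flat j 0 = 0 by rewrite /flat ltxx.
  apply/cvgrPdist_le => e e0; near=> h.
  rewrite sub0r normrN addr0 f0 subr0 /GRing.scale/= mulr1 normrM.
  (* The difference quotient at 0 is again a member of the family, and tends to 0 by
     [flat_bound j.+1]. *)
  have -> : `|h^-1| * `|flat j h| = flat j.+1 h.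
    rewrite /flat; case: ifPn => [h0|_]; last by rewrite normr0 mulr0.
    rewrite gtr0_norm ?invr_gt0// ger0_norm ?mulr_ge0 ?exprn_ge0 ?invr_ge0 ?expR_ge0 ?(ltW h0)//.
    by rewrite exprS mulrA.
  have /andP[_ h1] := flat_bound j.+1 h; apply: le_trans h1 _.
  rewrite -ler_pdivlMl ?ltr0n ?fact_gt0//; near: h.
  apply: dnbhs0_le; rewrite mulr_gt0// invr_gt0 ltr0n fact_gt0//.
Unshelve. all: by end_near. Qed.

Lemma flat0_bound (y : R) : 0 <= flat 0 y <= 1.
Proof.
rewrite /flat; case: ifPn => [y0|_]; last by rewrite lexx ler01.
by rewrite expr0 mul1r expR_ge0 -expR0 ler_expR oppr_le0 invr_ge0 ltW.
Qed.

Lemma cvg_flat0 (y : R) : flat 0 (k.+1%:R * y) @[k --> \oo] --> ((0 < y)%R%:R : R).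
Proof.
have [y0|y0] := ltP 0 y; last first.
  rewrite (_ : (fun k => _) = fun=> 0); first exact: cvg_cst.
  by apply/funext => k; rewrite /flat pmulr_rgt0// ltNge y0.
rewrite (_ : (fun k => _) = (fun k => expR (- (k.+1%:R^-1 * y^-1)))); last first.
  by apply/funext => k; rewrite /flat pmulr_rgt0// y0 expr0 mul1r invfM.
rewrite /= -[X in _ --> X](@expR0 R) -oppr0.
have H : (- (k.+1%:R^-1 * y^-1)) @[k --> \oo] --> (- 0 : R).
  apply: cvgN; rewrite -[X in _ --> X](mul0r y^-1); apply: cvgMr_tmp.
  exact: cvg_harmonic.
exact: (cvg_comp _ _ H (@continuous_expR R _)).
Qed.

End flat.

Section Ck_theory.
Context {R : realType} {n : nat}.
Local Notation Rn := 'rV[R]_n.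
Implicit Types (f g phi : Rn -> R).

Local Notation e_ i := (delta_mx ord0 i : Rn).

Lemma continuous_rvD f g : continuous f -> continuous g -> continuous (f \+ g).
Proof. by move=> cf cg x; exact: (@cvgD _ _ _ _ (nbhs_filter x) f g _ _ (cf x) (cg x)). Qed.

Lemma continuous_rvM f g : continuous f -> continuous g -> continuous (f \* g).
Proof. by move=> cf cg x; exact: (@cvgM _ _ _ (nbhs_filter x) f g _ _ (cf x) (cg x)). Qed.

Lemma continuous_rv_translate f (v : Rn) : continuous f -> continuous (fun x => f (v + x)).
Proof.
move=> cf x; apply: (@cvg_comp _ _ _ (fun x => v + x) f _ (nbhs (v + x))).
  apply: (@cvgD _ _ _ _ (nbhs_filter x) (cst v) id); last exact: cvg_id.
  exact: cst_continuous.
exact: cf.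
Qed.

Lemma CkW k f : Ck k.+1 f -> Ck k f.
Proof.
elim: k f => [f []//|k IH f [cf df pf]]; split => // i.
exact/IH/pf.
Qed.

Lemma Ck_continuous k f : Ck k f -> continuous f.
Proof. by case: k => [|k] //= []. Qed.

Lemma Ck_cst k (c : R) : Ck k (cst c : Rn -> R).
Proof.
elim: k c => [|k IH] c /=; first exact: cst_continuous.
split; [exact: cst_continuous|by move=> i x; exact: derivable_cst|].
move=> i; rewrite (_ : partial i _ = cst 0)//.
by apply/funext => x; rewrite /partial derive_cst.
Qed.

Lemma CkD k f g : Ck k f -> Ck k g -> Ck k (f \+ g).
Proof.
elim: k f g => [|k IH] f g; first exact: continuous_rvD.
move=> [cf df pf] [cg dg pg]; split.
- exact: continuous_rvD.
- by move=> i x; apply: derivableD.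
- move=> i; rewrite (_ : partial i _ = partial i f \+ partial i g).
    exact: IH (pf i) (pg i).
  by apply/funext => x; rewrite /partial (deriveD (df i x) (dg i x)).
Qed.

Lemma CkM k f g : Ck k f -> Ck k g -> Ck k (f \* g).
Proof.
elim: k f g => [|k IH] f g; first exact: continuous_rvM.
move=> Cf Cg; have [cf df pf] := Cf; have [cg dg pg] := Cg; split.
- exact: continuous_rvM.
- by move=> i x; apply: derivableM.
- move=> i; rewrite (_ : partial i _ = (f \* partial i g) \+ (g \* partial i f)).
    exact: CkD (IH _ _ (CkW Cf) (pg i)) (IH _ _ (CkW Cg) (pf i)).
  by apply/funext => x; rewrite /partial (deriveM (df i x) (dg i x)).
Qed.

Lemma Ck_prod k (I : Type) (s : seq I) (F : I -> Rn -> R) :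
  (forall i, Ck k (F i)) -> Ck k (fun x => \prod_(i <- s) F i x).
Proof.
move=> CF; elim: s => [|i s IH].
  by under eq_fun do rewrite big_nil; exact: Ck_cst.
under eq_fun do rewrite big_cons.
exact: CkM.
Qed.

Lemma is_derive_translate f (v x u : Rn) (l : R) :
  is_derive (v + x) u f l -> is_derive x u (fun y => f (v + y)) l.
Proof.
move=> /is_derive_cvgP H; apply/is_derive_cvgP.
rewrite (_ : (fun h => _) = (fun h => h^-1 *: (f (h *: u + (v + x)) - f (v + x))))//.
by apply/funext => h; rewrite addrCA.
Qed.

Lemma Ck_translate k f (v : Rn) : Ck k f -> Ck k (fun x => f (v + x)).
Proof.
elim: k f => [|k IH] f; first exact: continuous_rv_translate.
move=> [cf df pf]; split.
- exact: continuous_rv_translate.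
- by move=> i x; have [] := is_derive_translate (derivableP (df i (v + x))).
- move=> i; rewrite (_ : partial i _ = fun x => partial i f (v + x)).
    exact: IH (pf i).
  apply/funext => x.
  by have [_ H] := is_derive_translate (derivableP (df i (v + x))); rewrite /partial; exact: H.
Qed.

Lemma is_derive_flat_coord j (a b : R) (l i : 'I_n) (x : Rn) :
  is_derive x (e_ l) (fun x : Rn => flat j (a * x 0 i + b))
    ((l == i)%:R * a * (- j%:R * flat j.+1 (a * x 0 i + b) + flat j.+2 (a * x 0 i + b))).
Proof.
rewrite -[x]add0r -[X in X + _](scale0r (e_ l)).
apply/is_derive_line.
have E s : a * (s *: e_ l + x) 0 i + b = s * ((l == i)%:R * a) + (a * x 0 i + b).
  by rewrite !mxE eqxx eq_sym/=; ring.
under eq_fun do rewrite E.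
rewrite -/(GRing.scale 0 _) E.
set c := (l == i)%:R * a; set d := a * x 0 i + b.
have dl : is_derive (0 : R) 1 (fun s : R => s * c + d) c.
  rewrite (_ : (fun s => _) = (c \*: (@id R)) \+ cst d); last first.
    by apply/funext => s /=; rewrite /GRing.scale/= mulrC.
  apply: is_derive_eq; by rewrite addr0 /GRing.scale/= mulr1.
have := @is_derive1_comp _ (flat j) (fun s : R => s * c + d) 0 _ _ (is_derive_flat j (0 * c + d)) dl.
by rewrite mulrC.
Qed.

(** The induction on [k] keeps [j] general, because a partial derivative involves [flat j.+1] and
    [flat j.+2]. *)
Lemma Ck_flat_coord k j (a b : R) (i : 'I_n) : Ck k (fun x : Rn => flat j (a * x 0 i + b)).
Proof.
have cont l : continuous (fun x : Rn => flat l (a * x 0 i + b)).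
  move=> x; apply: (@cvg_comp _ _ _ (fun x : Rn => a * x 0 i + b) (flat l) _ (nbhs (a * x 0 i + b))).
    apply: (continuous_rvD (f := cst a \* _) (g := cst b)); last exact: cst_continuous.
    by apply: continuous_rvM; [exact: cst_continuous|exact: coord_continuous].
  apply: differentiable_continuous; apply/derivable1_diffP.
  by have [] := is_derive_flat l (a * x 0 i + b).
elim: k j => [|k IH] j; first exact: cont.
split => //.
  by move=> l x; have [] := is_derive_flat_coord j a b l i x.
move=> l; rewrite (_ : partial l _ = cst ((l == i)%:R * a) \*
    ((cst (- j%:R) \* (fun x : Rn => flat j.+1 (a * x 0 i + b))) \+
    (fun x : Rn => flat j.+2 (a * x 0 i + b)))).
  apply: CkM; first exact: Ck_cst.
  by apply: CkD => //; apply: CkM => //; exact: Ck_cst.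
apply/funext => x; rewrite /partial.
by have [_ H] := is_derive_flat_coord j a b l i x; exact: H.
Qed.

End Ck_theory.

Section C1_directional.
Context {R : realType} {n : nat}.
Local Notation Rn := 'rV[R]_n.

Lemma is_derive_continuous (g dg : R -> R) :
  (forall s : R, is_derive s 1 g (dg s)) -> continuous g.
Proof.
move=> H s; apply: differentiable_continuous; apply/derivable1_diffP.
by have [] := H s.
Qed.

Lemma MVT_from0 (g dg : R -> R) (t : R) : (forall s : R, is_derive s 1 g (dg s)) ->
  exists2 c, `|c| <= `|t| & g t - g 0 = dg c * t.
Proof.
move=> H; have cg := is_derive_continuous H.
have cw A : {within A, continuous g} by exact: continuous_subspaceT.
have [t0|t0] := leP 0 t.
  have [c /itvP ct ->] := MVT_segment t0 (fun x _ => H x) (cw _).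
  by exists c; rewrite ?subr0// !ger0_norm ?ct.
have [c /itvP ct E] := MVT_segment (ltW t0) (fun x _ => H x) (cw _).
exists c; first by rewrite ler0_norm ?ct// ltr0_norm// lerN2 ct.
by rewrite -opprB E sub0r mulrN opprK.
Qed.

(** The increment along [a + b e_j] is the increment along [a] followed by one along [e_j]. The mean
    value theorem turns the latter into the [j]-th partial at a nearby point, which converges by
    continuity at [x]. Iterating over the coordinates gives [Ck1_directional]. *)
Lemma is_derive_add_coord (phi : Rn -> R) (x a : Rn) (b l : R) (j : 'I_n) :
  (forall y, derivable phi y (delta_mx ord0 j)) -> {for x, continuous (partial j phi)} ->
  is_derive x a phi l -> is_derive x (a + b *: delta_mx ord0 j) phi (l + b * partial j phi x).
Proof.
move=> dphi cphi /is_derive_cvgP Hl; apply/is_derive_cvgP.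
set e := delta_mx ord0 j : Rn.
rewrite (_ : (fun h => _) = (fun h => h^-1 *: (phi (h *: a + x) - phi x)) \+
   (fun h => h^-1 *: (phi (h *: (a + b *: e) + x) - phi (h *: a + x)))); last first.
  by apply/funext => h /=; rewrite -scalerDr; congr (_ *: _); ring.
apply: cvgD => //; apply/cvgrPdist_le => eps eps0.
have cdist : \forall y \near x, `|partial j phi x - partial j phi y| <= eps / (`|b| + 1).
  apply: (@cvgr_dist_le _ _ _ (nbhs x) (nbhs_filter x) (partial j phi) (partial j phi x)) => //.
  by rewrite divr_gt0// ltr_wpDl.
have [d /= d0 Hd] := (nbhs_ballP _ _).1 cdist.
near=> h.
have h0 : h != 0 by near: h; exact: nbhs_dnbhs_neq.
have [c cb ->] : exists2 c, `|c| <= `|h * b| &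
    phi (h *: (a + b *: e) + x) - phi (h *: a + x) = partial j phi (c *: e + (h *: a + x)) * (h * b).
  have [s|c cb E] := @MVT_from0 (fun s => phi (s *: e + (h *: a + x)))
     (fun s => partial j phi (s *: e + (h *: a + x))) (h * b).
    by apply/is_derive_line; exact: derivableP.
  exists c => //; rewrite -E scale0r add0r; congr (phi _ - _).
  by rewrite scalerDr scalerA -addrA addrCA.
set y := c *: e + _.
have -> : h^-1 *: (partial j phi y * (h * b)) = b * partial j phi y.
  by rewrite /GRing.scale/=; field.
rewrite -mulrBr normrM; apply: (@le_trans _ _ (`|b| * (eps / (`|b| + 1)))); last first.
  rewrite mulrCA ger_pMr// ler_pdivrMr ?ltr_wpDl// mul1r lerDl//.
rewrite ler_wpM2l//; apply: Hd; rewrite -ball_normE /ball_/=.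
have -> : x - y = - (c *: e + h *: a) by apply/eqP; rewrite subr_eq /y [c *: e + (_ + _)]addrA addKr.
rewrite normrN.
apply: le_lt_trans (ler_normD _ _) _; rewrite !normrZ.
apply: (@le_lt_trans _ _ (`|h| * (`|b| * `|e| + `|a|))).
  by rewrite mulrDr lerD2r mulrA -normrM ler_wpM2r.
set M := _ + _; have M0 : 0 <= M by rewrite addr_ge0 ?mulr_ge0.
apply: (@le_lt_trans _ _ (`|h| * (M + 1))); first by rewrite ler_wpM2l// lerDl.
rewrite -ltr_pdivlMr ?ltr_wpDl//; near: h.
by apply: dnbhs0_lt; rewrite divr_gt0// ltr_wpDl.
Unshelve. all: by end_near. Qed.

Lemma Ck1_directional (phi : Rn -> R) (x v : Rn) : Ck 1 phi ->
  is_derive x v phi (dotv (grad phi x) v).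
Proof.
move=> [cphi dphi pphi].
have H (s : seq 'I_n) : is_derive x (\sum_(i <- s) v 0 i *: delta_mx ord0 i) phi
    (\sum_(i <- s) v 0 i * partial i phi x).
  elim: s => [|i s IH]; first by rewrite !big_nil; exact: is_derive0.
  rewrite !big_cons addrC [X in is_derive _ _ _ X]addrC.
  apply: is_derive_add_coord => //.
  exact: pphi.
have := H (index_enum 'I_n); rewrite -row_sum_delta.
rewrite (_ : \sum_(i <- _) _ * _ = dotv (grad phi x) v)//.
by apply: eq_bigr => i _; rewrite mxE mulrC.
Qed.

End C1_directional.

Section test_functions.
Context {R : realType} {n : nat}.
Local Notation Rn := 'rV[R]_n.
Local Notation leb := (@lebesgue_mx R 1 n).
Implicit Types (f g phi psi : Rn -> R) (Omega : set Rn).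

Lemma mx_box_norm (r : R) (x : Rn) : 0 <= r -> mx_box r x -> `|x| <= r.
Proof.
move=> r0 H; rewrite /Num.Def.normr/= mx_normrE (bigmax_le _ r0)//= => -[i j] _.
Qed.

Lemma norm_mx_box (x : Rn) : mx_box `|x| x.
Proof. by move=> i j; rewrite ord1 normr_mx_coord. Qed.

Lemma mx_boxW (r s : R) (x : Rn) : r <= s -> mx_box r x -> mx_box s x.
Proof. by move=> rs H i j; exact: le_trans (H i j) rs. Qed.

Definition supported (r : R) (phi : Rn -> R) := forall x, phi x != 0 -> mx_box r x.

Lemma closed_norm_le (r : R) : closed [set x : Rn | `|x| <= r].
Proof.
rewrite (_ : [set _ | _] = (fun x : Rn => `|x|) @^-1` [set y | y <= r])//.
apply: preimage_closed; last exact: closed_le.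
by move=> x _; exact: norm_continuous.
Qed.

Lemma test_function_supported phi (r : R) : 0 <= r -> (forall k, Ck k phi) ->
  supported r phi -> test_function setT phi.
Proof.
move=> r0 Cphi sphi; split => //.
apply: bounded_closed_compact; last exact: closed_closure.
have sub : closure [set x | phi x != 0] `<=` [set x : Rn | `|x| <= r].
  rewrite closureE; apply: smallest_sub; first exact: closed_norm_le.
  by move=> x /= /sphi; exact: mx_box_norm.
exists r; split; first exact: num_real.
by move=> M rM x /sub /= xr; exact: le_trans (ltW rM).
Qed.

Lemma test_function_bounded_support Omega phi : test_function Omega phi ->
  exists2 r, 0 < r & supported r phi.
Proof.
move=> [_ cphi _]; have [M [_ HM]] := compact_bounded cphi.
exists (`|M| + 1); first by rewrite ltr_wpDl.
move=> x x0; apply: mx_boxW (norm_mx_box x).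
have : closure [set x | phi x != 0] x by exact: subset_closure.
by apply: HM; rewrite (le_lt_trans (ler_norm M))// ltrDl.
Qed.

Lemma test_functionS Omega phi : test_function Omega phi -> test_function setT phi.
Proof. by move=> [? ? _]; split. Qed.

Lemma test_function_notin Omega phi x : test_function Omega phi -> ~ Omega x -> phi x = 0.
Proof.
move=> [_ _ sub] nx; apply: contrapT => /eqP x0; apply: nx; apply: sub.
exact: subset_closure.
Qed.

Lemma test_function_sub Omega phi psi : test_function Omega phi ->
  (forall k, Ck k psi) -> [set x | psi x != 0] `<=` closure [set x | phi x != 0] ->
  test_function Omega psi.
Proof.
move=> [_ cphi sphi] Cpsi sub.
have cl : closure [set x | psi x != 0] `<=` closure [set x | phi x != 0].
  by rewrite [X in X `<=` _]closureE; apply: smallest_sub => //; exact: closed_closure.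
split => //; last exact: subset_trans cl sphi.
by apply: subclosed_compact cphi cl; exact: closed_closure.
Qed.

Lemma test_function_partial Omega phi i :
  test_function Omega phi -> test_function Omega (partial i phi).
Proof.
move=> tphi; apply: (test_function_sub tphi).
  by move=> k; have [/(_ k.+1)[_ _ +] _ _] := tphi; apply.
move=> x /= dx; apply: contrapT => nx.
have op : open (~` closure [set x | phi x != 0]) by rewrite openC; exact: closed_closure.
have nphi : \forall y \near x, cst 0 y = phi y.
  have := open_nbhs_nbhs (conj op nx); apply: filterS => y ny /=.
  by apply/esym; apply: contrapT => /eqP y0; apply: ny; exact: subset_closure.
by move: dx; rewrite /partial -(near_eq_derive _ nphi) derive_cst eqxx.
Qed.

Lemma test_functionM Omega phi psi : test_function Omega phi ->
  (forall k, Ck k psi) -> test_function Omega (phi \* psi).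
Proof.
move=> tphi Cpsi; apply: (test_function_sub tphi).
  by move=> k; apply: CkM => //; have [] := tphi.
by move=> x /= x0; apply: subset_closure => /=; move: x0; apply: contra => /eqP ->; rewrite mul0r.
Qed.

Lemma test_function_continuous Omega phi : test_function Omega phi -> continuous phi.
Proof. by move=> [/(_ 0%N)]. Qed.

Lemma test_function_measurable Omega phi : test_function Omega phi -> measurable_fun setT phi.
Proof. by move=> /test_function_continuous; exact: continuous_measurable_mx. Qed.

Lemma test_function_bounded Omega phi : test_function Omega phi ->
  exists2 C, 0 < C & forall x, `|phi x| <= C.
Proof.
move=> tphi; have [_ cphi _] := tphi.
have cont := test_function_continuous tphi.
have : compact (phi @` closure [set x | phi x != 0]).
  by apply: continuous_compact cphi; exact: continuous_subspaceT.
move=> /compact_bounded[M [_ HM]]; exists (`|M| + 1); first by rewrite ltr_wpDl.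
move=> x; have [->|x0] := eqVneq (phi x) 0; first by rewrite normr0 addr_ge0.
apply: HM => /=; first by rewrite (le_lt_trans (ler_norm M))// ltrDl.
by exists x => //; exact: subset_closure.
Qed.

Lemma test_function_translate phi (v : Rn) : test_function setT phi ->
  test_function setT (fun x => phi (v + x)).
Proof.
move=> tphi; have [r r0 sphi] := test_function_bounded_support tphi.
apply: (@test_function_supported _ (r + `|v|)); first by rewrite addr_ge0// ltW.
  by move=> k; apply: Ck_translate; have [] := tphi.
move=> x /sphi bx i j; have -> : x i j = (v + x) i j - v i j by rewrite mxE addrC addKr.
apply: le_trans (ler_normB _ _) _; rewrite lerD//.
by rewrite ord1 normr_mx_coord.
Qed.

Lemma lebesgue_box_lty (r : R) : (leb (mx_box r) < +oo)%E.
Proof.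
apply: (@le_lt_trans _ _ (leb (mx_box `|r|))); last by rewrite lebesgue_mx_box// ltry.
apply: le_measure; rewrite ?inE; try exact: measurable_mx_box.
by move=> x; apply: mx_boxW; exact: ler_norm.
Qed.

Lemma integrable_bounded_supported f (r C : R) : measurable_fun setT f ->
  (forall x, `|f x| <= C) -> supported r f -> leb.-integrable setT (EFin \o f).
Proof.
move=> mf fC sf.
have C0 : 0 <= C by exact: le_trans (fC 0).
apply: (@le_integrable _ _ _ _ _ _ _ (EFin \o (cst C \* \1_(mx_box r)))) => //.
- exact/measurable_EFinP.
- move=> x _ /=; rewrite lee_fin [leRHS]ger0_norm; last by rewrite mulr_ge0.
  have [->|x0] := eqVneq (f x) 0; first by rewrite normr0 mulr_ge0.
  by rewrite indicE mem_set ?mulr1//; exact: sf.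
- have H : leb.-integrable setT (EFin \o (\1_(mx_box r) : Rn -> R)).
    apply/integrableP; split.
      by apply/measurable_EFinP; apply: measurable_indic; exact: measurable_mx_box.
    under eq_integral do rewrite /= ger0_norm//.
    rewrite integral_indic// ?setIT; first exact: lebesgue_box_lty.
    exact: measurable_mx_box.
  exact: (integrableZl measurableT C H).
Qed.

Lemma test_function_integrable Omega phi : test_function Omega phi ->
  leb.-integrable setT (EFin \o phi).
Proof.
move=> tphi; have [C _ HC] := test_function_bounded tphi.
have [r _ sphi] := test_function_bounded_support tphi.
exact: integrable_bounded_supported (test_function_measurable tphi) HC sphi.
Qed.

Lemma integrable_bounded_mul d (T : measurableType d) (mu : {measure set T -> \bar R})
    (f g : T -> R) (C : R) : mu.-integrable setT (EFin \o f) ->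
  measurable_fun setT g -> (forall x, `|g x| <= C) ->
  mu.-integrable setT (EFin \o (f \* g)).
Proof.
move=> intf mg gC; have [/measurable_EFinP mf _] := integrableP _ _ _ intf.
apply: (@le_integrable _ _ _ _ _ _ _ (EFin \o (cst `|C| \* f))) => //.
- by apply/measurable_EFinP; exact: measurable_funM.
- move=> x _ /=; rewrite lee_fin !normrM normr_id mulrC ler_wpM2r//.
  by apply: le_trans (gC x) _; exact: ler_norm.
- exact: (integrableZl measurableT `|C| intf).
Qed.

End test_functions.

(** * Density of test functions *)

Section density.
Context {R : realType} {n : nat}.
Local Notation Rn := 'rV[R]_n.
Local Notation leb := (@lebesgue_mx R 1 n).
Implicit Types (f g phi psi : Rn -> R).

Definition open_box (r : R) : set Rn := [set x | forall i, `|x 0 i| < r].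

(** Smooth cut-offs for the open box, one factor for each face: each vanishes beyond its face and
    tends to 1 before it as [k] grows. *)
Definition box_bump (r : R) (k : nat) (x : Rn) : R :=
  \prod_i (flat 0 (k.+1%:R * x 0 i + k.+1%:R * r) *
           flat 0 (- k.+1%:R * x 0 i + k.+1%:R * r)).

Lemma box_bump_in01 r k x : 0 <= box_bump r k x <= 1.
Proof.
have H i : 0 <= flat 0 (k.+1%:R * x 0 i + k.+1%:R * r) *
           flat 0 (- k.+1%:R * x 0 i + k.+1%:R * r) <= 1.
  have /andP[a0 a1] := flat0_bound (k.+1%:R * x 0 i + k.+1%:R * r).
  have /andP[b0 b1] := flat0_bound (- k.+1%:R * x 0 i + k.+1%:R * r).
  by rewrite mulr_ge0//= mulr_ile1.
by rewrite prodr_ge0 ?prodr_ile1// => i _; have /andP[] := H i.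
Qed.

Lemma Ck_box_bump k r j : Ck k (box_bump r j).
Proof. by apply: Ck_prod => i; apply: CkM; exact: Ck_flat_coord. Qed.

Lemma box_bump_out r k x : ~ open_box r x -> box_bump r k x = 0.
Proof.
move=> /existsNP[i /negP]; rewrite -leNgt => rx.
rewrite /box_bump (bigD1 i)//= [X in X * _](_ : _ = 0) ?mul0r//.
have k0 : 0 < k.+1%:R :> R by [].
have [x0|x0] := leP 0 (x 0 i).
  rewrite [X in _ * X](_ : _ = 0) ?mulr0//.
  rewrite /flat ltNge mulNr addrC subr_le0 ler_pM2l//.
  by move: rx; rewrite ger0_norm// => ->.
rewrite [X in X * _](_ : _ = 0) ?mul0r//.
rewrite /flat ltNge -mulrDr pmulr_rle0//.
by move: rx; rewrite ltr0_norm// => rx; rewrite ifF//; apply/negbTE; rewrite negbK; lra.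
Qed.

Lemma cvg_prod (I : Type) (s : seq I) (F : I -> nat -> R) (l : I -> R) :
  (forall i, F i k @[k --> \oo] --> l i) ->
  \prod_(i <- s) F i k @[k --> \oo] --> \prod_(i <- s) l i.
Proof.
move=> Fl; elim: s => [|i s IH].
  by rewrite big_nil; under eq_fun do rewrite big_nil; exact: cvg_cst.
by rewrite big_cons; under eq_fun do rewrite big_cons; exact: cvgM.
Qed.

Lemma cvg_box_bump r x : open_box r x -> box_bump r k x @[k --> \oo] --> (1 : R).
Proof.
move=> rx; rewrite [X in _ --> X](_ : _ = \prod_(i < n) (1 * 1)); last first.
  by rewrite big1// => i _; rewrite mulr1.
apply: cvg_prod => i; have := rx i; rewrite ltr_norml => /andP[h1 h2].
apply: cvgM.
  have := @cvg_flat0 R (x 0 i + r); rewrite (_ : 0 < _); last by lra.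
  by under eq_fun do rewrite mulrDr.
have := @cvg_flat0 R (- x 0 i + r); rewrite (_ : 0 < _); last by lra.
by under eq_fun do rewrite mulrDr mulrN -mulNr.
Qed.

Lemma open_box_sub r : open_box r `<=` mx_box r.
Proof. by move=> x H i j; rewrite ord1; exact: ltW. Qed.

Lemma measurable_open_box r : measurable (open_box r).
Proof.
rewrite (_ : open_box r = \bigcap_(i in [set: 'I_n]) ((fun x : Rn => x 0 i) @^-1` `](- r), r[%classic)).
  apply: fin_bigcap_measurable; first exact: finite_finset.
  move=> i _; rewrite -[X in measurable X]setTI.
  by apply: measurable_mx_coord => //.
apply/seteqP; split => x /=.
  by move=> H i _ /=; rewrite in_itv/= -ltr_norml.
by move=> H i; have := H i I; rewrite /= in_itv/= -ltr_norml.
Qed.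

Section approximation.
Variables (w : Rn -> R) (r : R).
Hypotheses (r0 : 0 <= r) (intw : leb.-integrable (open_box r) (EFin \o w)).
Local Notation U := (open_box r).

Let mU : measurable U := measurable_open_box r.

(** Values in [0, 1] are preserved by 1 - f and f (1 - g) + g, which imitate complement and
    union. *)
Definition admissible psi := [/\ test_function setT psi,
  forall x, ~ U x -> psi x = 0 & forall x, 0 <= psi x <= 1].

(* The approximable sets form a sigma-algebra, which contains the open rays. *)
Definition approximable (A : set Rn) := forall e : R, 0 < e ->
  exists2 psi, admissible psi &
    (\int[leb]_(x in U) (`|w x| * `|psi x - \1_A x|)%:E <= e%:E)%E.

Lemma admissible_bump k phi : (forall k, Ck k phi) -> (forall x, 0 <= phi x <= 1) ->
  admissible (box_bump r k \* phi).
Proof.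
move=> Cphi phi01; split.
- apply: (@test_function_supported _ _ _ r) => //.
    by move=> j; apply: CkM => //; exact: Ck_box_bump.
  move=> x; have [/open_box_sub//|nx] := pselect (U x).
  by rewrite /= box_bump_out// mul0r eqxx.
- by move=> x nx; rewrite /= box_bump_out// mul0r.
- move=> x; have /andP[a0 a1] := box_bump_in01 r k x; have /andP[b0 b1] := phi01 x.
  by rewrite /= mulr_ge0//= mulr_ile1.
Qed.

Let mw : measurable_fun U w.
Proof. by have [/measurable_EFinP] := integrableP _ _ _ intw. Qed.

Lemma cvg0_approx (g : nat -> Rn -> R) : (forall k, measurable_fun U (g k)) ->
  (forall k x, `|g k x| <= 1) -> (forall x, U x -> g k x @[k --> \oo] --> (0 : R)) ->
  forall e : R, 0 < e -> exists k, (\int[leb]_(x in U) (`|w x| * `|g k x|)%:E <= e%:E)%E.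
Proof.
move=> mg g1 g0 e e0.
have H : (\int[leb]_(x in U) (`|w x| * `|g k x|)%:E)%E @[k --> \oo] --> (\int[leb]_(x in U) 0%E)%E.
  apply: (@dominated_cvg _ _ _ _ _ mU _ _ (fun x => (`|w x|)%:E)) => //.
  - move=> k; apply/measurable_EFinP; apply: measurable_funM.
      exact: measurableT_comp.
    exact: measurableT_comp.
  - move=> x Ux; apply: cvg_EFin; first exact: nearW.
    rewrite -[X in _ --> X](mulr0 `|w x|) -[X in _ * X](@normr0 _ R).
    by apply: cvgMl_tmp; apply: cvg_norm; exact: g0.
  - exact: (integrable_abse intw).
  - move=> k x Ux; rewrite abse_EFin lee_fin ger0_norm ?mulr_ge0//.
    by rewrite ler_piMr.
rewrite integral0 in H.
have : \forall k \near \oo, (\int[leb]_(x in U) (`|w x| * `|g k x|)%:E < e%:E)%E.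
  move: H => /fine_cvgP[Hfin /cvgr0Pnorm_lt/(_ e e0) He].
  near=> k; rewrite -[ltLHS]fineK; last by near: k.
  by rewrite lte_fin; apply: le_lt_trans (ler_norm _) _; near: k.
move=> [k _ Hk]; exists k; apply/ltW/Hk; exact: leqnn.
Unshelve. all: by end_near. Qed.

Lemma indicC01 (A : set Rn) x : 0 <= (\1_A x : R) <= 1.
Proof. by rewrite indicE; case: (_ \in _); rewrite ?lexx ?ler01. Qed.

Lemma normr_sub01 (a b : R) : 0 <= a <= 1 -> 0 <= b <= 1 -> `|a - b| <= 1.
Proof. by move=> /andP[? ?] /andP[? ?]; rewrite ler_norml; apply/andP; split; lra. Qed.

Lemma normr_subr1 (a : R) : 0 <= a <= 1 -> `|a - 1| = 1 - a.
Proof. by move=> /andP[_ a1]; rewrite ler0_norm ?opprB// subr_le0. Qed.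

Lemma test_function_box psi : (forall k, Ck k psi) -> (forall x, ~ U x -> psi x = 0) ->
  test_function setT psi.
Proof.
move=> Cpsi psiU; apply: (@test_function_supported _ _ _ r) => // x.
have [/open_box_sub//|nx] := pselect (U x).
by rewrite psiU// eqxx.
Qed.

Let measurable_error (B : set Rn) f : measurable B -> measurable_fun U f ->
  measurable_fun U (fun x => (`|w x| * `|f x - \1_B x|)%:E).
Proof.
move=> mB mf; apply/measurable_EFinP; apply: measurable_funM.
  exact: measurableT_comp.
apply: measurableT_comp => //; apply: measurable_funB; first exact: mf.
by apply: measurable_funTS; exact: measurable_indic.
Qed.

Lemma admissible_measurable psi : admissible psi -> measurable_fun U psi.
Proof. by move=> [/test_function_measurable mpsi _ _]; exact: measurable_funTS. Qed.

Lemma approx_le psi psi1 psi2 (a b : R) (A A1 A2 : set Rn) :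
  measurable A1 -> measurable A2 -> measurable A ->
  measurable_fun U psi -> measurable_fun U psi1 -> measurable_fun U psi2 ->
  (forall x, U x -> `|psi x - \1_A x| <= `|psi1 x - \1_A1 x| + `|psi2 x - \1_A2 x|) ->
  (\int[leb]_(x in U) (`|w x| * `|psi1 x - \1_A1 x|)%:E <= a%:E)%E ->
  (\int[leb]_(x in U) (`|w x| * `|psi2 x - \1_A2 x|)%:E <= b%:E)%E ->
  (\int[leb]_(x in U) (`|w x| * `|psi x - \1_A x|)%:E <= (a + b)%:E)%E.
Proof.
move=> mA1 mA2 mA mpsi mpsi1 mpsi2 H Ha Hb.
rewrite EFinD; apply: le_trans (leeD Ha Hb).
rewrite -ge0_integralD//; last 2 first.
- exact: measurable_error.
- exact: measurable_error.
apply: ge0_le_integral => //.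
- exact: measurable_error.
- by apply: emeasurable_funD; exact: measurable_error.
- by move=> x Ux; rewrite -EFinD lee_fin -mulrDr ler_wpM2l// H.
Qed.

Lemma measurable_ray (i : 'I_n) (c : R) : measurable [set x : Rn | c < x 0 i].
Proof.
rewrite (_ : [set _ | _] = (fun x : Rn => x 0 i) @^-1` `]c, +oo[%classic).
  by rewrite -[X in measurable X]setTI; apply: measurable_mx_coord.
by apply/seteqP; split => x /=; rewrite in_itv/= andbT.
Qed.

Lemma approximable_ray (i : 'I_n) (c : R) : approximable [set x : Rn | c < x 0 i].
Proof.
move=> e e0.
pose phi k (x : Rn) := flat 0 (k.+1%:R * x 0 i + - k.+1%:R * c).
have mA := measurable_ray i c.
have adm k : admissible (box_bump r k \* phi k).
  apply: admissible_bump => [j|x]; first exact: Ck_flat_coord.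
  exact: flat0_bound.
pose g k x := (box_bump r k \* phi k) x - \1_[set x : Rn | c < x 0 i] x.
have mg k : measurable_fun U (g k).
  apply: measurable_funB; first exact: admissible_measurable.
  by apply: measurable_funTS; exact: measurable_indic.
have g1 k x : `|g k x| <= 1.
  by apply: normr_sub01; [have [_ _] := adm k|exact: indicC01].
have g0 x : U x -> g k x @[k --> \oo] --> (0 : R).
  move=> Ux; rewrite -[X in _ --> X](subrr (1 * \1_[set x : Rn | c < x 0 i] x)).
  rewrite [X in _ --> _ - X]mul1r.
  apply: cvgB; last exact: cvg_cst.
  apply: cvgM; first exact: cvg_box_bump.
  have := @cvg_flat0 R (x 0 i - c); rewrite subr_gt0 indicE.
  rewrite (_ : (x \in _) = (c < x 0 i)); last by apply/idP/idP; rewrite inE.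
  by under eq_fun do rewrite mulrBr -mulNr.
have [k Hk] := cvg0_approx mg g1 g0 e0.
by exists (box_bump r k \* phi k).
Qed.

(** 1 - psi does not vanish outside the box, so it is multiplied by a bump; half of the error pays
    for the bump, as an approximation of [setT]. *)
Lemma approximableC (A : set Rn) : measurable A -> approximable A -> approximable (~` A).
Proof.
move=> mA aA e e0; have e20 : 0 < e / 2 by rewrite divr_gt0.
have [psi [tpsi psiU psi01] Hpsi] := aA _ e20.
have admk k : admissible (box_bump r k \* (cst 1 \+ (cst (-1) \* psi))).
  apply: admissible_bump => [j|x].
    apply: CkD; first exact: Ck_cst.
    by apply: CkM; [exact: Ck_cst|have [] := tpsi].
  by have /andP[? ?] := psi01 x; rewrite /=; apply/andP; split; lra.
pose g k x := box_bump r k x - \1_(@setT Rn) x.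
have mbump k : measurable_fun U (box_bump r k).
  by apply: measurable_funTS; apply: continuous_measurable_mx; exact: (Ck_continuous (Ck_box_bump 0 r k)).
have mg k : measurable_fun U (g k).
  apply: measurable_funB; first exact: mbump.
  by apply: measurable_funTS; exact: measurable_indic.
have g1 k x : `|g k x| <= 1.
  by apply: normr_sub01; [exact: box_bump_in01|exact: indicC01].
have g0 x : U x -> g k x @[k --> \oo] --> (0 : R).
  move=> Ux; rewrite -[X in _ --> X](subrr 1) /g indicE in_setT.
  by apply: cvgB; [exact: cvg_box_bump|exact: cvg_cst].
have [k Hk] := cvg0_approx mg g1 g0 e20.
exists (box_bump r k \* (cst 1 \+ (cst (-1) \* psi))) => //.
rewrite (splitr e); apply: (@approx_le _ (box_bump r k) psi _ _ _ setT A measurableT mA (measurableC mA)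
  _ _ _ _ Hk Hpsi) => //.
- exact: admissible_measurable.
- exact: measurable_funTS (test_function_measurable tpsi).
- move=> x Ux; rewrite /= !indicE in_setT in_setC mulN1r.
  have := box_bump_in01 r k x; set b := box_bump r k x => /andP[b0 b1].
  have := psi01 x; set q := psi x => /andP[q0 q1].
  have bE : `|b - 1| = 1 - b by rewrite normr_subr1 ?b0.
  have qE : `|q - 1| = 1 - q by rewrite normr_subr1 ?q0.
  by case: (x \in A) => /=; rewrite ?subr0 ?bE ?qE ?(@ger0_norm _ q)// ler_norml; apply/andP; split; nra.
Qed.

(** f (1 - g) + g equals the indicator of the union when [f] and [g] are indicators, and changes by
    at most the sum of the changes in [f] and [g]. *)
Lemma approximableU (A B : set Rn) : measurable A -> measurable B ->
  approximable A -> approximable B -> approximable (A `|` B).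
Proof.
move=> mA mB aA aB e e0; have e20 : 0 < e / 2 by rewrite divr_gt0.
have [f [tf fU f01] Hf] := aA _ e20; have [g [tg gU g01] Hg] := aB _ e20.
have tfg : test_function setT (f \* (cst 1 \+ (cst (-1) \* g))).
  apply: test_functionM => // k; apply: CkD; first exact: Ck_cst.
  by apply: CkM; [exact: Ck_cst|have [] := tg].
pose psi := (f \* (cst 1 \+ (cst (-1) \* g))) \+ g.
have psi01 x : 0 <= psi x <= 1.
  have /andP[? ?] := f01 x; have /andP[? ?] := g01 x.
  by rewrite /psi /= mulN1r; apply/andP; split; nra.
have psiU x : ~ U x -> psi x = 0 by move=> nx; rewrite /psi /= fU// gU// mul0r addr0.
have Cpsi k : Ck k psi by apply: CkD; [have [] := tfg|have [] := tg].
have tpsi := test_function_box Cpsi psiU.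
exists psi => //.
have mf := test_function_measurable tf; have mg := test_function_measurable tg.
have mpsi := test_function_measurable tpsi.
rewrite (splitr e); apply: (approx_le mA mB (measurableU _ _ mA mB) _ _ _ _ Hf Hg).
- exact: measurable_funTS.
- exact: measurable_funTS.
- exact: measurable_funTS.
- move=> x Ux; rewrite /psi /= !indicE in_setU mulN1r.
  have /andP[? ?] := f01 x; have /andP[? ?] := g01 x.
  have f1 := normr_subr1 (f01 x).
  have g1 := normr_subr1 (g01 x).
  case: (x \in A); case: (x \in B) => /=; rewrite ?subr0 ?f1 ?g1
    ?(@ger0_norm _ (f x))// ?(@ger0_norm _ (g x))// ler_norml; apply/andP; split; nra.
Qed.

Lemma approximable0 : approximable set0.
Proof.
move=> e e0; exists (box_bump r 0 \* cst 0).
  apply: admissible_bump => [k|x]; first exact: Ck_cst.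
  by rewrite lexx ler01.
rewrite integral0_eq ?lee_fin ?ltW// => x _.
by rewrite /= mulr0 indicE in_set0 subr0 normr0 mulr0.
Qed.

Lemma approximable_bigcup (A : nat -> set Rn) : (forall k, measurable (A k)) ->
  (forall k, approximable (A k)) -> approximable (\bigcup_k A k).
Proof.
move=> mA aA e e0; have e20 : 0 < e / 2 by rewrite divr_gt0.
pose B k := \big[setU/set0]_(j < k) A j.
have mB k : measurable (B k) by exact: bigsetU_measurable.
have aB k : approximable (B k).
  rewrite /B; elim: k => [|k IH]; first by rewrite big_ord0; exact: approximable0.
  rewrite big_ord_recr/=; apply: approximableU => //.
  by exact: bigsetU_measurable.
have mUA := bigcupT_measurable _ mA.
pose g k x : R := \1_(B k) x - \1_(\bigcup_k A k) x.
have mg k : measurable_fun U (g k).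
  by apply: measurable_funB; apply: measurable_funTS; exact: measurable_indic.
have g1 k x : `|g k x| <= 1 by apply: normr_sub01; exact: indicC01.
have g0 x : U x -> g k x @[k --> \oo] --> (0 : R).
  move=> Ux; rewrite /g; have [UA|nA] := pselect ((\bigcup_k A k) x).
    have [k _ Ak] := UA.
    apply: cvg_near_cst; near=> j; rewrite !indicE (mem_set UA) mem_set ?subrr//.
    rewrite /B -bigcup_mkord; exists k => //=; near: j; exact: nbhs_infty_gt.
  apply: cvg_near_cst; near=> j; rewrite !indicE !memNset ?subrr//.
  by rewrite /B -bigcup_mkord => -[k _ Ak]; apply: nA; exists k.
have [k Hk] := cvg0_approx mg g1 g0 e20.
have [psi apsi Hpsi] := aB k _ e20.
exists psi => //; rewrite (splitr e).
apply: (@approx_le psi psi (\1_(B k)) _ _ _ (B k) (\bigcup_k A k) (mB k) mUA mUA _ _ _ _ Hpsi Hk).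
- exact: admissible_measurable.
- exact: admissible_measurable.
- by apply: measurable_funTS; exact: measurable_indic.
- by move=> x Ux; rewrite -[X in `|X| <= _](subrKA (\1_(B k) x)) ler_normD.
Unshelve. all: by end_near. Qed.

Lemma measurable_approximable (A : set Rn) : measurable A -> approximable A.
Proof.
(* Measurability is carried along since the closure properties assume it. *)
suff H : forall B : set Rn, <<s @mx_cylinders _ R 1 n >> B -> measurable B /\ approximable B.
  by move=> mA; have [] := H A mA.
apply: smallest_sub.
  split; first by split=> //; exact: approximable0.
    by move=> B [mB aB]; rewrite setTD; split; [exact: measurableC|exact: approximableC].
  move=> B HB; split; first by apply: bigcupT_measurable => k; have [] := HB k.
  by apply: approximable_bigcup => k; have [] := HB k.
move=> _ [i [j [B mB ->]]]; split.
  by rewrite -[X in measurable X]setTI; exact: (@measurable_mx_coord _ R 1 n i j).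
(* A second induction, over the Borel sets of the line, handles a cylinder; its generators are the
   open rays. *)
suff H : forall B : set R, <<s @RGenOInfty.G R >> B ->
    measurable [set M : Rn | B (M i j)] /\ approximable [set M : Rn | B (M i j)].
  have mB' : <<s @ocitv R >> B := mB.
  have E : <<s @ocitv R >> = <<s @RGenOInfty.G R >> := RGenOInfty.measurableE R.
  by rewrite E in mB'; have [] := H B mB'.
apply: smallest_sub.
  split.
  - by rewrite (_ : [set M : Rn | set0 (M i j)] = set0)//; split=> //; exact: approximable0.
  - move=> C [mC aC].
    rewrite (_ : [set M : Rn | ([set: R] `\` C) (M i j)] = ~` [set M : Rn | C (M i j)]).
      by split; [exact: measurableC|exact: approximableC].
    by apply/seteqP; split => M /= => [[]|].
  move=> C HC; split.
    rewrite (_ : [set _ | _] = \bigcup_k [set M : Rn | C k (M i j)])//.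
    by apply: bigcupT_measurable => k; have [] := HC k.
  rewrite (_ : [set _ | _] = \bigcup_k [set M : Rn | C k (M i j)])//.
  by apply: approximable_bigcup => k; have [] := HC k.
move=> _ [c ->]; rewrite !ord1.
have -> : [set M : Rn | `]c, +oo[%classic (M 0 j)] = [set x : Rn | c < x 0 j].
  by apply/seteqP; split => x /=; rewrite in_itv/= andbT.
by split; [exact: measurable_ray|exact: approximable_ray].
Qed.

(** L^1 duality: if [f] and [g] approximate the indicators of {w > 0} and {w < 0}, then f - g is a
    test function approximating the sign of [w] in the weight |w|. *)
Lemma integral_norm_le_test (C : R) :
  (forall psi, test_function setT psi -> (forall x, ~ U x -> psi x = 0) ->
     (forall x, `|psi x| <= 1) -> (\int[leb]_(x in U) (w x * psi x)%:E <= C%:E)%E) ->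
  (\int[leb]_(x in U) (`|w x|)%:E <= C%:E)%E.
Proof.
move=> HC; apply/lee_addgt0Pr => e e0; have e20 : 0 < e / 2 by rewrite divr_gt0.
pose A := U `&` [set x | 0 < w x]; pose B := U `&` [set x | w x < 0].
have mA : measurable A.
  rewrite (_ : A = U `&` w @^-1` `]0, +oo[%classic); first exact: mw.
  by apply/seteqP; split => x /=; rewrite in_itv/= andbT.
have mB : measurable B.
  rewrite (_ : B = U `&` w @^-1` `]-oo, 0[%classic); first exact: mw.
  by apply/seteqP; split => x /=; rewrite in_itv/=.
have [f [tf fU f01] Hf] := measurable_approximable mA e20.
have [g [tg gU g01] Hg] := measurable_approximable mB e20.
pose psi := f \+ (cst (-1) \* g).
have psiU x : ~ U x -> psi x = 0 by move=> nx; rewrite /psi /= fU// gU// mulr0 addr0.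
have psi1 x : `|psi x| <= 1 by rewrite /psi /= mulN1r; exact: normr_sub01.
have tpsi : test_function setT psi.
  apply: test_function_box => // k.
  by apply: CkD; [have [] := tf|apply: CkM; [exact: Ck_cst|have [] := tg]].
have mpsi := test_function_measurable tpsi.
have iwpsi : leb.-integrable U (EFin \o (w \* psi)).
  apply: le_integrable intw => //.
    by apply/measurable_EFinP; apply: measurable_funM => //; exact: measurable_funTS.
  by move=> x Ux; rewrite lee_fin normrM ler_piMr.
have m1 (D : set Rn) h : measurable D -> test_function setT h ->
    measurable_fun U (fun x => (`|w x| * `|h x - \1_D x|)%:E).
  by move=> mD /test_function_measurable mh; apply: measurable_error => //; exact: measurable_funTS.
(* An equality for each sign of [w x]: the two errors make up exactly for psi falling short of the
   sign. *)
have key x : U x -> `|w x| <= w x * psi x + (`|w x| * `|f x - \1_A x| + `|w x| * `|g x - \1_B x|).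
  move=> Ux; rewrite /psi /= mulN1r !indicE.
  have /andP[? ?] := f01 x; have /andP[? ?] := g01 x.
  have f1 := normr_subr1 (f01 x).
  have g1 := normr_subr1 (g01 x).
  have [w0|w0|w0] := ltgtP (w x) 0.
  - rewrite (_ : (x \in A) = false); last by apply: memNset => -[_ /=]; rewrite ltNge ltW.
    rewrite (_ : (x \in B) = true); last by apply: mem_set; split.
    rewrite subr0 g1 ltr0_norm// ger0_norm//; nra.
  - rewrite (_ : (x \in B) = false); last by apply: memNset => -[_ /=]; rewrite ltNge ltW.
    rewrite (_ : (x \in A) = true); last by apply: mem_set; split.
    rewrite subr0 f1 gtr0_norm// ger0_norm//; nra.
  - by rewrite w0 normr0 !mul0r !addr0.
have i2 : leb.-integrable U (fun x => (`|w x| * `|f x - \1_A x| + `|w x| * `|g x - \1_B x|)%:E).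
  apply: (le_integrable mU (g := fun x => (2 * `|w x|)%:E)).
  - under eq_fun do rewrite EFinD.
    by apply: emeasurable_funD; exact: m1.
  - move=> x Ux; rewrite lee_fin [leLHS]ger0_norm ?addr_ge0 ?mulr_ge0// [leRHS]ger0_norm ?mulr_ge0//.
    have h1 : `|f x - \1_A x| <= 1 by apply: normr_sub01 => //; exact: indicC01.
    have h2 : `|g x - \1_B x| <= 1 by apply: normr_sub01 => //; exact: indicC01.
    by have := normr_ge0 (w x); nra.
  - exact: (integrableZl mU 2 (integrable_abse intw)).
apply: (@le_trans _ _ (\int[leb]_(x in U) ((w x * psi x)%:E +
  (`|w x| * `|f x - \1_A x| + `|w x| * `|g x - \1_B x|)%:E)))%E.
  apply: le_integral => //.
  - exact: (integrable_abse intw).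
  - exact: integrableD.
  - by move=> x /set_mem Ux; rewrite -EFinD lee_fin key.
rewrite integralD//; apply: leeD; first exact: HC.
under eq_integral do rewrite EFinD.
rewrite ge0_integralD//; [|exact: m1|exact: m1].
by rewrite [in leRHS](splitr e) EFinD leeD.
Qed.

End approximation.

End density.

(** * Directional derivatives and translations *)

Section translation.
Context {R : realType} {n : nat}.
Local Notation Rn := 'rV[R]_n.
Local Notation leb := (@lebesgue_mx R 1 n).

Let mtr (v : Rn) : measurable_fun [set: Rn] (fun x : Rn => v + x).
Proof. by apply: measurable_mxD => //; exact: measurable_cst. Qed.

Lemma ge0_integral_translate (f : Rn -> \bar R) (v : Rn) : measurable_fun setT f ->
  (forall x, 0 <= f x)%E -> (\int[leb]_x f (v + x)%R = \int[leb]_x f x)%E.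
Proof.
move=> mf f0; rewrite -[LHS](@ge0_integral_pushforward _ _ _ _ _ _ (mtr v) leb setT f)//.
by apply: eq_measure_integral => A mA _; exact: lebesgue_mx_translation.
Qed.

Lemma integral_translate (f : Rn -> R) (v : Rn) : measurable_fun setT f ->
  (\int[leb]_x (f (v + x)%R)%:E = \int[leb]_x (f x)%:E)%E.
Proof.
move=> mf; rewrite integralE [RHS]integralE.
have mfp : measurable_fun setT (fun x => (f x)%:E) by exact/measurable_EFinP.
congr (_ - _)%E.
  apply: etrans (ge0_integral_translate v (measurable_funepos mfp) _).
    by apply: eq_integral => x _; rewrite !funeposE.
  by move=> x; rewrite funepos_ge0.
apply: etrans (ge0_integral_translate v (measurable_funeneg mfp) _).
  by apply: eq_integral => x _; rewrite !funenegE.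
by move=> x; rewrite funeneg_ge0.
Qed.

Lemma Lnorm_translate (f : Rn -> R) (v : Rn) (p : R) : 0 < p -> measurable_fun setT f ->
  Lnorm leb p%:E (fun x => (f (v + x))%:E) = Lnorm leb p%:E (EFin \o f).
Proof.
move=> p0 mf; rewrite !LnormE; congr (_ `^ _)%E.
rewrite -(@ge0_integral_translate (fun x => `|(f x)%:E| `^ p)%E v)//.
  by apply: measurable_poweR_abse; exact/measurable_EFinP.
by move=> x; exact: poweR_ge0.
Qed.

Section pairing.
Variables (B : set Rn) (w psi : Rn -> R) (v : Rn).
Hypotheses (mB : measurable B) (intw : leb.-integrable B (EFin \o w)).
Hypothesis tpsi : test_function setT psi.

Let dpsi (x : Rn) : R := dotv (grad psi x) v.

Lemma measurable_dir : measurable_fun setT dpsi.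
Proof.
apply: measurable_sum => i; apply: measurable_funM => //.
under eq_fun do rewrite mxE.
exact: test_function_measurable (test_function_partial i tpsi).
Qed.

Lemma bounded_dir : exists2 C, 0 < C & forall x, `|dpsi x| <= C.
Proof.
have H i : exists C, 0 < C /\ forall x, `|partial i psi x| <= C.
  by have [C C0 HC] := test_function_bounded (test_function_partial i tpsi); exists C.
have [C HC] := choice H; exists (\sum_i C i * `|v 0 i| + 1).
  rewrite ltr_wpDl// sumr_ge0// => i _; have [Ci _] := HC i.
  by rewrite mulr_ge0// ltW.
move=> x; apply: ler_wpDr => //; apply: le_trans (ler_norm_sum _ _ _) _.
by apply: ler_sum => i _; rewrite normrM mxE ler_wpM2r//; have [_] := HC i; apply.
Qed.

Let f (s : R) (x : Rn) : R := w x * psi (s *: v + x).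

Let mw : measurable_fun B w.
Proof. by have [/measurable_EFinP] := integrableP _ _ _ intw. Qed.

Let mpsis s : measurable_fun setT (fun x => psi (s *: v + x)).
Proof. exact: measurableT_comp (test_function_measurable tpsi) (mtr _). Qed.

Let intf s : leb.-integrable B (EFin \o f s).
Proof.
have [C C0 HC] := test_function_bounded tpsi.
apply: (le_integrable mB (g := fun x => (C * `|w x|)%:E)).
- apply/measurable_EFinP; apply: measurable_funM => //.
  by apply: measurable_funTS; exact: mpsis.
- move=> x Bx; rewrite lee_fin /f normrM [leRHS]ger0_norm ?mulr_ge0 ?(ltW C0)//.
  by rewrite mulrC ler_wpM2r.
- exact: (integrableZl mB C (integrable_abse intw)).
Qed.

Let derf (s : R) x : is_derive s 1 (f ^~ x) (w x * dpsi (s *: v + x)).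
Proof.
have H : is_derive s 1 (fun t => psi (t *: v + x)) (dpsi (s *: v + x)).
  by apply/is_derive_line; apply: Ck1_directional; have [] := tpsi.
have := is_deriveZ (w x) H.
by [].
Qed.

(** Differentiation under the integral falls on [psi] alone, with [C * |w|] as dominating function.
    Thus [w] may be the constant 1, a power of a test function, or a BV function. *)
Lemma pairing_MVT (T : R) : 0 <= T -> exists2 c, 0 <= c <= T &
  (\int[leb]_(x in B) (w x * psi (T *: v + x)) - \int[leb]_(x in B) (w x * psi x) =
   T * \int[leb]_(x in B) (w x * dpsi (c *: v + x)))%R.
Proof.
move=> T0; have [C C0 HC] := bounded_dir.
pose F s := \int[leb]_(x in B) f s x.
have dF (s : R) : is_derive s 1 F (\int[leb]_(x in B) (w x * dpsi (s *: v + x))).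
  have Is : `](s - 1), (s + 1)[%classic s by rewrite /= in_itv/= ltrDl ltrBlDr ltrDl ltr01.
  pose G x := C * `|w x|.
  have G0 x : 0 <= G x by rewrite mulr_ge0// ltW.
  have intG : leb.-integrable B (EFin \o G).
    exact: (integrableZl mB C (integrable_abse intw)).
  have pf t x : partial1of2 f t x = w x * dpsi (t *: v + x).
    by rewrite partial1of2E; have [_] := derf t x.
  have GH t x : `](s - 1), (s + 1)[%classic t -> B x -> `|partial1of2 f t x| <= G x.
    by move=> _ _; rewrite pf normrM /G mulrC ler_wpM2r.
  have d1 t x : `](s - 1), (s + 1)[%classic t -> B x -> derivable (f ^~ x) t 1.
    by move=> _ _; have [] := derf t x.
  have i1 t : `](s - 1), (s + 1)[%classic t -> leb.-integrable B (EFin \o f t) by [].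
  apply: DeriveDef.
    exact: (derivable_under_integral mB Is i1 d1 G0 intG GH).
  rewrite -derive1E (differentiation_under_integral mB Is i1 d1 G0 intG GH).
  by apply: eq_Rintegral => x _; rewrite pf.
have cF := is_derive_continuous dF.
have [c /itvP cT E] := MVT_segment T0 (fun x _ => dF x) (continuous_subspaceT cF).
exists c; first by rewrite !cT.
rewrite subr0 mulrC in E; rewrite -E /F; congr (_ - _).
by apply: eq_Rintegral => x _; rewrite /f scale0r add0r.
Qed.

End pairing.

End translation.

(** * The Poincare inequality for test functions *)

Section smooth_poincare.
Context {R : realType} {n : nat}.
Local Notation Rn := 'rV[R]_n.
Local Notation leb := (@lebesgue_mx R 1 n).
Implicit Types (phi psi : Rn -> R).

Lemma integral_vanish_out (B : set Rn) (f : Rn -> R) : (forall x, ~ B x -> f x = 0) ->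
  (\int[leb]_(x in B) (f x)%:E = \int[leb]_x (f x)%:E)%E.
Proof.
move=> fB; rewrite integral_mkcond; apply: eq_integral => x _; rewrite patchE.
by case: ifPn => // /negP xB; rewrite fB// => Bx; apply: xB; exact: mem_set.
Qed.

Lemma Rintegral_vanish_out (B : set Rn) (f : Rn -> R) : (forall x, ~ B x -> f x = 0) ->
  \int[leb]_(x in B) f x = \int[leb]_x f x.
Proof. by move=> fB; rewrite /Rintegral integral_vanish_out. Qed.

Lemma Rintegral_translate (f : Rn -> R) (v : Rn) : measurable_fun setT f ->
  \int[leb]_x f (v + x) = \int[leb]_x f x.
Proof. by move=> mf; rewrite /Rintegral integral_translate. Qed.

(** [pairing_MVT] with [w = 1], along the unit vector [e] with [T = 1]: translation invariance makes
    the left-hand difference 0 and removes the shift by [c] on the right. *)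
Lemma integral_partial phi i : test_function setT phi ->
  (\int[leb]_x (partial i phi x)%:E = 0)%E.
Proof.
move=> tphi; have tp := test_function_partial i tphi.
have [r r0 sphi] := test_function_bounded_support tphi.
have [r' r'0 sp] := test_function_bounded_support tp.
pose e := delta_mx ord0 i : Rn.
(* Large enough for the box to contain the supports of [phi] and of its partial derivative after any
   shift by [c e] with [c] in [0, 1]. *)
pose rho := r + r' + `|e|.
have out (f : Rn -> R) s c x : s <= r + r' -> supported s f -> 0 <= c <= 1 ->
    ~ mx_box rho x -> f (c *: e + x) = 0.
  move=> sr sf /andP[c0 c1] nx; apply: contrapT => /eqP /sf bx; apply: nx => a b.
  have -> : x a b = (c *: e + x) a b - (c *: e) a b by rewrite mxE; ring.
  apply: le_trans (ler_normB _ _) _; rewrite /rho lerD//; first exact: le_trans (bx a b) sr.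
  rewrite ord1 mxE normrM ger0_norm//; apply: le_trans (ler_wpM2r _ c1) _ => //.
  by rewrite mul1r normr_mx_coord.
have mB := @measurable_mx_box R 1 n rho.
have int1 : leb.-integrable (mx_box rho) (EFin \o cst (1 : R)).
  apply/integrableP; split; first by apply/measurable_EFinP; exact: measurable_cst.
  under eq_integral do rewrite /= normr1.
  by rewrite integral_cst// mul1e; exact: lebesgue_box_lty.
have [c /andP[c0 c1] E] := pairing_MVT e mB int1 tphi ler01.
have s1 : r <= r + r' by rewrite lerDl ltW.
have s2 : r' <= r + r' by rewrite lerDr ltW.
have EP (f : Rn -> R) s t : s <= r + r' -> supported s f -> measurable_fun setT f ->
    0 <= t <= 1 -> \int[leb]_(x in mx_box rho) (cst 1 x * f (t *: e + x)) = \int[leb]_x f x.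
  move=> sr sf mf t01; rewrite -(Rintegral_translate (t *: e) mf) -(Rintegral_vanish_out (B := mx_box rho)).
    by apply: eq_Rintegral => x _; rewrite mul1r.
  by move=> x; exact: out sr sf t01.
have mphi := test_function_measurable tphi.
have z01 : 0 <= (0 : R) <= 1 by rewrite lexx ler01.
have o01 : 0 <= (1 : R) <= 1 by rewrite lexx ler01.
have E0 : \int[leb]_(x in mx_box rho) (cst 1 x * phi x) = \int[leb]_x phi x.
  rewrite -(EP phi r 0 s1 sphi mphi z01); apply: eq_Rintegral => x _.
  by rewrite scale0r add0r.
have E2 : \int[leb]_(x in mx_box rho) (cst 1 x * dotv (grad phi (c *: e + x)) e) =
    \int[leb]_x partial i phi x.
  rewrite -(EP (partial i phi) r' c s2 sp (test_function_measurable tp)) ?c0//.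
  by apply: eq_Rintegral => x _; rewrite dotv_delta mxE.
move: E; rewrite (EP phi r 1 s1 sphi mphi o01) E0 E2 subrr mul1r /Rintegral => /esym H.
rewrite -[LHS]fineK ?H//.
exact: integrable_fin_num (test_function_integrable tp).
Qed.

Lemma integration_by_parts_test phi psi i : test_function setT phi -> test_function setT psi ->
  (\int[leb]_x (phi x * partial i psi x)%:E = - \int[leb]_x (partial i phi x * psi x)%:E)%E.
Proof.
move=> tphi tpsi.
have tM : test_function setT (phi \* psi) by apply: test_functionM => //; have [] := tpsi.
have t1 : test_function setT (phi \* partial i psi).
  by apply: test_functionM => //; have [] := test_function_partial i tpsi.
have t2 : test_function setT (partial i phi \* psi).
  by apply: test_functionM; [exact: test_function_partial|have [] := tpsi].
have := integral_partial i tM.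
have -> : partial i (phi \* psi) = (phi \* partial i psi) \+ (partial i phi \* psi).
  apply/funext => x; have [/(_ 1%N)[_ d1 _] _ _] := tphi; have [/(_ 1%N)[_ d2 _] _ _] := tpsi.
  rewrite /partial (deriveM (d1 i x) (d2 i x)) /= /GRing.scale/=.
  by rewrite [in RHS](mulrC _ (psi x)).
under eq_integral do rewrite EFinD.
have i1 := test_function_integrable t1; have i2 := test_function_integrable t2.
rewrite integralD//.
have f2 := integrable_fin_num measurableT i2.
by move=> H; rewrite -[LHS](addeK _ f2) H sub0e.
Qed.

(* [pairing_MVT] applied to [w = sg phi * |phi| ^ (p - 1)] and [psi = phi]: as
   [w] and the translate of [phi] have disjoint supports, the left-hand side
   reduces to [- int |phi| ^ p]. *)
Lemma smooth_poincare (Omega : set Rn) phi (v : Rn) (T p : R) : 0 < T -> 1 < p ->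
  test_function Omega phi -> (forall x, Omega x -> ~ Omega (T *: v + x)) ->
  (Lnorm leb p%:E (EFin \o phi) <=
   T%:E * Lnorm leb p%:E (fun x => (dotv (grad phi x) v)%:E))%E.
Proof.
move=> T0 p1 tphiO shift; have tphi := test_functionS tphiO.
have p0 : 0 < p by rewrite (lt_trans _ p1).
have pn0 : p != 0 by rewrite gt_eqF.
have mphi := test_function_measurable tphi.
pose w x := phi x * `|phi x| `^ (p - 2).
have mw : measurable_fun setT w.
  apply: measurable_funM => //; apply: (measurableT_comp (measurable_powR _)).
  exact: measurableT_comp.
have wphi x : w x * phi x = `|phi x| `^ p.
  rewrite /w; have [->|x0] := eqVneq (phi x) 0; first by rewrite normr0 !mulr0 powR0.
  rewrite mulrAC -expr2 -real_normK ?num_real// -powR_mulrn// -powRD ?normr_eq0 ?x0 ?implybT//.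
  by congr (_ `^ _); ring.
have wE x : `|w x| = `|phi x| `^ (p - 1).
  rewrite /w normrM; have [->|x0] := eqVneq (phi x) 0.
    by rewrite normr0 mul0r powR0// subr_eq0 gt_eqF.
  rewrite (@ger0_norm _ (_ `^ _)) ?powR_ge0//.
  rewrite -[X in X * _]powRr1// -powRD ?normr_eq0 ?x0 ?implybT//.
  by congr (_ `^ _); ring.
have [C C0 HC] := test_function_bounded tphi.
have [r r0 sphi] := test_function_bounded_support tphi.
have intw : leb.-integrable setT (EFin \o w).
  apply: (@integrable_bounded_supported _ _ w r (C `^ (p - 1))) => //.
    by move=> x; rewrite wE ge0_ler_powR ?nnegrE ?(ltW C0)// subr_ge0 ltW.
  by move=> x; rewrite /w => H; apply: sphi; move: H; apply: contra => /eqP ->; rewrite mul0r.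
have [c cT E] := pairing_MVT v measurableT intw tphi (ltW T0).
pose d x := dotv (grad phi (c *: v + x)) v.
have md : measurable_fun setT d.
  have mtr : measurable_fun setT (fun x : Rn => c *: v + x).
    by apply: measurable_mxD => //; exact: measurable_cst.
  exact: measurableT_comp (measurable_dir v tphi) mtr.
have [D D0 HD] := bounded_dir v tphi.
have intwd : leb.-integrable setT (EFin \o (w \* d)).
  by apply: (integrable_bounded_mul intw md (C := D)) => x; exact: HD.
set a := Lnorm leb p%:E (EFin \o phi).
set b := Lnorm leb p%:E _.
have aE : (\int[leb]_x (`|phi x| `^ p)%:E = a `^ p)%E.
  by rewrite poweR_Lnorm.
have ifin : leb.-integrable setT (EFin \o (fun x => `|phi x| `^ p)).
  apply: (@integrable_bounded_supported _ _ _ r (C `^ p)) => //.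
  - by apply: (measurableT_comp (measurable_powR _)); exact: measurableT_comp.
  - by move=> x; rewrite ger0_norm ?powR_ge0// ge0_ler_powR ?nnegrE ?(ltW C0)// ltW.
  - by move=> x H; apply: sphi; move: H; apply: contra => /eqP ->; rewrite normr0 powR0.
have apfin : (a `^ p)%E \is a fin_num.
  by rewrite -aE; exact: (integrable_fin_num measurableT ifin).
have a0 : (0 <= a)%E by exact: Lnorm_ge0.
have afin : a \is a fin_num.
  rewrite ge0_fin_numE// ltNge leye_eq; apply/eqP => aoo.
  by move: apfin; rewrite aoo poweRyr.
have E' : fine (a `^ p)%E = - (T * \int[leb]_x (w x * d x)).
  rewrite -E opprB (_ : \int[leb]_x (w x * phi (T *: v + x)) = 0) ?subr0.
    rewrite /Rintegral; congr fine; rewrite -aE; apply: eq_integral => x _.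
    by rewrite wphi.
  rewrite -[RHS](_ : \int[leb]_x (0 : R) = 0); last by rewrite /Rintegral integral0.
  apply: eq_Rintegral => x _.
  have [Ox|nOx] := pselect (Omega x).
    by rewrite (test_function_notin tphiO (shift x Ox)) mulr0.
  by rewrite /w (test_function_notin tphiO nOx) !mul0r.
have hold : ((fine (a `^ p))%:E <= T%:E * ((a `^ (p - 1)) * b))%E.
  rewrite E' -mulrN EFinM lee_wpmul2l ?lee_fin ?(ltW T0)//.
  apply: (@le_trans _ _ (\int[leb]_x `|(w x * d x)%:E|)%E).
    apply: (@le_trans _ _ (`|\int[leb]_x (w x * d x)|)%:E).
      by rewrite lee_fin -normrN ler_norm.
    rewrite /Rintegral -abse_EFin fineK; last exact: (integrable_fin_num measurableT intwd).
    apply: le_abse_integral => //.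
    by have [] := integrableP _ _ _ intwd.
  (* The exponent conjugate to [p], for which the [q]-th power of |w| is |phi|^p. *)
  pose q := p / (p - 1).
  have pm0 : 0 < p - 1 by rewrite subr_gt0.
  have q0 : 0 < q by rewrite divr_gt0.
  have qp : q^-1 + p^-1 = 1 by rewrite /q invf_div; field.
  have := hoelder leb mw md q0 p0 qp.
  rewrite Lnorm1 => /le_trans; apply.
  have -> : Lnorm leb p%:E (EFin \o d) = b.
    apply: (Lnorm_translate (f := fun x => dotv (grad phi x) v) (c *: v) p0).
    exact: measurable_dir.
  rewrite lee_wpmul2r ?Lnorm_ge0// LnormE.
  have -> : p - 1 = p * q^-1 by rewrite /q invf_div mulrC mulfVK.
  rewrite poweRrM -aE.
  rewrite (_ : (\int[leb]_x `|(EFin \o w) x| `^ q = \int[leb]_x (`|phi x| `^ p)%:E)%E)//.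
  apply: eq_integral => x _ /=; rewrite wE -powRrM; congr (_ `^ _)%:E.
  by rewrite /q mulrCA divff ?mulr1// gt_eqF.
(* [hold] says a^p <= T a^(p-1) b, to be divided by a^(p-1). *)
have [a00|a00] := eqVneq (fine a) 0.
  by rewrite -(fineK afin) a00 mule_ge0 ?lee_fin ?(ltW T0) ?Lnorm_ge0.
have af0 : 0 < fine a by rewrite lt0r a00 fine_ge0.
have b0 : (0 <= b)%E by exact: Lnorm_ge0.
move: hold; rewrite -(fineK afin).
case: b b0 => [b b0||//]; last first.
  by move=> _ _; rewrite gt0_muley ?leey ?lte_fin.
rewrite !poweR_EFin /= -!EFinM !lee_fin.
have -> : fine a `^ p = fine a `^ (p - 1) * fine a.
  by rewrite -[X in _ = _ * X]powRr1 ?(ltW af0)// -powRD ?a00 ?implybT// subrK.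
by rewrite mulrCA ler_pM2l// powR_gt0.
Qed.

End smooth_poincare.

(** * Functions of bounded variation *)

Section charge_density.
Context d (T : measurableType d) {R : realType}.
Local Open Scope ereal_scope.

Lemma ae_le0_integral (mu : {measure set T -> \bar R}) (h : T -> \bar R) :
  mu.-integrable setT h ->
  (forall A, measurable A -> \int[mu]_(x in A) h x <= 0) ->
  {ae mu, forall x, h x <= 0}.
Proof.
move=> ih hle; have mh := measurable_int _ ih.
have mA : measurable [set x | 0 < h x].
  by rewrite -[X in measurable X]setTI; exact: emeasurable_fun_o_infty.
have h0 : ae_eq mu [set x | 0 < h x] (cst 0) h.
  apply: integral_ae_eq => //.
  - exact: integrable0.
  - exact: measurable_funTS.
  - move=> E EA mE; rewrite integral0; apply/eqP; rewrite eq_le hle// andbT.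
    by rewrite integral_ge0// => x /EA/ltW.
apply: filterS h0 => x /= hx0; rewrite leNgt; apply/negP => hx.
by move: (hx); rewrite -(hx0 hx) ltxx.
Qed.

(** By uniqueness of densities, the densities of the two Jordan parts differ almost everywhere by
    that of [nu], so the chosen Hahn decomposition leaves no trace. *)
Lemma charge_integralE (nu : {charge set T -> \bar R})
    (mu : {sigma_finite_measure set T -> \bar R}) (psi : T -> R) (M : R) :
  nu `<< mu -> measurable_fun setT psi -> (forall x, `|psi x| <= M)%R ->
  charge_integral nu psi = \int[mu]_x ((psi x)%:E * Radon_Nikodym nu mu x).
Proof.
move=> numu mpsi bpsi; rewrite /charge_integral.
cbv zeta; move: (svalP (cid (svalP (cid (Hahn_decomposition nu))))) => nuPN.
have pmu := jordan_pos_dominates nuPN numu.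
have nmu := jordan_neg_dominates nuPN numu.
have bd : [bounded psi x | x in setT].
  by exists M; split => [|y My x _]; [exact: num_real | exact: le_trans (bpsi x) (ltW My)].
have ifin (la : {finite_measure set T -> \bar R}) : la.-integrable setT (EFin \o psi).
  apply: measurable_bounded_integrable => //.
  by rewrite -ge0_fin_numE// fin_num_measure.
rewrite -(Radon_Nikodym_change_of_variables pmu)//
  -(Radon_Nikodym_change_of_variables nmu)//.
set gp := Radon_Nikodym _ _; set gn := Radon_Nikodym (charge_of_finite_measure (jordan_neg nuPN)) _.
have igp : mu.-integrable setT gp by exact: Radon_Nikodym_integrable.
have ign : mu.-integrable setT gn by exact: Radon_Nikodym_integrable.
rewrite -integralB//; [|exact: (integrableMr _ mpsi bd igp)|exact: (integrableMr _ mpsi bd ign)].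
apply: ae_eq_integral => //.
- apply: emeasurable_funB; apply: emeasurable_funM; try exact/measurable_EFinP.
  + exact: measurable_int igp.
  + exact: measurable_int ign.
- by apply: emeasurable_funM; [exact/measurable_EFinP | exact: measurable_int (Radon_Nikodym_integrable numu)].
have e : ae_eq mu setT (Radon_Nikodym nu mu) (gp \- gn).
  apply: integral_ae_eq => //.
  - exact: Radon_Nikodym_integrable.
  - by apply: emeasurable_funB; [exact: measurable_int igp | exact: measurable_int ign].
  - move=> A _ mA; rewrite -Radon_Nikodym_integral// integralB//; last 2 first.
    + exact: integrableS igp.
    + exact: integrableS ign.
    rewrite -!Radon_Nikodym_integral// (jordan_decomp nuPN mA)/=.
    by rewrite /cadd; congr (_ + _); exact: mulN1e.
apply: filterS e => x /= /(_ I) -> _.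
rewrite muleBr// fin_num_adde_defr//.
exact: Radon_Nikodym_fin_num.
Qed.
End charge_density.

Lemma enormD {R : realType} k (u v : 'rV[R]_k) : enorm (u + v) <= enorm u + enorm v.
Proof.
rewrite -(ler_pXn2r (n := 2)) ?nnegrE ?addr_ge0 ?enorm_ge0//.
rewrite enorm_rv_sqr dotvDl !dotvDr -!enorm_rv_sqr (dotvC v u).
have := dotv_le_enorm u v; nra.
Qed.

Section vec_density.
Context d (T : measurableType d) {R : realType} (k : nat).
Variable D : 'I_k -> {charge set T -> \bar R}.
Local Open Scope ereal_scope.
Let mu : {finite_measure set T -> \bar R} := vec_variation D.

Definition vec_density (x : T) : 'rV[R]_k :=
  \row_i fine (Radon_Nikodym (D i) mu x).

Lemma charge_dominated_variation i : D i `<< mu.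
Proof.
apply/null_content_dominatesP => A mA muA0.
have e0 : (enorm (charge_vec D A) = 0)%R.
  apply/eqP; rewrite eq_le sqrtr_ge0 andbT -lee_fin.
  by apply: le_trans (le_vec_variation D mA) _; rewrite -[leRHS]muA0.
have /rowP/(_ i) := enorm_eq0 e0.
rewrite !mxE => f0; rewrite -[LHS]fineK ?f0//.
exact: fin_num_measure.
Qed.

Lemma vec_densityE i x : (vec_density x 0 i)%:E = Radon_Nikodym (D i) mu x.
Proof.
by rewrite mxE fineK// Radon_Nikodym_fin_num//; exact: charge_dominated_variation.
Qed.

Lemma integrable_vec_density i :
  mu.-integrable setT (fun x => (vec_density x 0 i)%:E).
Proof.
under eq_fun do rewrite vec_densityE.
exact: Radon_Nikodym_integrable (charge_dominated_variation i).
Qed.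

Lemma measurable_vec_density : measurable_fun setT vec_density.
Proof.
apply: measurable_fun_mx => a i; rewrite ord1.
by apply/measurable_EFinP; exact: measurable_int (integrable_vec_density i).
Qed.

Lemma integral_vec_density i A : measurable A ->
  \int[mu]_(x in A) (vec_density x 0 i)%:E = D i A.
Proof.
move=> mA; under eq_integral do rewrite vec_densityE.
by rewrite -Radon_Nikodym_integral//; exact: charge_dominated_variation.
Qed.

Lemma integrable_dotv_density u : mu.-integrable setT (fun x => (dotv (vec_density x) u)%:E).
Proof.
rewrite (_ : (fun _ => _) =
  (fun x => \sum_(i <- index_enum 'I_k) ((u 0 i)%:E * (vec_density x 0 i)%:E))).
  apply: integrable_sum => //= i _.
  by apply: integrableZl => //; exact: integrable_vec_density.
apply/funext => x; rewrite /dotv -sumEFin; apply: eq_bigr => i _.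
by rewrite mulrC EFinM.
Qed.

Lemma integral_dotv_density u A : measurable A ->
  \int[mu]_(x in A) (dotv (vec_density x) u)%:E = (dotv (charge_vec D A) u)%:E.
Proof.
move=> mA.
rewrite (eq_integral
  (fun x => \sum_(i <- index_enum 'I_k) ((u 0 i)%:E * (vec_density x 0 i)%:E))); last first.
  move=> x _; rewrite /dotv -sumEFin; apply: eq_bigr => i _.
  by rewrite mulrC EFinM.
have iA i : mu.-integrable A (fun x => (vec_density x 0 i)%:E).
  by apply: integrableS (integrable_vec_density i).
rewrite integral_sum//; last by move=> i; apply: integrableZl.
rewrite /dotv -sumEFin; apply: eq_bigr => i _.
rewrite integralZl// integral_vec_density// mxE EFinM fineK ?fin_num_measure//.
by rewrite muleC.
Qed.

(** Over a set [A] the left side integrates to <D(A), u>, which is at most |u| times the variation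
    of [A]. The exceptional null set depends on [u]. *)
Lemma dotv_density_le u : {ae mu, forall x, (dotv (vec_density x) u <= enorm u)%R}.
Proof.
have ic : mu.-integrable setT (cst (enorm u)%:E) by exact: finite_measure_integrable_cst.
have id := integrable_dotv_density u.
have h A : measurable A ->
    \int[mu]_(x in A) ((dotv (vec_density x) u)%:E - cst (enorm u)%:E x) <= 0.
  move=> mA; rewrite integralB//; [|exact: integrableS id|exact: integrableS ic].
  rewrite integral_dotv_density// integral_cst//.
  rewrite sube_le0; apply: le_trans (_ : (enorm u * enorm (charge_vec D A))%:E <= _).
    by rewrite lee_fin mulrC dotv_le_enorm.
  rewrite EFinM lee_wpmul2l//; first by rewrite lee_fin sqrtr_ge0.
  exact: le_vec_variation.
have := @ae_le0_integral _ _ _ mu _ (integrableB measurableT id ic) h.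
by apply: filterS => x /=; rewrite -EFinB lee_fin subr_le0.
Qed.

(* Testing the previous bound on the integer vector [floor (N y)], for every N. *)
Lemma enorm_density_le1 : {ae mu, forall x, (enorm (vec_density x) <= 1)%R}.
Proof.
pose P j x := if unpickle j is Some z
  then (dotv (vec_density x) (map_mx intr (z : 'rV[int]_k)) <= enorm (map_mx intr z : 'rV[R]_k))%R
  else true.
have /ae_foralln : forall j, {ae mu, forall x, P j x}.
  move=> j; rewrite /P; case: unpickle => [z|]; last exact: aeW.
  exact: dotv_density_le.
apply: filterS => x Px; set y := vec_density x.
have {}Px (z : 'rV[int]_k) : (dotv y (map_mx intr z) <= enorm (map_mx intr z : 'rV[R]_k))%R.
  by have := Px (pickle z); rewrite /P pickleK.
rewrite leNgt; apply/negP => y1.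
pose e := enorm y; have e0 : (0 < e)%R by exact: lt_trans y1.
(* Rounding moves N y by at most [k], so the test on the rounded vector yields N e^2 - e k <= N e +
   k; this fails for such an [N]. *)
have [N N1] : exists N : nat, (k%:R * (1 + e) / (e * (e - 1)) < N%:R)%R.
  set q := (_ / _)%R; exists (Num.bound q); apply: archi_boundP.
  have e1 : (0 <= e - 1)%R by rewrite subr_ge0 ltW.
  by rewrite divr_ge0// mulr_ge0// ?addr_ge0// ltW.
pose z : 'rV[int]_k := (\row_i Num.floor (N%:R * y 0 i))%R.
pose w := (N%:R *: y - map_mx intr z)%R.
have we : (enorm w <= k%:R)%R.
  apply: le_trans (enorm_le_sum w) _.
  rewrite -[leRHS]mul1r mulr_natr -[X in (1 *+ X)%R]card_ord -sumr_const.
  apply: ler_sum => i _; rewrite !mxE ger0_norm ?subr_ge0 ?floor_le//.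
  by rewrite lerBlDr addrC -intrD1 ltW// floorD1_gt.
have zE : map_mx intr z = (N%:R *: y - w)%R by rewrite /w opprB addrC subrK.
have := Px z; rewrite zE dotvBr dotvZr -enorm_rv_sqr -/e => h1.
have h2 : (dotv y w <= e * k%:R)%R.
  by apply: le_trans (dotv_le_enorm _ _) _; rewrite ler_wpM2l// sqrtr_ge0.
have h3 : (enorm (N%:R *: y - w) <= N%:R * e + k%:R)%R.
  apply: le_trans (enormD _ _) _; rewrite enormZ ger0_norm// -/e lerD2l.
  by rewrite -scaleN1r enormZ normrN1 mul1r.
move: N1; rewrite ltr_pdivrMr ?mulr_gt0 ?subr_gt0//.
nra.
Qed.

End vec_density.

Section bv_poincare.
Context {R : realType} {n : nat}.
Local Notation Rn := 'rV[R]_n.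
Local Notation leb := (@lebesgue_mx R 1 n).
Implicit Types (f psi : Rn -> R) (v : Rn).

Lemma partial_translate psi v i x : test_function setT psi ->
  partial i (fun y => psi (v + y)) x = partial i psi (v + x).
Proof.
move=> [/(_ 1%N)[_ d _] _ _].
by have [_ H] := is_derive_translate (derivableP (d i (v + x))); rewrite /partial; exact: H.
Qed.

Lemma grad_translate psi v x : test_function setT psi ->
  grad (fun y => psi (v + y)) x = grad psi (v + x).
Proof. by move=> tpsi; apply/rowP => i; rewrite !mxE partial_translate. Qed.

Lemma bvDP f : BV f -> distr_derivative f (bvD f).
Proof.
by move=> [_ ex]; rewrite /bvD; case: pselect => // H; exact: svalP.
Qed.

Lemma bv_integral_grad f psi v : BV f -> test_function setT psi ->
  (\int[leb]_x (f x * dotv (grad psi x) v)%:E =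
   - \int[bv_variation f]_x (psi x * dotv (bv_eta f x) v)%:E)%E.
Proof.
move=> bvf tpsi; have [intf _] := bvf; have D := bvDP bvf.
have mpsi := test_function_measurable tpsi.
have [M M0 bpsi] := test_function_bounded tpsi.
set mu := bv_variation f.
have ieta i : mu.-integrable setT (EFin \o (fun x => bv_eta f x 0 i)).
  exact: integrable_vec_density.
have ieta2 i : mu.-integrable setT (EFin \o (fun x => psi x * bv_eta f x 0 i)).
  rewrite (_ : (fun _ => _) = (fun x => bv_eta f x 0 i) \* psi).
    exact: integrable_bounded_mul (ieta i) mpsi bpsi.
  by apply/funext => x /=; rewrite mulrC.
have part i : (\int[leb]_x (f x * partial i psi x)%:E =
    - \int[mu]_x (psi x * bv_eta f x 0 i)%:E)%E.
  rewrite D// (charge_integralE (mu := mu) _ mpsi bpsi).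
    congr (- _)%E; apply: eq_integral => x _.
    by rewrite EFinM; congr (_ * _)%E; rewrite -vec_densityE.
  exact: charge_dominated_variation.
have ifp i : leb.-integrable setT (EFin \o (fun x => f x * partial i psi x)).
  have tp := test_function_partial i tpsi.
  have [M' _ bp] := test_function_bounded tp.
  exact: integrable_bounded_mul intf (test_function_measurable tp) bp.
transitivity (\int[leb]_x \sum_(i <- index_enum 'I_n)
    ((v 0 i)%:E * (f x * partial i psi x)%:E))%E.
  apply: eq_integral => x _; rewrite /dotv mulr_sumr -sumEFin.
  by apply: eq_bigr => i _; rewrite -EFinM !mxE mulrA mulrC.
rewrite integral_sum//; last by move=> i; apply: integrableZl => //; exact: ifp.
transitivity (- \int[mu]_x \sum_(i <- index_enum 'I_n)
    ((v 0 i)%:E * (psi x * bv_eta f x 0 i)%:E))%E; last first.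
  congr (- _)%E; apply: eq_integral => x _; rewrite /dotv mulr_sumr -sumEFin.
  by apply: eq_bigr => i _; rewrite -EFinM mulrA mulrC.
rewrite integral_sum//; last by move=> i; apply: integrableZl => //; exact: ieta2.
have fin i : (\int[mu]_x (psi x * bv_eta f x 0 i)%:E)%E \is a fin_num.
  exact: integrable_fin_num (ieta2 i).
rewrite -sumeN; last first.
  move=> i j _ _; apply: fin_num_adde_defr.
  rewrite integralZl//; last exact: ieta2.
  by rewrite fin_numM.
apply: eq_bigr => i _; rewrite integralZl//; last exact: ifp.
rewrite integralZl//; last exact: ieta2.
by rewrite part muleN.
Qed.

(** By duality it suffices to bound the integral of f psi for test functions |psi| <= 1 supported in
    the box. [pairing_MVT] with [w = f] does so: the translated term vanishes because the box is
    moved off itself, and the gradient of [psi] is exchanged for Df. *)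
Lemma bv_poincare f (Omega : set Rn) r v (T : R) : 0 <= r -> 0 <= T ->
  BV f -> {ae leb, forall x, ~ Omega x -> f x = 0} -> Omega `<=` open_box r ->
  (forall x, open_box r x -> ~ open_box r (T *: v + x)) ->
  (\int[leb]_(x in open_box r) (`|f x|)%:E <=
   T%:E * \int[bv_variation f]_x (`|dotv (bv_eta f x) v|)%:E)%E.
Proof.
move=> r0 T0 bvf f0 Or shift; have [intf _] := bvf.
set mu := bv_variation f.
have idot : mu.-integrable setT (EFin \o (fun x => dotv (bv_eta f x) v)).
  exact: integrable_dotv_density.
set J := (\int[mu]_x _)%E.
have Jfin : J \is a fin_num by apply: integrable_fin_num => //; exact: integrable_abse idot.
rewrite -(fineK Jfin) -EFinM.
apply: integral_norm_le_test => //.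
  by apply: integrableS intf => //; exact: measurable_open_box.
move=> psi tpsi psi_out psi1.
have mpsi := test_function_measurable tpsi.
rewrite integral_vanish_out; last by move=> x /psi_out ->; rewrite mulr0.
have [c _ E] := pairing_MVT v measurableT intf tpsi T0.
pose psic x := psi (c *: v + x).
have tpsic : test_function setT psic by exact: test_function_translate.
have int0 : \int[leb]_x (f x * psi (T *: v + x)) = 0.
  rewrite /Rintegral (ae_eq_integral (cst 0%E))//= ?integral0//.
    apply/measurable_EFinP; apply: measurable_funM.
      by apply/measurable_EFinP; exact: measurable_int intf.
    exact: test_function_measurable (test_function_translate (T *: v) tpsi).
  apply: filterS f0 => x fx _; have [Ux|nUx] := pselect (open_box r x).
    by rewrite (psi_out _ (shift _ Ux)) mulr0.
  by rewrite fx ?mul0r// => /Or.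
have fin1 : (\int[leb]_x (f x * psi x)%:E)%E \is a fin_num.
  apply: integrable_fin_num => //.
  exact: integrable_bounded_mul intf mpsi psi1.
have ipe : mu.-integrable setT (EFin \o (fun x => psic x * dotv (bv_eta f x) v)).
  rewrite (_ : (fun _ => _) = (fun x => dotv (bv_eta f x) v) \* psic).
    apply: (integrable_bounded_mul (C := 1)) idot (test_function_measurable tpsic) _.
    by move=> x; exact: psi1.
  by apply/funext => x /=; rewrite mulrC.
rewrite -(fineK fin1) lee_fin.
have -> : fine (\int[leb]_x (f x * psi x)%:E) =
    T * fine (\int[mu]_x (psic x * dotv (bv_eta f x) v)%:E)%E.
  move: E; rewrite int0 sub0r => /eqP; rewrite eqr_oppLR => /eqP; rewrite {1}/Rintegral => ->.
  rewrite -mulrN; congr (_ * _); rewrite /Rintegral.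
  rewrite (_ : (fun x => _) = fun x => (f x * dotv (grad psic x) v)%:E).
    by rewrite bv_integral_grad// fineN opprK.
  by apply/funext => x; rewrite grad_translate.
rewrite ler_wpM2l// fine_le//; first exact: integrable_fin_num ipe.
apply: le_integral => //; first exact: integrable_abse idot.
move=> x _; rewrite lee_fin; apply: le_trans (ler_norm _) _.
by rewrite normrM ler_piMl//; exact: psi1.
Qed.

End bv_poincare.

(** * Sobolev functions *)

Section measurable_open.
Context {R : realType} (a b : nat).
Local Notation V := 'M[R]_(a, b).

(** An open set is the countable union of the grid cells, of all meshes, that it contains. *)
Lemma measurable_open_mx (O : set V) : open O -> measurable O.
Proof.
move=> oO.
rewrite (_ : O = \bigcup_k \bigcup_(Z in [set: 'M[int]_(a, b)])
  (mx_floor k @^-1` [set Z] `&` [set M | mx_floor k @^-1` [set Z] `<=` O])).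
  apply: bigcupT_measurable => k; apply: countable_bigcupT_measurable => // Z.
  have [BZ|BZ] := pselect (@mx_floor R a b k @^-1` [set Z] `<=` O).
    by rewrite (_ : [set _ | _] = setT) ?setIT; [exact: measurable_mx_floor|apply/seteqP; split].
  by rewrite (_ : [set _ | _] = set0) ?setI0//; apply/seteqP; split.
apply/seteqP; split => M /=; last by move=> [k _ [Z _ [MZ]]]; exact.
move=> OM; have /nbhs_ballP[e/= e0 eO] : nbhs M O by exact: open_nbhs_nbhs.
have [k ke] : exists k, k.+1%:R^-1 < e.
  by have [k _ /(_ k (leqnn k))] := near_infty_natSinv_lt (PosNum e0); exists k.
exists k => //; exists (mx_floor k M) => //; split => // N NM; apply: eO.
split => // i j.
have k0 : 0 < k.+1%:R :> R by [].
have /matrixP/(_ i j) := NM; rewrite !mxE => E.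
have /andP[h1 h2] := floor_itv (k.+1%:R * M i j).
have /andP[h3 h4] := floor_itv (k.+1%:R * N i j).
move: h3 h4; rewrite E => h3 h4.
rewrite /ball/=; apply: le_lt_trans ke.
rewrite -(ler_pM2l k0) divff ?gt_eqF// -[X in X * `|_|]gtr0_norm// -normrM mulrBr.
rewrite ler_norml; move: h2 h4; rewrite intrD; move: h1 h3; lra.
Qed.

Lemma measurable_closed_mx (C : set V) : closed C -> measurable C.
Proof. by move=> cC; rewrite -[C]setCK; apply: measurableC; exact: measurable_open_mx (closed_openC cC). Qed.

End measurable_open.

Lemma continuous_normr_powR {R : realType} (p : R) : 0 < p ->
  continuous (fun y : R => `|y| `^ p).
Proof.
move=> p0 y; have [->|y0] := eqVneq y 0.
  rewrite /continuous_at normr0 powR0 ?gt_eqF//.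
  apply/cvgrPdist_lt => e e0; near=> z; rewrite sub0r normrN ger0_norm ?powR_ge0//.
  have -> : e = (e `^ p^-1) `^ p by rewrite -powRrM mulVf ?gt_eqF// powRr1// ltW.
  rewrite gt0_ltr_powR ?nnegrE ?powR_ge0//.
  near: z; have ep : 0 < e `^ p^-1 by exact: powR_gt0.
  have /cvgrPdist_lt/(_ _ ep) : z @[z --> (0 : R)] --> (0 : R) by exact: cvg_id.
  by apply: filterS => z; rewrite sub0r normrN.
apply: (@continuous_comp _ _ _ (fun y : R => `|y|) (@powR R ^~ p)).
  exact: norm_continuous.
have ay : 0 < `|y| by rewrite normr_gt0.
apply: differentiable_continuous; apply/derivable1_diffP.
by have [] := is_derive1_powR p ay.
Unshelve. all: by end_near. Qed.

(** * Completeness of L^p *)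

Section riesz_fischer.
Context d (T : measurableType d) {R : realType} (mu : {measure set T -> \bar R}).
Variable p : R.
Hypothesis p1 : 1 <= p.
Implicit Types f g h : T -> R.
Local Open Scope ereal_scope.
Let p0 : (0 < p)%R. Proof. exact: lt_le_trans p1. Qed.

Lemma Lnorm_sum_le (I : Type) (s : seq I) (h : I -> T -> R) :
  (forall i, measurable_fun setT (h i)) ->
  Lnorm mu p%:E (fun x => (\sum_(i <- s) h i x)%:E) <=
  \sum_(i <- s) Lnorm mu p%:E (EFin \o h i).
Proof.
move=> mh; elim: s => [|i s IH].
  rewrite big_nil (_ : (fun _ => _) = cst 0); last by apply/funext => x; rewrite big_nil.
  by rewrite Lnorm0// eqe gt_eqF.
rewrite big_cons; apply: le_trans (leeD2l _ IH).
have := @minkowski_EFin _ _ _ mu (h i) (fun x => \sum_(j <- s) h j x)%R p (mh i) _ p1.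
rewrite (_ : EFin \o (h i \+ _)%R = fun x => (\sum_(j <- i :: s) h j x)%:E)%R.
  by apply; exact: measurable_sum.
by apply/funext => x /=; rewrite big_cons.
Qed.

Lemma LnormB_le f g : measurable_fun setT f -> measurable_fun setT g ->
  Lnorm mu p%:E (EFin \o f) <=
  Lnorm mu p%:E (EFin \o g) + Lnorm mu p%:E (fun x => (f x - g x)%:E).
Proof.
move=> mf mg.
have := @minkowski_EFin _ _ _ mu g (f \- g)%R p mg (measurable_funB mf mg) p1.
rewrite (_ : EFin \o (g \+ _)%R = EFin \o f)//.
by apply/funext => x /=; rewrite addrCA subrr addr0.
Qed.

Lemma LnormBC f g :
  Lnorm mu p%:E (fun x => (f x - g x)%:E) = Lnorm mu p%:E (fun x => (g x - f x)%:E).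
Proof.
rewrite -(oppe_Lnorm mu (fun x => (f x - g x)%:E)); congr Lnorm.
by apply/funext => x /=; rewrite opprB.
Qed.

Lemma fatou_Lnorm_pow (h : nat -> T -> R) (C : R) :
  (forall j, measurable_fun setT (h j)) -> (forall j, Lnorm mu p%:E (EFin \o h j) <= C%:E) ->
  \int[mu]_x limn_einf (fun j => `|(h j x)%:E| `^ p) <= C%:E `^ p.
Proof.
move=> mh hC; have mp j : measurable_fun setT (fun x => `|(h j x)%:E| `^ p).
  by apply: measurable_poweR_abse; exact/measurable_EFinP.
apply: le_trans (fatou _ _ mp _) _ => //; first by move=> *; exact: poweR_ge0.
rewrite limn_einf_lim; apply: lime_le; first exact: is_cvg_einfs.
apply: nearW => j; apply: ge_ereal_inf; exists (\int[mu]_x `|(h j x)%:E| `^ p).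
  by exists j => //=.
rewrite -(powR_Lnorm mu (EFin \o h j)) ?gt_eqF//; apply: le_poweR (hC j); [exact: ltW|exact: Lnorm_ge0].
Qed.

Let mpow f : measurable_fun setT f -> measurable_fun setT (fun x => `|(f x)%:E| `^ p).
Proof. by move=> mf; apply: measurable_poweR_abse; exact/measurable_EFinP. Qed.

Let measurable_einf_pow (h : nat -> T -> R) : (forall j, measurable_fun setT (h j)) ->
  measurable_fun setT (fun x => limn_einf (fun j => `|(h j x)%:E| `^ p)).
Proof.
move=> mh; rewrite /limn_einf; apply: measurableT_comp => //.
apply: measurable_fun_limn_esup => j; apply: measurableT_comp => //.
exact: mpow.
Qed.

Let einf_pow_ge0 (h : nat -> R) : 0 <= limn_einf (fun j => `|(h j)%:E| `^ p).
Proof.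
rewrite limn_einf_lim; apply: lime_ge; first exact: is_cvg_einfs.
by apply: nearW => j; apply: le_ereal_inf_tmp => _ [k _ <-]; exact: poweR_ge0.
Qed.

Lemma fatou_Lnorm (h : nat -> T -> R) g (C : R) : (0 <= C)%R ->
  (forall j, measurable_fun setT (h j)) -> measurable_fun setT g ->
  {ae mu, forall x, h j x @[j --> \oo] --> g x} ->
  (forall j, Lnorm mu p%:E (EFin \o h j) <= C%:E) ->
  Lnorm mu p%:E (EFin \o g) <= C%:E.
Proof.
move=> C0 mh mg hg hC; rewrite LnormE.
have -> : \int[mu]_x `|(EFin \o g) x| `^ p =
    \int[mu]_x limn_einf (fun j => `|(h j x)%:E| `^ p).
  apply: ae_eq_integral => //; [exact: mpow|exact: measurable_einf_pow|].
  apply: filterS hg => x hx _ /=.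
  have H : (`|h j x| `^ p)%R @[j --> \oo] --> (`|g x| `^ p)%R.
    exact: (cvg_comp _ _ hx (@continuous_normr_powR R p p0 (g x))).
  have /cvg_limn_einf_sup[<- _] : (`|h j x| `^ p)%:E @[j --> \oo] --> (`|g x| `^ p)%:E.
    by apply: cvg_EFin => //; exact: nearW.
  by [].
have -> : C%:E = (C%:E `^ p) `^ p^-1.
  by rewrite -poweRrM divff ?gt_eqF// poweRe1.
apply: le_poweR; [by rewrite invr_ge0 ltW|exact: integral_ge0|].
exact: fatou_Lnorm_pow.
Qed.

(** The partial sums of |h_j| increase and are bounded in L^p, so by Fatou their limit is finite
    almost everywhere. *)
Lemma summable_ae_cvg (h : nat -> T -> R) (C : R) :
  (forall j, measurable_fun setT (h j)) ->
  (forall k, \sum_(j < k) Lnorm mu p%:E (EFin \o h j) <= C%:E) ->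
  {ae mu, forall x, cvgn (series (h ^~ x))}.
Proof.
move=> mh hC; pose S k x : R := (\sum_(j < k) `|h j x|)%R.
have mS k : measurable_fun setT (S k).
  by apply: measurable_sum => j; exact: measurableT_comp.
have SC k : Lnorm mu p%:E (EFin \o S k) <= C%:E.
  apply: le_trans (hC k); apply: le_trans (Lnorm_sum_le _ _) _.
    by move=> j; exact: measurableT_comp.
  by apply: lee_sum => j _; rewrite -(Lnorm_abse mu (EFin \o h j)).
have int : mu.-integrable setT (fun x => limn_einf (fun k => `|(S k x)%:E| `^ p)).
  apply/integrableP; split; first exact: measurable_einf_pow.
  under eq_integral do rewrite gee0_abs//.
  apply: le_lt_trans (fatou_Lnorm_pow mS SC) _.
  by rewrite poweR_lty// ltry.
have := integrable_ae measurableT int; apply: filterS => x /(_ I) xfin.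
apply: normed_cvg.
have nd : nondecreasing_seq (S ^~ x).
  by apply/nondecreasing_seqP => k; rewrite /S big_ord_recr/= lerDl.
have S0 k : (0 <= S k x)%R by exact: sumr_ge0.
have ndp : nondecreasing_seq (fun k => `|(S k x)%:E| `^ p).
  move=> k l kl; apply: le_poweR; [exact: ltW|by []|].
  by rewrite !abse_EFin !ger0_norm// lee_fin; exact: nd.
have -> : [normed series (h ^~ x)] = S ^~ x.
  by apply/funext => k; rewrite /S -(big_mkord xpredT (fun j => `|h j x|)%R).
apply: nondecreasing_is_cvgn => //.
exists (fine (limn_einf (fun k => `|(S k x)%:E| `^ p))%E `^ p^-1)%R => _ [k _ <-].
rewrite -[leLHS]powRr1// -[X in (_ `^ X)%R](divff (lt0r_neq0 p0)) powRrM.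
apply: ge0_ler_powR; rewrite ?nnegrE ?invr_ge0 ?powR_ge0 ?(ltW p0)//.
  exact: fine_ge0.
rewrite -lee_fin fineK// is_cvg_limn_einfE; last exact: ereal_nondecreasing_is_cvgn.
rewrite (cvg_lim _ (ereal_nondecreasing_cvgn ndp))//.
apply: ereal_sup_ubound; exists k => //=.
by rewrite ger0_norm.
Qed.

Theorem riesz_fischer (g : nat -> T -> R) :
  (forall k, measurable_fun setT (g k)) ->
  (forall e : R, (0 < e)%R -> exists N, forall k l, (N <= k)%N -> (N <= l)%N ->
     Lnorm mu p%:E (fun x => (g k x - g l x)%:E) <= e%:E) ->
  exists2 u : T -> R, measurable_fun setT u &
    forall e : R, (0 < e)%R -> exists N, forall k, (N <= k)%N ->
      Lnorm mu p%:E (fun x => (g k x - u x)%:E) <= e%:E.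
Proof.
move=> mg cg.
have e2 j : (0 < 2^-1 ^+ j :> R)%R by rewrite exprn_gt0.
have /choice[N HN] : forall j, exists N, forall k l, (N <= k)%N -> (N <= l)%N ->
    Lnorm mu p%:E (fun x => (g k x - g l x)%:E) <= (2^-1 ^+ j)%:E.
  by move=> j; exact: cg (e2 j).
pose K j := (j + \sum_(i < j.+1) N i)%N.
have KS j : (K j <= K j.+1)%N by rewrite /K [in leqRHS]big_ord_recr/= leq_add// leq_addr.
have NK j : (N j <= K j)%N by rewrite /K big_ord_recr/= addnA leq_addl.
have jK j : (j <= K j)%N by rewrite /K leq_addr.
pose h j x := (g (K j.+1) x - g (K j) x)%R.
have mh j : measurable_fun setT (h j) by exact: measurable_funB.
have hC k : \sum_(j < k) Lnorm mu p%:E (EFin \o h j) <= 2%:E.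
  have -> : 2%:E = (\sum_(j < k) 2^-1 ^+ j + 2 * 2^-1 ^+ k)%R%:E :> \bar R.
    congr EFin; elim: k => [|k IH]; first by rewrite big_ord0 add0r mulr1.
    by rewrite big_ord_recr/= -addrA exprS; rewrite [LHS]IH; congr (_ + _)%R; field.
  rewrite EFinD -sumEFin -[leLHS]adde0; apply: leeD; last by rewrite lee_fin mulr_ge0// ltW.
  apply: lee_sum => j _; apply: HN (leq_trans (NK j) (KS j)) (NK j).
have /= := summable_ae_cvg mh hC.
move=> [N0 [mN0 muN0 cN0]].
have cvgK x : ~ N0 x -> cvgn (fun j => g (K j) x).
  move=> nx; have {}nx : cvgn (series (h ^~ x)).
    by apply: contrapT => nc; apply: nx; exact: cN0.
  rewrite (_ : (fun j => _) = (fun j => g (K 0%N) x + series (h ^~ x) j)%R).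
    exact: is_cvgD (is_cvg_cst _) nx.
  apply/funext => j; rewrite /series/= /h telescope_sumr//.
  by rewrite addrC subrK.
(* Set to 0 on the exceptional null set, so that the limit exists everywhere and is measurable. *)
pose gg j x := (g (K j) x * \1_(~` N0) x)%R.
have mgg j : measurable_fun setT (gg j).
  by apply: measurable_funM => //; apply: measurable_indic; exact: measurableC.
have ggE x : ~ N0 x -> gg ^~ x = fun j => g (K j) x.
  by move=> xN; apply/funext => j; rewrite /gg indicE mem_set// mulr1.
have cgg x : cvgn (gg ^~ x).
  have [xN|xN] := pselect (N0 x); last by rewrite ggE//; exact: cvgK.
  rewrite (_ : gg ^~ x = cst 0%R); first exact: is_cvg_cst.
  by apply/funext => j; rewrite /gg indicE memNset ?mulr0//= => /(_ xN).
pose u x := limn (gg ^~ x).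
have mu_ : measurable_fun setT u by apply: measurable_fun_cvg mgg _ => x _; exact: cgg.
exists u => // e e0; have [M HM] := cg e e0; exists M => k Mk.
apply: (@fatou_Lnorm (fun j x => g k x - g (K (j + M)%N) x)%R) => //.
- exact: ltW.
- by move=> j; exact: measurable_funB.
- exact: measurable_funB.
- exists N0; split => // x /=; apply: contra_notP => xN.
  apply: cvgB; first exact: cvg_cst.
  have : gg j x @[j --> \oo] --> u x by exact: cgg.
  by rewrite ggE// -(cvg_shiftn M).
- move=> j; apply: HM => //.
  exact: leq_trans (leq_addl _ _) (jK _).
Qed.

End riesz_fischer.

(** * Weak gradients *)

Section weak_gradient.
Context {R : realType} {n : nat}.
Local Notation Rn := 'rV[R]_n.
Local Notation leb := (@lebesgue_mx R 1 n).
Implicit Types (f h w phi : Rn -> R) (g u : Rn -> Rn).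

Lemma mx_box_compact (r : R) : 0 <= r -> compact (mx_box r : set Rn).
Proof.
move=> r0; have -> : mx_box r = [set x : Rn | `|x| <= r].
  apply/seteqP; split => x; first exact: mx_box_norm.
  by move=> xr; exact: mx_boxW xr (norm_mx_box x).
apply: bounded_closed_compact; last exact: closed_norm_le.
exists r; split; first exact: num_real.
by move=> M rM x /= xr; exact: le_trans (ltW rM).
Qed.

Lemma loc_integrable_open_box f (r : R) : 0 <= r -> loc_integrable f ->
  leb.-integrable (open_box r) (EFin \o f).
Proof.
move=> r0 [_ /(_ _ (mx_box_compact r0))]; apply: integrableS.
- exact: measurable_mx_box.
- exact: measurable_open_box.
- exact: open_box_sub.
Qed.

Lemma bigcup_open_box : \bigcup_k (open_box k%:R : set Rn) = setT.
Proof.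
apply/seteqP; split => // x _; exists (Num.bound `|x|) => // i.
by apply: le_lt_trans (normr_mx_coord x i) _; exact: archi_boundP.
Qed.

(** The du Bois-Reymond lemma: on each open box, [integral_norm_le_test] with constant 0 applies to
    f - h. *)
Lemma ae_test_eq f h : loc_integrable f -> loc_integrable h ->
  (forall phi, test_function setT phi ->
    (\int[leb]_x (f x * phi x)%:E = \int[leb]_x (h x * phi x)%:E)%E) ->
  {ae leb, forall x, f x = h x}.
Proof.
move=> lf lh fh.
have ae k : {ae leb, forall x, open_box k%:R x -> (f x - h x)%:E = cst 0%E x}.
  have k0 : 0 <= k%:R :> R by [].
  have mB := @measurable_open_box R n k%:R.
  have if_ := loc_integrable_open_box k0 lf; have ih := loc_integrable_open_box k0 lh.
  have id : leb.-integrable (open_box k%:R) (EFin \o (fun x => f x - h x)).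
    exact: (integrableB mB if_ ih).
  apply/(ae_eq_integral_abs leb mB (measurable_int _ id)).
  apply/eqP; rewrite eq_le integral_ge0 ?andbT//.
  apply: (integral_norm_le_test k0 id) => psi tpsi out psi1.
  have mul w : loc_integrable w -> leb.-integrable (open_box k%:R) (EFin \o (fun x => w x * psi x)).
    move=> lw; have iw := loc_integrable_open_box k0 lw.
    have := @integrableMl _ _ _ leb _ mB (EFin \o w) psi iw.
    apply; first exact: measurable_funTS (test_function_measurable tpsi).
    by exists 1; split => [|y y1 x _]; [exact: num_real|exact: le_trans (psi1 x) (ltW y1)].
  rewrite (_ : (fun x => _) = fun x => ((f x * psi x)%:E - (h x * psi x)%:E)%E); last first.
    by apply/funext => x; rewrite -EFinB mulrBl.
  rewrite integralB//; [|exact: mul|exact: mul].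
  have vo w : (\int[leb]_(x in open_box k%:R) (w x * psi x)%:E = \int[leb]_x (w x * psi x)%:E)%E.
    by apply: (@integral_vanish_out _ _ _ (fun x => w x * psi x)) => x /out ->; rewrite mulr0.
  rewrite (vo f) (vo h) fh// subee// -(vo h).
  exact: (integrable_fin_num mB (mul _ lh)).
have /ae_foralln : forall k, {ae leb, forall x, open_box k%:R x -> (f x - h x)%:E = cst 0%E x}.
  exact: ae.
apply: filterS => x Hx.
have : (\bigcup_k (open_box k%:R : set Rn)) x by rewrite bigcup_open_box.
by move=> [k _ /Hx/= /eqP]; rewrite eqe subr_eq0 => /eqP.
Qed.

Lemma weak_gradient_ae f g u : weak_gradient f g -> weak_gradient f u ->
  {ae leb, forall x, g x = u x}.
Proof.
move=> [_ Hg] [_ Hu].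
have : forall i : 'I_n, {ae leb, forall x, g x 0 i = u x 0 i}.
  move=> i; have [lg ig] := Hg i; have [lu iu] := Hu i.
  apply: ae_test_eq => // phi tphi; apply: oppe_inj.
  by rewrite -ig// iu.
move=> /filter_forall; apply: filterS => x H; apply/rowP => i; exact: H.
Qed.

Lemma weak_gradient_wgrad f g : weak_gradient f g -> weak_gradient f (wgrad f).
Proof. by move=> fg; apply: (xgetPex (cst 0)); exists g. Qed.

Variables (p : R).
Hypothesis p1 : 1 < p.
Let p0 : 0 < p. Proof. exact: lt_trans p1. Qed.
Let q := p / (p - 1).
Let pm0 : 0 < p - 1. Proof. by rewrite subr_gt0. Qed.
Let q0 : 0 < q. Proof. by rewrite divr_gt0. Qed.
Let pq : p^-1 + q^-1 = 1. Proof. by rewrite /q invf_div; field; rewrite gt_eqF. Qed.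

Lemma Lnorm_bounded_supported_lty h (r C s : R) : 0 < s -> measurable_fun setT h ->
  (forall x, `|h x| <= C) -> supported r h -> (Lnorm leb s%:E (EFin \o h) < +oo)%E.
Proof.
move=> s0 mh hC sh; have C0 : 0 <= C by exact: le_trans (hC 0).
rewrite LnormE poweR_lty//.
have int : leb.-integrable setT (EFin \o (fun x => `|h x| `^ s)).
  apply: (@integrable_bounded_supported _ _ _ r (C `^ s)).
  - by apply: (measurableT_comp (measurable_powR _)); exact: measurableT_comp.
  - by move=> x; rewrite ger0_norm ?powR_ge0// ge0_ler_powR ?nnegrE ?(ltW s0).
  - by move=> x H; apply: sh; move: H; apply: contra => /eqP ->; rewrite normr0 powR0 ?(gt_eqF s0).
have /integrableP[_] := int; apply: le_lt_trans.
rewrite le_eqVlt; apply/orP; left; apply/eqP; apply: eq_integral => x _ /=.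
by rewrite [in RHS]ger0_norm ?powR_ge0.
Qed.

Lemma Lp_mul_integrable w h (r C : R) : measurable_fun setT w ->
  (Lnorm leb p%:E (EFin \o w) < +oo)%E -> measurable_fun setT h ->
  (forall x, `|h x| <= C) -> supported r h ->
  leb.-integrable setT (EFin \o (w \* h)).
Proof.
move=> mw wfin mh hC sh; apply/integrableP; split.
  by apply/measurable_EFinP; exact: measurable_funM.
have := hoelder leb mw mh p0 q0 pq; rewrite Lnorm1 => /le_lt_trans; apply.
rewrite lte_mul_pinfty ?Lnorm_ge0//; last exact: Lnorm_bounded_supported_lty q0 mh hC sh.
by rewrite ge0_fin_numE ?Lnorm_ge0.
Qed.

Lemma Lp_loc_integrable w : measurable_fun setT w ->
  (Lnorm leb p%:E (EFin \o w) < +oo)%E -> loc_integrable w.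
Proof.
move=> mw wfin; split => // K cK.
have mK : measurable K by apply: measurable_closed_mx; exact: compact_closed cK.
have [M [_ HM]] := compact_bounded cK.
have sub : K `<=` mx_box (`|M| + 1).
  move=> x Kx; apply: mx_boxW (norm_mx_box x); apply: HM => //.
  by rewrite (le_lt_trans (ler_norm M))// ltrDl.
have : leb.-integrable setT (EFin \o (w \* \1_K)).
  apply: (@Lp_mul_integrable _ _ (`|M| + 1) 1) => //.
  - by move=> x; rewrite indicE; case: (_ \in _); rewrite ?normr1 ?normr0.
  - by move=> x; rewrite indicE; case: (boolP (x \in K)) => [/set_mem/sub//|_]; rewrite eqxx.
move=> int; have := integrableS measurableT mK (@subsetT _ K) int.
apply: eq_integrable => // x xK /=.
by rewrite indicE xK mulr1.
Qed.

Lemma cvg_Lp_pairing (a : nat -> Rn -> R) w h (r C : R) :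
  (forall k, measurable_fun setT (a k)) -> measurable_fun setT w ->
  (forall k, Lnorm leb p%:E (EFin \o a k) < +oo)%E ->
  (Lnorm leb p%:E (EFin \o w) < +oo)%E ->
  (forall e : R, 0 < e -> exists N, forall k, (N <= k)%N ->
      (Lnorm leb p%:E (fun x => (a k x - w x)%:E) <= e%:E)%E) ->
  measurable_fun setT h -> (forall x, `|h x| <= C) -> supported r h ->
  \int[leb]_x (a k x * h x) @[k --> \oo] --> \int[leb]_x (w x * h x).
Proof.
move=> ma mw afin wfin aw mh hC sh.
have hq := Lnorm_bounded_supported_lty q0 mh hC sh.
pose H := fine (Lnorm leb q%:E (EFin \o h)).
have H0 : 0 <= H by exact/fine_ge0/Lnorm_ge0.
have HE : Lnorm leb q%:E (EFin \o h) = H%:E by rewrite fineK// ge0_fin_numE ?Lnorm_ge0.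
have ia k : leb.-integrable setT (EFin \o (a k \* h)) by exact: Lp_mul_integrable hC sh.
have iw : leb.-integrable setT (EFin \o (w \* h)) by exact: Lp_mul_integrable hC sh.
apply/cvgrPdist_le => e e0.
have [N HN] := aw (e / (H + 1)) (divr_gt0 e0 (ltr_wpDl H0 ltr01)).
exists N => // k /= Nk.
rewrite distrC -RintegralB//; last exact: ia k.
apply: le_trans (le_normr_Rintegral _ _) _ => //; first exact: (integrableB measurableT (ia k) iw).
rewrite -lee_fin fineK; last first.
  by apply: integrable_fin_num => //; exact: integrable_abse (integrableB measurableT (ia k) iw).
have := hoelder leb (measurable_funB (ma k) mw) mh p0 q0 pq; rewrite Lnorm1.
rewrite (_ : (fun x => _) = fun x => (`|a k x * h x - w x * h x|)%:E); last first.
  by apply/funext => x /=; rewrite mulrBl.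
move=> /le_trans; apply.
apply: le_trans (lee_wpmul2r (Lnorm_ge0 _ _ _) (HN _ Nk)) _.
rewrite HE -EFinM lee_fin mulrAC ler_pdivrMr ?ltr_wpDl//.
by rewrite ler_wpM2l ?(ltW e0)// lerDl.
Qed.

End weak_gradient.

Section sobolev.
Context {R : realType} {n : nat}.
Local Notation Rn := 'rV[R]_n.
Local Notation leb := (@lebesgue_mx R 1 n).
Implicit Types (f w : Rn -> R) (a : nat -> Rn -> R) (u : Rn -> Rn).
Variable p : R.
Hypothesis p1 : 1 < p.
Let p0 : 0 < p. Proof. exact: lt_trans p1. Qed.

Definition Lp_cvg a w := forall e : R, 0 < e -> exists N, forall k, (N <= k)%N ->
  (Lnorm leb p%:E (fun x => (a k x - w x)%:E) <= e%:E)%E.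

Lemma Lp_cvg_lty a w : (forall k, measurable_fun setT (a k)) -> measurable_fun setT w ->
  (forall k, Lnorm leb p%:E (EFin \o a k) < +oo)%E -> Lp_cvg a w ->
  (Lnorm leb p%:E (EFin \o w) < +oo)%E.
Proof.
move=> ma mw afin aw; have [N /(_ N (leqnn N)) HN] := aw 1 ltr01.
apply: le_lt_trans (LnormB_le leb (ltW p1) mw (ma N)) _.
by rewrite lte_add_pinfty// LnormBC (le_lt_trans HN)// ltry.
Qed.

Lemma Lnorm_cvg_Lp_cvg a w :
  Lnorm leb p%:E (fun x => (a k x - w x)%:E) @[k --> \oo] --> 0%E -> Lp_cvg a w.
Proof.
move=> /fine_cvgP[[N1 _ fin] /cvgrPdist_lt H] e e0.
have [N2 _ HN2] := H e e0; exists (maxn N1 N2) => k; rewrite geq_max => /andP[k1 k2].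
rewrite -(fineK (fin k k1)) lee_fin ltW//.
by have := HN2 k k2; rewrite /= sub0r normrN; exact: le_lt_trans (ler_norm _).
Qed.

Lemma test_Lnorm_lty Omega phi : test_function Omega phi ->
  (Lnorm leb p%:E (EFin \o phi) < +oo)%E.
Proof.
move=> tphi; have [C _ HC] := test_function_bounded tphi.
have [r _ sphi] := test_function_bounded_support tphi.
exact: Lnorm_bounded_supported_lty p0 (test_function_measurable tphi) HC sphi.
Qed.

Lemma Lp_cvg_dotv (a : nat -> Rn -> Rn) u v :
  (forall k, measurable_fun setT (a k)) -> measurable_fun setT u ->
  (forall i, Lp_cvg (fun k x => a k x 0 i) (fun x => u x 0 i)) ->
  Lp_cvg (fun k x => dotv (a k x) v) (fun x => dotv (u x) v).
Proof.
move=> ma mu au e e0.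
pose V := \sum_i `|v 0 i|; have V0 : 0 <= V by exact: sumr_ge0.
have e1 : 0 < e / (V + 1) by rewrite divr_gt0// ltr_wpDl.
have /choice[N HN] := fun i => au i _ e1.
exists (\sum_i N i)%N => k Nk.
rewrite (_ : (fun x => _) = fun x => (\sum_i v 0 i * (a k x 0 i - u x 0 i))%:E); last first.
  apply/funext => x; rewrite -dotvBl /dotv; congr EFin; apply: eq_bigr => i _.
  by rewrite !mxE mulrC.
have md i : measurable_fun setT (fun x => a k x 0 i - u x 0 i).
  apply: measurable_funB; apply: (measurableT_comp (measurable_mx_coord _ _)) => //.
apply: le_trans (Lnorm_sum_le leb (ltW p1) _ _) _.
  by move=> i; apply: measurable_funM.
apply: (@le_trans _ _ (\sum_i (`|v 0 i| * (e / (V + 1)))%:E)%E).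
  apply: lee_sum => i _.
  have -> : Lnorm leb p%:E (EFin \o (fun x => v 0 i * (a k x 0 i - u x 0 i))) =
      Lnorm leb p%:E (fun x => (`|v 0 i| * (a k x 0 i - u x 0 i))%:E).
    rewrite -[LHS]Lnorm_abse -[RHS]Lnorm_abse; congr Lnorm; apply/funext => x /=.
    by rewrite !normrM normr_id.
  rewrite LnormMl// EFinM lee_wpmul2l//; apply: HN; apply: leq_trans Nk.
  by rewrite (bigD1 i)//= leq_addr.
rewrite sumEFin lee_fin -mulr_suml mulrA ler_pdivrMr ?ltr_wpDl//.
by rewrite mulrC ler_wpM2l ?(ltW e0)// lerDl.
Qed.

(** The partial derivatives of the approximating sequence are Cauchy in L^p; their limits form a
    weak gradient, since integration by parts against a fixed test function passes to the limit by
    Hoelder's inequality. *)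
Lemma sobolev0_limit Omega f : sobolev0 p Omega f ->
  exists phi u, [/\ forall k, test_function Omega (phi k), Lp_cvg phi f,
    measurable_fun setT u,
    forall i, Lp_cvg (fun k => partial i (phi k)) (fun x => u x 0 i) &
    weak_gradient f u].
Proof.
move=> [mf [phi [tphi cphi /Lnorm_cvg_Lp_cvg phif]]].
have mphi k := test_function_measurable (tphi k).
have tpart k i := test_function_partial i (tphi k).
have mpart k i := test_function_measurable (tpart k i).
have mgrad k : measurable_fun setT (grad (phi k)).
  by apply: measurable_fun_mx => j i; under eq_fun do rewrite mxE; exact: mpart.
have /choice[u0 Hu0] : forall i, exists u : Rn -> R, measurable_fun setT u /\
    Lp_cvg (fun k => partial i (phi k)) u.
  move=> i; have [] := @riesz_fischer _ _ _ leb p (ltW p1) (fun k => partial i (phi k)).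
  - by move=> k; exact: mpart.
  - move=> e e0; have [N HN] := cphi e e0; exists N => k l Nk Nl.
    apply: le_trans (ltW (HN k l Nk Nl)); apply: le_Lnorm => //.
    + by apply/measurable_EFinP; exact: measurable_funB.
    + apply/measurable_EFinP; apply: (measurableT_comp (@measurable_enorm R 1 n)).
      by apply: measurable_mxD => //; exact: measurable_mxN.
    + move=> x /=; rewrite lee_fin (ger0_norm (enorm_ge0 _)).
      by have := normr_le_enorm (grad (phi k) x - grad (phi l) x) 0 i; rewrite !mxE.
  - by move=> w mw Hw; exists w.
pose u x : Rn := \row_i u0 i x.
have uE i : (fun x => u x 0 i) = u0 i by apply/funext => x; rewrite mxE.
have mu : measurable_fun setT u.
  by apply: measurable_fun_mx => j i; rewrite ord1 uE; exact: (Hu0 i).1.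
exists phi, u; split => //; first by move=> i; rewrite uE; exact: (Hu0 i).2.
have ffin := Lp_cvg_lty mphi mf (fun k => test_Lnorm_lty (tphi k)) phif.
have ufin i := Lp_cvg_lty (fun k => mpart k i) (Hu0 i).1 (fun k => test_Lnorm_lty (tpart k i)) (Hu0 i).2.
split; first exact: (Lp_loc_integrable p1 mf ffin).
move=> i; split; first by rewrite uE; exact: (Lp_loc_integrable p1 (Hu0 i).1 (ufin i)).
move=> psi tpsi; rewrite (_ : (fun x => (u x 0 i * _)%:E) = fun x => (u0 i x * psi x)%:E); last first.
  by apply/funext => x; rewrite mxE.
have [r _ spsi] := test_function_bounded_support tpsi.
have [C _ HC] := test_function_bounded tpsi.
have tpi := test_function_partial i tpsi.
have [r' _ spi] := test_function_bounded_support tpi.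
have [C' _ HC'] := test_function_bounded tpi.
have c1 := cvg_Lp_pairing p1 mphi mf (fun k => test_Lnorm_lty (tphi k)) ffin phif
  (test_function_measurable tpi) HC' spi.
have c2 := cvg_Lp_pairing p1 (fun k => mpart k i) (Hu0 i).1
  (fun k => test_Lnorm_lty (tpart k i)) (ufin i) (Hu0 i).2
  (test_function_measurable tpsi) HC spsi.
have E : \int[leb]_x (f x * partial i psi x) = - \int[leb]_x (u0 i x * psi x).
  rewrite -(cvg_lim (@Rhausdorff R) c1) -(cvg_lim (@Rhausdorff R) (cvgN c2)); congr (lim (_ @ \oo)).
  apply/funext => k /=.
  by rewrite /Rintegral (integration_by_parts_test _ (test_functionS (tphi k)) tpsi) fineN.
have i1 := Lp_mul_integrable p1 mf ffin (test_function_measurable tpi) HC' spi.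
have i2 := Lp_mul_integrable p1 (Hu0 i).1 (ufin i) (test_function_measurable tpsi) HC spsi.
rewrite -(fineK (integrable_fin_num measurableT i1)) -(fineK (integrable_fin_num measurableT i2)).
by move: E; rewrite /Rintegral => E; rewrite -EFinN; congr EFin.
Qed.

End sobolev.

Section sobolev_wgrad.
Context {R : realType} {n : nat}.
Local Notation Rn := 'rV[R]_n.
Local Notation leb := (@lebesgue_mx R 1 n).
Variables (p : R) (Omega : set Rn) (f : Rn -> R).
Hypotheses (p1 : 1 < p) (sf : sobolev0 p Omega f).
Let p0 : 0 < p. Proof. exact: lt_trans p1. Qed.
Let mf : measurable_fun setT f. Proof. by have [] := sf. Qed.

Lemma measurable_wgrad : measurable_fun setT (wgrad f).
Proof.
have [phi [u [_ _ _ _ fu]]] := sobolev0_limit p1 sf.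
have [_ H] := weak_gradient_wgrad fu.
by apply: measurable_fun_mx => j i; rewrite ord1; have [[]] := H i.
Qed.

(** [wgrad] is an arbitrary choice among the weak gradients; almost everywhere uniqueness identifies
    it with the L^p limit. *)
Lemma sobolev0_approx : exists phi, [/\ forall k, test_function Omega (phi k),
  Lp_cvg p phi f &
  forall i, Lp_cvg p (fun k x => grad (phi k) x 0 i) (fun x => wgrad f x 0 i)].
Proof.
have [phi [u [tphi phif mu phiu fu]]] := sobolev0_limit p1 sf.
exists phi; split => // i e e0; have [N HN] := phiu i e e0; exists N => k Nk.
have mp := test_function_measurable (test_function_partial i (tphi k)).
have mci (w : Rn -> Rn) : measurable_fun setT w -> measurable_fun setT (fun x => w x 0 i).
  by move=> mw; apply: (measurableT_comp (measurable_mx_coord _ _)).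
have mw := measurable_wgrad.
rewrite (_ : (fun x => _) = fun x => (partial i (phi k) x - wgrad f x 0 i)%:E); last first.
  by apply/funext => x; rewrite mxE.
rewrite (@ae_eq_Lnorm _ _ _ leb p p0 _ (fun x => (partial i (phi k) x - u x 0 i)%:E)).
- exact: HN.
- by apply/measurable_EFinP; apply: measurable_funB => //; exact: mci.
- by apply/measurable_EFinP; apply: measurable_funB => //; exact: mci.
- by apply: filterS (weak_gradient_ae (weak_gradient_wgrad fu) fu) => x ->.
Qed.

Lemma sobolev0_wgrad_lty : (Lnorm leb p%:E (fun x => (enorm (wgrad f x))%:E) < +oo)%E.
Proof.
have [phi [tphi _ phiu]] := sobolev0_approx.
have mw := measurable_wgrad.
have mci i : measurable_fun setT (fun x => wgrad f x 0 i).
  by apply: (measurableT_comp (measurable_mx_coord _ _)).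
have gE k i : (fun x => grad (phi k) x 0 i) = partial i (phi k).
  by apply/funext => x; rewrite mxE.
have wfin i : (Lnorm leb p%:E (EFin \o (fun x => wgrad f x 0%R i)) < +oo)%E.
  apply: (Lp_cvg_lty p1 _ _ _ (phiu i)) => // k; rewrite gE.
    exact: test_function_measurable (test_function_partial i (tphi k)).
  exact: (test_Lnorm_lty p1 (test_function_partial i (tphi k))).
apply: (@le_lt_trans _ _ (Lnorm leb p%:E (fun x => (\sum_i `|wgrad f x 0%R i|)%R%:E))).
  apply: le_Lnorm => //.
  - by apply/measurable_EFinP; apply: measurableT_comp mw; exact: measurable_enorm.
  - by apply/measurable_EFinP; apply: measurable_sum => i; exact: measurableT_comp.
  - move=> x; rewrite !abse_EFin lee_fin !ger0_norm ?enorm_ge0 ?sumr_ge0//.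
    exact: enorm_le_sum.
apply: le_lt_trans (Lnorm_sum_le leb (ltW p1) _ _) _.
  by move=> i; exact: measurableT_comp.
apply: lte_sum_pinfty => i _.
by have := wfin i; rewrite -(Lnorm_abse leb (EFin \o (fun x => wgrad f x 0%R i))).
Qed.

Lemma sobolev0_poincare v (T : R) : 0 < T -> (forall x, Omega x -> ~ Omega (T *: v + x)) ->
  (Lnorm leb p%:E (EFin \o f) <=
   T%:E * Lnorm leb p%:E (fun x => (dotv (wgrad f x) v)%:E))%E.
Proof.
move=> T0 shift; have [phi [tphi phif phiu]] := sobolev0_approx.
have mw := measurable_wgrad.
have mgrad k : measurable_fun setT (grad (phi k)).
  apply: measurable_fun_mx => j i; under eq_fun do rewrite mxE.
  exact: test_function_measurable (test_function_partial i (tphi k)).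
have phid := Lp_cvg_dotv p1 v mgrad mw phiu.
apply/lee_addgt0Pr => e e0.
(* The error on the function enters with weight 1, the error on its directional derivative with
   weight [T]. *)
have e1 : 0 < e / (1 + T) by rewrite divr_gt0// addr_gt0.
have [N1 HN1] := phif _ e1; have [N2 HN2] := phid _ e1.
pose k := maxn N1 N2.
have mphi := test_function_measurable (tphi k).
apply: le_trans (LnormB_le leb (ltW p1) mf mphi) _; rewrite LnormBC.
apply: le_trans (leeD (smooth_poincare T0 p1 (tphi k) shift) (HN1 k (leq_maxl _ _))) _.
have := LnormB_le leb (ltW p1) (measurable_dotv v (mgrad k)) (measurable_dotv v mw).
move=> /le_trans /(_ (leeD2l _ (HN2 k (leq_maxr _ _)))) H.
apply: le_trans (leeD2r _ (lee_wpmul2l _ H)) _; first by rewrite lee_fin ltW.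
rewrite ge0_muleDr ?Lnorm_ge0 ?lee_fin ?(ltW e1)// -addeA leeD2l//.
rewrite -EFinM -EFinD lee_fin; rewrite le_eqVlt; apply/orP; left; apply/eqP.
by field; rewrite gt_eqF// addr_gt0.
Qed.

(** Outside Omega the approximating functions are 0, so |f| is there the error of approximation,
    which is arbitrarily small in L^p. *)
Lemma sobolev0_vanish : measurable Omega -> {ae leb, forall x, ~ Omega x -> f x = 0}.
Proof.
move=> mO; have [phi [tphi phif _]] := sobolev0_approx.
pose w x := f x * \1_(~` Omega) x.
have mw : measurable_fun setT w.
  by apply: measurable_funM => //; apply: measurable_indic; exact: measurableC.
have w0 : Lnorm leb p%:E (EFin \o w) = 0%E.
  apply/eqP; rewrite eq_le Lnorm_ge0 andbT; apply/lee_addgt0Pr => e e0; rewrite add0e.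
  have [N /(_ N (leqnn N)) HN] := phif _ e0; apply: le_trans HN.
  apply: le_Lnorm => //; first exact/measurable_EFinP.
    apply/measurable_EFinP; apply: measurable_funB => //.
    exact: test_function_measurable (tphi N).
  move=> x; rewrite !abse_EFin lee_fin /w indicE.
  have [Ox|Ox] := pselect (Omega x).
    by rewrite memNset ?mulr0 ?normr0//; apply.
  by rewrite mem_set// mulr1 (test_function_notin (tphi N) Ox) sub0r normrN.
have := @Lnorm_eq0_eq0 _ _ _ leb (EFin \o w) p%:E.
move=> /(_ _ _ w0) []; [exact/measurable_EFinP|by rewrite lte_fin|].
move=> Z [mZ Z0 ZP]; exists Z; split => // x nx; apply: ZP => /=; apply: contra_not nx.
move=> /(_ I) []; rewrite /w indicE => H Ox; move: H.
by rewrite mem_set// mulr1.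
Qed.

End sobolev_wgrad.

(** * Eigenvalues *)

Section eigenvalues.
Context {R : realType} {n m : nat} (p : R) (Q : set 'rV[R]_m).
Hypotheses (n_gt0 : (0 < n)%N) (m_gt0 : (0 < m)%N) (p_ge1 : 1 <= p).
Hypotheses (Qbody : convex_body Q) (Q0 : Q° 0).
Local Notation Rn := 'rV[R]_n.
Local Notation leb := (@lebesgue_mx R 1 n).
Let p0 : 0 < p. Proof. exact: lt_le_trans p_ge1. Qed.

(* Some coordinate of a unit vector is at least [1 / n] in absolute value. *)
Lemma unit_shift (r : R) (v x : Rn) : 0 < r -> enorm v = 1 ->
  open_box r x -> ~ open_box r ((2 * n%:R * r) *: v + x).
Proof.
move=> r0 v1 bx bs.
have n0 : 0 < n%:R :> R by rewrite ltr0n.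
have small i : `|v 0 i| < n%:R^-1.
  have := bx i; have := bs i; rewrite !mxE => h1 h2.
  rewrite -(ltr_pM2l n0) divff ?gt_eqF//.
  have : 2 * r * (n%:R * `|v 0 i|) < 2 * r.
    have -> : 2 * r * (n%:R * `|v 0 i|) = `|2 * n%:R * r * v 0 i|.
      by rewrite normrM ger0_norm ?mulr_ge0 ?(ltW r0)//; ring.
    rewrite -[X in `|X|](addrK (x 0 i)); apply: le_lt_trans (ler_normB _ _) _.
    by rewrite (_ : 2 * r = r + r) ?ltrD//; ring.
  by rewrite -[X in _ < X -> _]mulr1 ltr_pM2l// mulr_gt0.
have := enorm_le_sum v; rewrite v1 leNgt => /negP; apply.
have -> : 1 = \sum_(i < n) n%:R^-1 :> R.
  by rewrite sumr_const card_ord -[RHS]mulr_natr mulVf ?gt_eqF.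
apply: ltr_sum => //.
by apply/hasP; exists (Ordinal n_gt0); rewrite ?mem_index_enum.
Qed.

(** [c] is fixed before the measure and the field, so it survives the infimum over all functions. *)
Lemma energy_constant : exists2 c : R, 0 < c &
  forall d (T : measurableType d) (mu : {sigma_finite_measure set T -> \bar R}) (g : T -> Rn)
    (K : R), measurable_fun setT g -> 0 < K ->
    (forall v, enorm v = 1 -> (K%:E <= Lnorm mu p%:E (fun x => (dotv (g x) v)%:E))%E) ->
    ((c * K)%:E <= field_energy p Q mu g)%E.
Proof.
have [r r0 hr] := enorm_support_le Qbody Q0.
have D0 := d_const_gt0 n_gt0 m_gt0 p_ge1 Qbody Q0.
(* [d_const_gt0] gives positivity in the extended reals, so a real positive lower bound is
   extracted. *)
have [D' D'0 D'D] : exists2 D' : R, 0 < D' & (D'%:E <= @d_const R n m p Q)%E.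
  move: D0; case: (@d_const R n m p Q) => [D||]//; last by exists 1; rewrite ?leey.
  by rewrite lte_fin => D0; exists D.
set S := @sphere_measure R n m (@esphere R n m).
have S0 : 0 < fine S.
  have nm0 : (0 < n * m)%N by rewrite muln_gt0 n_gt0.
  have mS := @measurable_esphere R n m.
  have Sfin : S \is a fin_num by exact: fin_num_measure.
  rewrite lt0r fine_ge0 ?measure_ge0// andbT; apply/eqP => S0.
  have ST : @sphere_measure R n m setT = (S + @sphere_measure R n m (~` (@esphere R n m)))%E.
    by rewrite -measureU ?setUv ?setICr//; exact: measurableC.
  have SC : @sphere_measure R n m (~` (@esphere R n m)) = 0%E by exact: sphere_measure_setC.
  by have := sphere_measure_gt0 (R := R) nm0; rewrite ST SC -(fineK Sfin) S0 adde0 ltxx.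
exists (D' * ((r / Num.sqrt m%:R) / fine S `^ (n * m)%:R^-1)).
  by rewrite mulr_gt0// !divr_gt0// ?powR_gt0// sqrtr_gt0 ltr0n.
move=> d T mu g K mg K0 HK.
have Hu (u : Rn) : ((enorm u * K)%:E <= Lnorm mu p%:E (fun x => (dotv (g x) u)%:E))%E.
  have [->|u0] := eqVneq u 0; first by rewrite enorm0 mul0r Lnorm_ge0.
  have := HK (radial u) (enorm_radial u0).
  move=> /(lee_wpmul2l (_ : 0 <= (enorm u)%:E)%E); rewrite lee_fin enorm_ge0 => /(_ isT).
  rewrite -EFinM => /le_trans; apply.
  rewrite -LnormMl ?enorm_ge0//.
    rewrite le_eqVlt; apply/orP; left; apply/eqP; congr Lnorm; apply/funext => x.
    by rewrite -dotvZr radial_enorm.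
  exact: measurable_dotv.
apply: le_trans (field_energy_ge n_gt0 m_gt0 p_ge1 Qbody Q0 mg r0 K0 hr Hu).
apply: (@le_trans _ _ (D'%:E * (K * (r / Num.sqrt m%:R) / fine S `^ (n * m)%:R^-1)%:E)%E).
  by rewrite -EFinM lee_fin le_eqVlt; apply/orP; left; apply/eqP; ring.
apply: lee_wpmul2r D'D.
by rewrite lee_fin !mulr_ge0 ?invr_ge0 ?powR_ge0 ?sqrtr_ge0 ?(ltW K0) ?(ltW r0).
Qed.

Variables (Omega : set Rn) (r : R).
Hypotheses (r0 : 0 < r) (Or : Omega `<=` open_box r) (mO : measurable Omega).
(** A unit vector has a coordinate of size at least 1/n, so this displacement is at least the width
    2r of the box along some axis. *)
Let T : R := 2 * n%:R * r.
Let T0 : 0 < T. Proof. by rewrite !mulr_gt0// ltr0n. Qed.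

(** The interface that hides whether p = 1. The field norm is only bounded by [E]: for p = 1 this is
    what the almost everywhere bound 1 on [bv_eta] gives. *)
Let energy_data (f : Rn -> R) (E : \bar R) :=
  exists d (X : measurableType d) (mu : {sigma_finite_measure set X -> \bar R}) (g : X -> Rn),
  [/\ measurable_fun setT g, affine_energy p Q f = field_energy p Q mu g,
      (Lnorm mu p%:E (fun x => (enorm (g x))%:E) <= E)%E &
      forall v, enorm v = 1 ->
        (Lp_norm p Omega f <= T%:E * Lnorm mu p%:E (fun x => (dotv (g x) v)%:E))%E].

Lemma W0_vanish f : W0 p Omega f -> {ae leb, forall x, ~ Omega x -> f x = 0}.
Proof.
rewrite /W0/=; case: eqP => [_ []//|/eqP pn1 sf].
by apply: sobolev0_vanish sf mO; rewrite lt_neqAle eq_sym pn1.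
Qed.

Lemma W0_measurable f : W0 p Omega f -> measurable_fun setT f.
Proof.
rewrite /W0/=; case: eqP => [_ [[/integrableP[+ _] _] _]|_ []//].
by move/measurable_EFinP.
Qed.

(** [Lp_norm] sees only Omega, while [ae_zero] concerns the whole space; [W0_vanish] bridges the
    two. *)
Lemma Lp_norm_gt0 f : (W0 p Omega `\` ae_zero) f -> (0 < Lp_norm p Omega f)%E.
Proof.
move=> [Wf nf]; rewrite lt0e Lnorm_ge0 andbT; apply/eqP => N0; apply: nf.
have mf := W0_measurable Wf.
have mfO : measurable_fun setT (f \_ Omega).
  by apply/(measurable_restrictT _ mO); exact: measurable_funTS.
have := @Lnorm_eq0_eq0 _ _ _ leb (EFin \o (f \_ Omega)) p%:E.
move=> /(_ _ _ N0) []; [exact/measurable_EFinP|by rewrite lte_fin|].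
move=> Z ZP; have : {ae leb, forall x, (EFin \o f \_ Omega) x = \0%E x}.
  by exists Z; case: ZP => mZ Z0 ZP; split => // x nx; apply: ZP => /=; apply: contra_not nx; exact.
move=> H; apply: filterS2 (W0_vanish Wf) H => x fx /= [].
rewrite patchE; have [Ox|Ox] := pselect (Omega x); first by rewrite mem_set.
by move=> _; exact: fx.
Qed.

Lemma W0_energy f : W0 p Omega f -> energy_data f (grad_norm p f) /\ (grad_norm p f < +oo)%E.
Proof.
move=> Wf; have mf := W0_measurable Wf.
have mfO : measurable_fun setT (f \_ Omega).
  by apply/(measurable_restrictT _ mO); exact: measurable_funTS.
move: Wf; rewrite /W0 /energy_data /affine_energy /grad_norm /hQ_norm /=.
case: eqP => [p1 [bvf f0]|/eqP pn1 sf].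
  split; last by rewrite -ge0_fin_numE// fin_num_measure.
  have meta : measurable_fun setT (bv_eta f) by exact: measurable_vec_density.
  exists _, _, (bv_variation f), (bv_eta f); split => //.
  - congr (_ * (_ `^ _)^-1)%E; apply: eq_integral => th _; congr (_ ^+ _)^-1%E.
    rewrite p1 Lnorm1; apply: eq_integral => x _ /=.
    by rewrite /hfield ger0_norm// support_ge0.
  - rewrite p1 Lnorm1; apply: (@le_trans _ _ (\int[bv_variation f]_x (cst 1%E x))%E); last first.
      by rewrite integral_cst// mul1e.
    apply: ae_ge0_le_integral => //.
    + apply/measurable_EFinP; apply: measurableT_comp => //.
      by apply: measurableT_comp meta; exact: measurable_enorm.
    + apply: filterS (enorm_density_le1 (bvD f)) => x H _ /=.
      by rewrite lee_fin ger0_norm ?enorm_ge0.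
  - move=> v v1; rewrite /Lp_norm p1 !Lnorm1.
    have := bv_poincare (ltW r0) (ltW T0) bvf f0 Or (fun x => unit_shift r0 v1).
    apply: le_trans; rewrite [leRHS]integral_mkcond; apply: ge0_le_integral => //.
    + by apply/measurable_EFinP; exact: measurableT_comp.
    + apply/(measurable_restrictT _ (measurable_open_box _)); apply: measurable_funTS.
      by apply/measurable_EFinP; exact: measurableT_comp.
    + move=> x _; rewrite /= !patchE; case: ifPn => [/set_mem/Or Ox|_]; first by rewrite mem_set.
      by rewrite normr0; case: ifP => // _; rewrite lee_fin.
have p1 : 1 < p by rewrite lt_neqAle eq_sym pn1.
split; last exact: sobolev0_wgrad_lty p1 sf.
exists _, _, leb, (wgrad f); split => //; first exact: measurable_wgrad p1 sf.
move=> v v1; apply: le_trans (sobolev0_poincare p1 sf T0 _).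
  apply: le_Lnorm => //; try exact/measurable_EFinP.
  by move=> x; rewrite /= !lee_fin patchE; case: ifP => // _; rewrite normr0.
by move=> x /Or Ox /Or; exact: unit_shift.
Qed.

End eigenvalues.

Lemma bounded_open_box {R : realType} {n : nat} (A : set 'rV[R]_n) :
  bounded_set A -> exists2 r : R, 0 < r & A `<=` open_box r.
Proof.
move=> /bounded_set_enorm[r r0 Ar]; exists (r + 1); first by rewrite addr_gt0.
move=> x /Ar xr i; apply: le_lt_trans (normr_le_enorm x 0 i) _.
by apply: le_lt_trans xr _; rewrite ltrDl.
Qed.

Theorem proposition1p5 (R : realType) (n m : nat) (p : R)
    (Q : set 'rV[R]_m) (Omega : set 'rV[R]_n)
    (n_gt0 : (0 < n)%N) (m_gt0 : (0 < m)%N) (p_ge1 : 1 <= p)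
    (Qbody : convex_body Q) (Q0 : Q° 0)
    (Omega_bounded : bounded_set Omega) (Omega_open : open Omega) :
  exists d : R, 0 < d /\
    (lambda1_affine p Q Omega <= lambda1 p Omega)%E /\
    (d%:E * lambda1 p Omega `^ ((n * m)%N%:R^-1) <= lambda1_affine p Q Omega)%E.
Proof.
have p0 : 0 < p by exact: lt_le_trans p_ge1.
have mO := measurable_open_mx Omega_open.
have [r r0 Or] := bounded_open_box Omega_bounded.
have [c c0 Hc] := energy_constant n_gt0 m_gt0 p_ge1 Qbody Q0.
pose T : R := 2 * n%:R * r; have T0 : 0 < T by rewrite !mulr_gt0// ltr0n.
pose F := W0 p Omega `\` ae_zero.
have main f : F f -> exists l : R, [/\ 0 < l, Lp_norm p Omega f = l%:E,
    (affine_energy p Q f <= grad_norm p f)%E,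
    (grad_norm p f < +oo)%E & ((c * (l / T))%:E <= affine_energy p Q f)%E].
  move=> Ff; have L0 := Lp_norm_gt0 p_ge1 mO Ff.
  have [[d [X [mu [g [mg -> gE HL]]]]] gfin] := W0_energy n_gt0 p_ge1 Qbody Q0 r0 Or mO Ff.1.
  have e1 := @enorm_delta R n (Ordinal n_gt0).
  have mdot v := measurable_dotv v mg.
  have menorm : measurable_fun setT (fun x => enorm (g x)).
    by apply: measurableT_comp mg; exact: measurable_enorm.
  (* The Poincare inequality along a coordinate direction bounds the norm by [T] times the finite
     gradient norm. *)
  have Lfin : Lp_norm p Omega f \is a fin_num.
    rewrite ge0_fin_numE ?Lnorm_ge0//; apply: le_lt_trans (HL _ e1) _.
    rewrite lte_mul_pinfty ?lee_fin ?(ltW T0)//; apply: le_lt_trans gfin.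
    apply: le_trans gE; apply: le_Lnorm => //; try exact/measurable_EFinP.
    move=> x; rewrite /= lee_fin (ger0_norm (enorm_ge0 _)).
    by apply: le_trans (normr_dotv_le _ _) _; rewrite e1 mulr1.
  have l0 : 0 < fine (Lp_norm p Omega f) by rewrite fine_gt0// L0 -ge0_fin_numE ?Lnorm_ge0.
  exists (fine (Lp_norm p Omega f)); split => //.
  - by rewrite fineK.
  - exact: le_trans (field_energy_le n_gt0 m_gt0 p_ge1 Qbody Q0 mu mg) gE.
  (* With [K = l / T], the norm [l] cancels in the quotient, which is then at least (c/T)^p. *)
  - apply: Hc => //; first by rewrite divr_gt0.
    move=> v v1; rewrite mulrC EFinM (fineK Lfin) lee_pdivrMl//.
    exact: HL.
have quotient f : F f -> ((((c / T) `^ p)%:E <=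
      affine_energy p Q f `^ p / Lp_norm p Omega f `^ p) /\
    (affine_energy p Q f `^ p / Lp_norm p Omega f `^ p <=
      grad_norm p f `^ p / Lp_norm p Omega f `^ p) /\
    (grad_norm p f `^ p / Lp_norm p Omega f `^ p < +oo))%E.
  move=> /main[l [l0 -> Ag gfin cA]].
  have A0 : (0 <= (c * (l / T))%:E)%E by rewrite lee_fin mulr_ge0 ?divr_ge0// ltW.
  have lp : (l%:E `^ p)^-1%E = ((l `^ p)^-1)%:E.
    by rewrite poweR_EFin inver gt_eqF// powR_gt0.
  have lp0 : (0 <= ((l `^ p)^-1)%:E)%E by rewrite lee_fin invr_ge0 powR_ge0.
  rewrite lp; split; [|split].
  - apply: le_trans (lee_wpmul2r lp0 (le_poweR (ltW p0) A0 cA)).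
    rewrite poweR_EFin -EFinM lee_fin mulrCA (powRM p (ltW l0) (ltW (divr_gt0 c0 T0))).
    by rewrite mulrAC divff ?mul1r// gt_eqF// powR_gt0.
  - by apply: lee_wpmul2r => //; apply: le_poweR => //; [exact: ltW|exact: le_trans cA].
  - rewrite muleC lte_mul_pinfty//; apply: poweR_lty => //.
have le1 : (lambda1_affine p Q Omega <= lambda1 p Omega)%E.
  apply: le_ereal_inf_tmp => _ [f Ff <-].
  apply: ge_ereal_inf; exists (affine_energy p Q f `^ p / Lp_norm p Omega f `^ p)%E; first by exists f.
  exact: (quotient f Ff).2.1.
have cpos : 0 < (c / T) `^ p by rewrite powR_gt0// divr_gt0.
have le2 : (((c / T) `^ p)%:E <= lambda1_affine p Q Omega)%E.
  by apply: le_ereal_inf_tmp => _ [f Ff <-]; exact: (quotient f Ff).1.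
(* With no admissible function both infima are +oo, and any positive constant will do. *)
have [F0|/set0P[f Ff]] := eqVneq F set0.
  by exists 1; split => //; split => //; rewrite /lambda1_affine -/F F0 image_set0 ereal_inf0 leey.
have fin1 : (lambda1 p Omega < +oo)%E.
  by apply: le_lt_trans (quotient f Ff).2.2; apply: ereal_inf_lbound; exists f.
(* So [lambda1] is a positive real, and its power can be divided out. *)
have : (((c / T) `^ p)%:E <= lambda1 p Omega)%E by exact: le_trans le1.
move: fin1 le1; case: (lambda1 p Omega) => [l||]// _ le1; rewrite lee_fin => cl.
have l0 : 0 < l by exact: lt_le_trans cl.
exists ((c / T) `^ p / (l `^ ((n * m)%N%:R^-1))); split; first by rewrite divr_gt0// powR_gt0.
by split => //; rewrite poweR_EFin -EFinM divfK// gt_eqF// powR_gt0.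
Qed.
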